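(* Let $\Gamma_1$ and $\Gamma_2$ be groups, and let $\Lambda$ be a group acting on both $\Gamma_1$ and $\Gamma_2$ by automorphisms. Let $\Lambda$ act on the free product $\Gamma_1*\Gamma_2$ via the induced action. If $\Gamma_1$ and $\Gamma_2$ both have property FD relative to $\Lambda$, then so does $\Gamma_1*\Gamma_2$.
   Context: Groups are discrete. $C^*\Gamma$ is the full group $C^*$-algebra: the completion of $\mathbb{C}[\Gamma]$ in the norm $\|a\|=\sup\|\pi(a)\|$ over all unitary representations $\pi$ of $\Gamma$. A collection $S$ of unitary representations of $\Gamma$ is dense in the Fell topology if (equivalently) for every nonzero $a\in C^*\Gamma$ there is $\sigma\in S$ with $\sigma(a)\ne0$. Let a group $\Lambda$ act on $\Gamma$ via a homomorphism $\alpha\colon\Lambda\to\mathrm{Aut}(\Gamma)$. Then $\Gamma$ has property FD relative to $\alpha$ (or relative to $\Lambda$) if the collection of unitary representations $\pi$ of $\Gamma$ that factor through a finite quotient of $\Gamma$ and for which $\{\pi\circ\alpha_l\mid l\in\Lambda\}$ is finite up to unitary equivalence is dense in the Fell topology. *)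

(* Defs.v *)
From HB Require Import structures.
From mathcomp Require Import all_boot all_order all_algebra all_fingroup finmap.
From mathcomp Require Import all_classical all_reals all_analysis complex.
From mathcomp Require multinomials.monalg.
(* Importing the notations of monalg would clash with those of analysis. *)
Import (canonicals, coercions) mathcomp.multinomials.monalg.

Set Implicit Arguments.
Unset Strict Implicit.
Unset Printing Implicit Defensive.

Import Order.TTheory GRing.Theory Num.Theory.
Import numFieldNormedType.Exports.
Local Open Scope classical_set_scope.
Local Open Scope ring_scope.
Local Open Scope complex_scope.
Local Open Scope quotient_scope.

Record hilbertSpace (R : realType) := HilbertSpace {
  hs_carrier :> completeNormedModType R[i];
  hs_dot : {dot hs_carrier for Num.conj};
  hs_normE : forall v : hs_carrier, `|v| ^+ 2 = hs_dot v v }.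

(* Each [rep_map g] is onto, being inverse to [rep_map g^-1], so preserving the
   inner product makes it a unitary operator. *)
Record unirep (R : realType) (G : groupType) (H : hilbertSpace R) := UniRep {
  rep_map :> G -> {linear H -> H};
  rep_map1 : forall v, rep_map 1%g v = v;
  rep_mapM : forall g h v, rep_map (g * h)%g v = rep_map g (rep_map h v);
  rep_unitary : forall g u v,
    hs_dot H (rep_map g u) (rep_map g v) = hs_dot H u v }.

Arguments UniRep {R G H} rep_map rep_map1 rep_mapM rep_unitary.

Definition unitarily_equivalent (R : realType) (G : groupType)
    (H K : hilbertSpace R) (pi : unirep G H) (rho : unirep G K) : Prop :=
  exists U : {linear H -> K},
    [/\ set_bij setT setT U,
        forall u v, hs_dot K (U u) (U v) = hs_dot H u v &
        forall g v, U (pi g v) = rho g (U v)].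

Notation group_algebra R G := (monalg.malg G R[i]).

Section FullGroupAlgebra.
Variables (R : realType) (G : groupType).
Implicit Types (a b c : group_algebra R G) (H : hilbertSpace R).

Definition rep_alg H (pi : unirep G H) a (v : H) : H :=
  \sum_(g <- monalg.msupp a) monalg.mcoeff g a *: pi g v.

(* The norm of a normed R[i]-module has values in R[i], hence the real part. *)
Definition opnorm H (T : H -> H) : R :=
  sup [set complex.Re `|T v| | v in [set v : H | `|v| <= 1]].

Definition full_norm a : R :=
  sup [set r : R | exists (H : hilbertSpace R) (pi : unirep G H),
                     r = opnorm (rep_alg pi a)].

Lemma rep_algEw H (pi : unirep G H) a (d : {fset G}) (v : H) :
  (monalg.msupp a `<=` d)%fset ->
  rep_alg pi a v = \sum_(g <- d) monalg.mcoeff g a *: pi g v.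
Proof.
move=> sad; rewrite /rep_alg (big_fset_incl _ sad)// => g _ ga.
by rewrite (monalg.mcoeff_outdom ga) scale0r.
Qed.

Lemma rep_alg0 H (pi : unirep G H) v : rep_alg pi 0 v = 0.
Proof. by rewrite /rep_alg monalg.msupp0 big_seq_fset0. Qed.

Lemma rep_algB H (pi : unirep G H) a b v :
  rep_alg pi (a - b) v = rep_alg pi a v - rep_alg pi b v.
Proof.
pose d := (monalg.msupp a `|` monalg.msupp b)%fset.
rewrite !(@rep_algEw _ _ _ d) ?fsubsetUl ?fsubsetUr ?monalg.msuppB_le//.
rewrite -sumrB; apply: eq_bigr => g _.
by rewrite monalg.mcoeffB scalerBl.
Qed.

Lemma rep_isometry H (pi : unirep G H) g v : `|pi g v| = `|v|.
Proof.
apply/eqP; rewrite -(@eqrXn2 _ 2)//; apply/eqP.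
by rewrite !hs_normE rep_unitary.
Qed.

Let l1norm a : R := \sum_(g <- monalg.msupp a) complex.Re `|monalg.mcoeff g a|.

Lemma complex_ge0_Re (z : R[i]) : 0 <= z -> (complex.Re z)%:C = z.
Proof. by case: z => x y; rewrite lecE /= => /andP[/eqP-> _]. Qed.

Lemma Re_normK (V : normedModType R[i]) (v : V) : (complex.Re `|v|)%:C = `|v|.
Proof. exact/complex_ge0_Re/normr_ge0. Qed.

Lemma Re_norm_ge0 (V : normedModType R[i]) (v : V) : 0 <= complex.Re `|v|.
Proof. by rewrite -lecR Re_normK; exact: normr_ge0. Qed.

Lemma rep_alg_le H (pi : unirep G H) a v :
  complex.Re `|rep_alg pi a v| <= l1norm a * complex.Re `|v|.
Proof.
rewrite -lecR rmorphM/= Re_normK Re_normK rmorph_sum/= mulr_suml.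
apply: le_trans (ler_norm_sum _ _ _) _; apply: ler_sum => g _.
by rewrite normrZ rep_isometry (@Re_normK R[i]^o).
Qed.

Lemma opnorm_has_sup H (pi : unirep G H) a :
  has_sup [set complex.Re `|rep_alg pi a v| | v in [set v : H | `|v| <= 1]].
Proof.
split; first by exists (complex.Re `|rep_alg pi a 0|), 0; rewrite //= normr0.
exists (l1norm a) => _ [v /= v1 <-]; apply: le_trans (rep_alg_le pi a v) _.
rewrite ler_piMr//; last by rewrite -lecR Re_normK.
by rewrite sumr_ge0// => g _; exact: (@Re_norm_ge0 R[i]^o).
Qed.

Lemma opnorm_ub H (pi : unirep G H) a v : `|v| <= 1 ->
  complex.Re `|rep_alg pi a v| <= opnorm (rep_alg pi a).
Proof. by move=> v1; apply: (ub_le_sup (opnorm_has_sup pi a).2); exists v. Qed.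

Lemma opnorm_le H (pi : unirep G H) a (M : R) :
  (forall v, `|v| <= 1 -> complex.Re `|rep_alg pi a v| <= M) ->
  opnorm (rep_alg pi a) <= M.
Proof.
by move=> aM; apply: (ge_sup (opnorm_has_sup pi a).1) => _ [v /= v1 <-]; exact: aM.
Qed.

Lemma opnorm_ge0 H (pi : unirep G H) a : 0 <= opnorm (rep_alg pi a).
Proof.
apply: (@le_trans _ _ (complex.Re `|rep_alg pi a 0|)).
  exact: Re_norm_ge0.
by apply: opnorm_ub; rewrite normr0.
Qed.

Lemma full_norm_ub H (pi : unirep G H) a : opnorm (rep_alg pi a) <= full_norm a.
Proof.
apply: ub_le_sup; last by exists H, pi.
exists (l1norm a) => _ [K [rho ->]]; apply: opnorm_le => v v1.
apply: le_trans (rep_alg_le rho a v) _; rewrite ler_piMr//.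
  by rewrite sumr_ge0// => g _; exact: (@Re_norm_ge0 R[i]^o).
by rewrite -lecR Re_normK.
Qed.

Lemma full_norm_le a (M : R) : 0 <= M ->
  (forall H (pi : unirep G H), opnorm (rep_alg pi a) <= M) -> full_norm a <= M.
Proof.
move=> M0 aM; rewrite /full_norm; set S := [set _ | _].
have [->|S0] := eqVneq S set0; first by rewrite sup0.
by apply: ge_sup => [|_ [H [pi ->]]]; [exact/set0P|exact: aM].
Qed.

Lemma full_norm_ge0 a : 0 <= full_norm a.
Proof.
have [S0|/set0P[_ [H [pi _]]]] := eqVneq
    [set r : R | exists H (pi : unirep G H), r = opnorm (rep_alg pi a)] set0.
  by rewrite /full_norm S0 sup0.
exact: le_trans (opnorm_ge0 pi a) (full_norm_ub pi a).
Qed.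

Lemma full_norm0 : full_norm 0 = 0.
Proof.
apply/eqP; rewrite eq_le full_norm_ge0 andbT; apply: full_norm_le => // H pi.
by apply: opnorm_le => v _; rewrite rep_alg0 normr0.
Qed.

Lemma full_norm_distC a b : full_norm (a - b) = full_norm (b - a).
Proof.
suff le c d : full_norm (c - d) <= full_norm (d - c) by apply/eqP; rewrite eq_le !le.
apply: full_norm_le => [|H pi]; first exact: full_norm_ge0.
apply: le_trans (full_norm_ub pi _); apply: opnorm_le => v v1.
by rewrite rep_algB distrC -rep_algB opnorm_ub.
Qed.

Lemma full_norm_triangle b a c :
  full_norm (a - c) <= full_norm (a - b) + full_norm (b - c).
Proof.
apply: full_norm_le => [|H pi]; first by rewrite addr_ge0 ?full_norm_ge0.
apply: opnorm_le => v v1.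
apply: (@le_trans _ _ (complex.Re `|rep_alg pi (a - b) v| +
                       complex.Re `|rep_alg pi (b - c) v|)).
  by rewrite -lecR rmorphD/= !Re_normK !rep_algB ler_distD.
by apply: lerD; apply: le_trans (full_norm_ub pi _); exact: opnorm_ub.
Qed.

(* C*(G) is the completion of C[G] in the full norm: Cauchy sequences modulo
   null sequences. *)
Definition full_cauchy (a : nat -> group_algebra R G) : Prop :=
  forall e : R, 0 < e -> exists N : nat, forall m n,
    (N <= m)%N -> (N <= n)%N -> full_norm (a m - a n) < e.

Definition cauchy_seq := {a : nat -> group_algebra R G | `[< full_cauchy a >]}.

HB.instance Definition _ := Choice.on cauchy_seq.

Definition cauchy_equiv (a b : cauchy_seq) : bool :=
  `[< full_norm (val a n - val b n) @[n --> \oo] --> (0 : R) >].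

Lemma cauchy_equiv_refl : reflexive cauchy_equiv.
Proof.
move=> a; apply/asboolP; under eq_fun do rewrite subrr full_norm0.
exact: cvg_cst.
Qed.

Lemma cauchy_equiv_sym : symmetric cauchy_equiv.
Proof.
move=> a b; rewrite /cauchy_equiv; congr (`[< _ >]).
by under eq_fun do rewrite full_norm_distC.
Qed.

Lemma cauchy_equiv_trans : transitive cauchy_equiv.
Proof.
move=> b a c /asboolP ab /asboolP bc; apply/asboolP.
apply: (squeeze_cvgr _ (cvg_cst 0)); last first.
  by rewrite -[X in _ --> X]addr0; exact: (cvgD ab bc).
by near=> n; rewrite full_norm_ge0/= full_norm_triangle.
Unshelve. all: end_near. Qed.

Canonical cauchy_equivR :=
  EquivRel cauchy_equiv cauchy_equiv_refl cauchy_equiv_sym cauchy_equiv_trans.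

Definition full_cstar := {eq_quot cauchy_equivR}.

Fact zero_cauchy : `[< full_cauchy (fun=> 0) >].
Proof.
by apply/asboolP => e e0; exists 0%N => m n _ _; rewrite subrr full_norm0.
Qed.

Definition cstar0 : full_cstar := \pi_full_cstar (exist _ (fun=> 0) zero_cauchy).

(* The extension of pi to C*(G), evaluated at the vector v. *)
Definition rep_cstar H (pi : unirep G H) (a : full_cstar) (v : H) : H :=
  lim (rep_alg pi (val (generic_quotient.repr a) n) v @[n --> \oo]).

Lemma rep_algZ H (pi : unirep G H) a (c : R[i]) v :
  rep_alg pi a (c *: v) = c *: rep_alg pi a v.
Proof.
rewrite /rep_alg scaler_sumr; apply: eq_bigr => g _.
by rewrite linearZ/= !scalerA mulrC.
Qed.

Lemma rep_alg_le_full H (pi : unirep G H) a v :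
  `|rep_alg pi a v| <= (full_norm a)%:C * `|v|.
Proof.
have [->|v0] := eqVneq v 0.
  by rewrite -[X in rep_alg _ _ X](scale0r (0 : H)) rep_algZ scale0r !normr0 mulr0.
have nv0 : `|v| != 0 by rewrite normr_eq0.
have v1 : `| (`|v|^-1 *: v) | <= 1.
  by rewrite normrZ normfV normr_id mulVf.
have := le_trans (opnorm_ub pi a v1) (full_norm_ub pi a).
rewrite -lecR Re_normK rep_algZ normrZ normfV normr_id mulrC.
by rewrite ler_pdivrMr// normr_gt0.
Qed.

Lemma rep_cstarE H (pi : unirep G H) (a : cauchy_seq) v :
  rep_alg pi (val a n) v @[n --> \oo] --> rep_cstar pi (\pi_full_cstar a) v.
Proof.
have cvgE (b : cauchy_seq) : cvg (rep_alg pi (val b n) v @[n --> \oo]).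
  apply: cauchy_cvg; apply: cauchy_exP => e e0.
  have de : (complex.Re e)%:C = e by exact/complex_ge0_Re/ltW.
  have d0 : 0 < complex.Re e by rewrite -ltcR de.
  pose M := complex.Re `|v| + 1.
  have M0 : 0 < M by rewrite ltr_wpDl// Re_norm_ge0.
  have vM : `|v| <= M%:C by rewrite rmorphD/= Re_normK rmorph1 lerDl.
  have /asboolP/(_ (complex.Re e / M))[|N bN] := valP b; first exact: divr_gt0.
  exists (rep_alg pi (val b N) v); exists N => // n /= Nn.
  rewrite -ball_normE/= -rep_algB.
  apply: le_lt_trans (rep_alg_le_full _ _ _) _.
  have full0 : 0 <= (full_norm (val b N - val b n))%:C.
    by rewrite lecR full_norm_ge0.
  apply: le_lt_trans (ler_wpM2l full0 vM) _.
  by rewrite -rmorphM/= -de ltcR -ltr_pdivlMr// bN.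
rewrite /rep_cstar; set b := generic_quotient.repr _.
have /asboolP ab : cauchy_equiv a b.
  by apply/(@eqquotP _ cauchy_equivR full_cstar); rewrite reprK.
rewrite -[X in _ --> X]addr0.
have -> : (fun n => rep_alg pi (val a n) v) =
  (fun n => rep_alg pi (val b n) v + rep_alg pi (val a n - val b n) v).
  by apply/funext => n; rewrite rep_algB addrC subrK.
apply: cvgD; first exact: cvgE.
apply/cvgr0Pnorm_lt => e e0.
have de : (complex.Re e)%:C = e by exact/complex_ge0_Re/ltW.
have d0 : 0 < complex.Re e by rewrite -ltcR de.
pose M := complex.Re `|v| + 1.
have M0 : 0 < M by rewrite ltr_wpDl// Re_norm_ge0.
have vM : `|v| <= M%:C by rewrite rmorphD/= Re_normK rmorph1 lerDl.
have /cvgr0Pnorm_lt/(_ _ (divr_gt0 d0 M0)) := ab.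
apply: filterS => n; rewrite ger0_norm ?full_norm_ge0// => abn.
apply: le_lt_trans (rep_alg_le_full _ _ _) _.
have full0 : 0 <= (full_norm (val a n - val b n))%:C.
  by rewrite lecR full_norm_ge0.
apply: le_lt_trans (ler_wpM2l full0 vM) _.
by rewrite -rmorphM/= -de ltcR -ltr_pdivlMr.
Qed.

End FullGroupAlgebra.

Definition fell_dense (R : realType) (G : groupType)
    (S : forall H : hilbertSpace R, unirep G H -> Prop) : Prop :=
  forall a : full_cstar R G, a <> cstar0 R G ->
    exists (H : hilbertSpace R) (sigma : unirep G H),
      S H sigma /\ exists v : H, rep_cstar sigma a v <> 0.

(* A homomorphism from L to Aut(G). *)
Record group_action (L G : groupType) := GroupAct {
  act :> L -> G -> G;
  act_morph : forall l, {morph act l : x y / (x * y)%g};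
  act1 : forall x, act 1%g x = x;
  actM : forall l m x, act (l * m)%g x = act l (act m x) }.

Arguments GroupAct {L G} act act_morph act1 actM.

Section RelativeFD.
Variables (R : realType) (L G : groupType) (alpha : group_action L G).
Variables (H : hilbertSpace R) (pi : unirep G H).

Lemma action1 l : alpha l 1%g = 1%g.
Proof. by apply: (@mulgI _ (alpha l 1%g)); rewrite -act_morph !mulg1. Qed.

Fact twist1 l v : pi (alpha l 1%g) v = v.
Proof. by rewrite action1 rep_map1. Qed.

Fact twistM l g h v :
  pi (alpha l (g * h)%g) v = pi (alpha l g) (pi (alpha l h) v).
Proof. by rewrite act_morph rep_mapM. Qed.

Definition twist (l : L) : unirep G H :=
  UniRep (fun g => pi (alpha l g)) (twist1 l) (twistM l)
    (fun g => rep_unitary pi (alpha l g)).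

Definition factors_through_finite_quotient : Prop :=
  exists (Q : finGroupType) (q : G -> Q) (rho : unirep Q H),
    [/\ {morph q : x y / (x * y)%g},
        forall z, exists x, q x = z &
        forall x v, pi x v = rho (q x) v].

Definition finite_orbit_up_to_equivalence : Prop :=
  finite_set (range (fun l =>
    [set rho : unirep G H | unitarily_equivalent rho (twist l)])).

End RelativeFD.

Definition property_FD_relative (R : realType) (L G : groupType)
    (alpha : group_action L G) : Prop :=
  fell_dense (fun (H : hilbertSpace R) (pi : unirep G H) =>
    factors_through_finite_quotient pi /\
    finite_orbit_up_to_equivalence alpha pi).

(* G1 * G2 is the monoid of words in the letters G1 + G2, modulo the congruence
   generated by the multiplication tables of G1 and G2. *)
Section FreeProduct.
Variables G1 G2 : groupType.

Local Notation word := (seq (G1 + G2)).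

Inductive word_congr : word -> word -> Prop :=
| WordRefl u : word_congr u u
| WordSym u v : word_congr u v -> word_congr v u
| WordTrans v u w : word_congr u v -> word_congr v w -> word_congr u w
| WordCat u u' v v' :
    word_congr u u' -> word_congr v v' -> word_congr (u ++ v) (u' ++ v')
| Word1l : word_congr [:: inl 1%g] [::]
| Word1r : word_congr [:: inr 1%g] [::]
| WordMl x y : word_congr [:: inl x; inl y] [:: inl (x * y)%g]
| WordMr x y : word_congr [:: inr x; inr y] [:: inr (x * y)%g].

Definition word_equiv (u v : word) : bool := `[< word_congr u v >].

Lemma word_equiv_refl : reflexive word_equiv.
Proof. by move=> u; apply/asboolP; exact: WordRefl. Qed.

Lemma word_equiv_sym : symmetric word_equiv.
Proof. by move=> u v; apply/asboolP/asboolP; exact: WordSym. Qed.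

Lemma word_equiv_trans : transitive word_equiv.
Proof.
by move=> v u w /asboolP uv /asboolP vw; apply/asboolP; exact: WordTrans vw.
Qed.

Canonical word_equivR :=
  EquivRel word_equiv word_equiv_refl word_equiv_sym word_equiv_trans.

Definition free_prod := {eq_quot word_equivR}.

HB.instance Definition _ := Choice.on free_prod.

Definition fp_pi (u : word) : free_prod := \pi_free_prod u.

Lemma fp_piP u v : word_congr u v <-> fp_pi u = fp_pi v.
Proof.
by split => [uv|/eqquotP/asboolP //]; apply/eqquotP/asboolP.
Qed.

Lemma fp_repr u : word_congr (generic_quotient.repr (fp_pi u)) u.
Proof. by apply/fp_piP; rewrite /fp_pi reprK. Qed.

Definition letterV (s : G1 + G2) : G1 + G2 :=
  match s with inl x => inl x^-1%g | inr y => inr y^-1%g end.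

Definition wordV (u : word) : word := rev (map letterV u).

Lemma letterVr s : word_congr [:: s; letterV s] [::].
Proof.
case: s => x /=.
- by apply: WordTrans (WordMl _ _) _; rewrite mulgV; exact: Word1l.
- by apply: WordTrans (WordMr _ _) _; rewrite mulgV; exact: Word1r.
Qed.

Lemma letterVl s : word_congr [:: letterV s; s] [::].
Proof.
case: s => x /=.
- by apply: WordTrans (WordMl _ _) _; rewrite mulVg; exact: Word1l.
- by apply: WordTrans (WordMr _ _) _; rewrite mulVg; exact: Word1r.
Qed.

Lemma wordVr u : word_congr (u ++ wordV u) [::].
Proof.
elim: u => [|s u IHu]; first exact: WordRefl.
have -> : (s :: u) ++ wordV (s :: u) =
    [:: s] ++ ((u ++ wordV u) ++ [:: letterV s]).
  by rewrite /wordV/= rev_cons -cats1 catA.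
apply: WordTrans (letterVr s).
exact: WordCat (WordRefl [:: s]) (WordCat IHu (WordRefl [:: letterV s])).
Qed.

Lemma wordVl u : word_congr (wordV u ++ u) [::].
Proof.
elim: u => [|s u IHu]; first exact: WordRefl.
have -> : wordV (s :: u) ++ (s :: u) =
    wordV u ++ ([:: letterV s; s] ++ u).
  by rewrite /wordV/= rev_cons -cats1 -catA.
apply: WordTrans IHu.
exact: WordCat (WordRefl (wordV u)) (WordCat (letterVl s) (WordRefl u)).
Qed.

Definition fp_one : free_prod := fp_pi [::].
Definition fp_mul (a b : free_prod) : free_prod :=
  fp_pi (generic_quotient.repr a ++ generic_quotient.repr b).
Definition fp_inv (a : free_prod) : free_prod :=
  fp_pi (wordV (generic_quotient.repr a)).

Lemma fp_mul_pi u v : fp_mul (fp_pi u) (fp_pi v) = fp_pi (u ++ v).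
Proof. by apply/fp_piP/WordCat; exact: fp_repr. Qed.

Lemma fp_ind (P : free_prod -> Prop) : (forall u, P (fp_pi u)) -> forall a, P a.
Proof. by move=> Ppi a; rewrite -[a]reprK; exact: Ppi. Qed.

Fact fp_mulA : associative fp_mul.
Proof.
by elim/fp_ind=> u; elim/fp_ind=> v; elim/fp_ind=> w; rewrite !fp_mul_pi catA.
Qed.

Fact fp_mul1 : left_id fp_one fp_mul.
Proof. by elim/fp_ind=> u; rewrite fp_mul_pi. Qed.

Fact fp_mulr1 : right_id fp_one fp_mul.
Proof. by elim/fp_ind=> u; rewrite fp_mul_pi cats0. Qed.

Fact fp_mulV : left_inverse fp_one fp_inv fp_mul.
Proof.
move=> a; rewrite -[in X in fp_mul _ X](reprK a) fp_mul_pi.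
by apply/fp_piP/wordVl.
Qed.

Fact fp_mulrV : right_inverse fp_one fp_inv fp_mul.
Proof.
move=> a; rewrite -[in X in fp_mul X _](reprK a) fp_mul_pi.
by apply/fp_piP/wordVr.
Qed.

HB.instance Definition _ := isGroup.Build free_prod
  fp_mulA fp_mul1 fp_mulr1 fp_mulV fp_mulrV.

Definition fp_inl (x : G1) : free_prod := fp_pi [:: inl x].
Definition fp_inr (y : G2) : free_prod := fp_pi [:: inr y].

Lemma fp_inlM : {morph fp_inl : x y / (x * y)%g}.
Proof.
by move=> x y; rewrite [RHS]fp_mul_pi; apply/fp_piP/WordSym; exact: WordMl.
Qed.

Lemma fp_inrM : {morph fp_inr : x y / (x * y)%g}.
Proof.
by move=> x y; rewrite [RHS]fp_mul_pi; apply/fp_piP/WordSym; exact: WordMr.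
Qed.

Section Lift.
Variables (K : groupType) (f1 : G1 -> K) (f2 : G2 -> K).

Definition word_eval (u : word) : K :=
  foldr (fun s z => (match s with inl x => f1 x | inr y => f2 y end * z)%g) 1%g u.

Definition fp_lift (a : free_prod) : K := word_eval (generic_quotient.repr a).

Lemma word_eval_cat u v : word_eval (u ++ v) = (word_eval u * word_eval v)%g.
Proof. by elim: u => [|s u IHu] /=; rewrite ?mul1g// IHu mulgA. Qed.

Hypothesis f1M : {morph f1 : x y / (x * y)%g}.
Hypothesis f2M : {morph f2 : x y / (x * y)%g}.

Lemma word_eval_congr u v : word_congr u v -> word_eval u = word_eval v.
Proof.
elim=> //=.
- by move=> ? ? ? _ -> _ ->.
- by move=> ? ? ? ? _ Eu _ Ev; rewrite !word_eval_cat Eu Ev.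
- by rewrite mulg1; apply: (@mulgI _ (f1 1%g)); rewrite -f1M !mulg1.
- by rewrite mulg1; apply: (@mulgI _ (f2 1%g)); rewrite -f2M !mulg1.
- by move=> x y; rewrite f1M !mulg1.
- by move=> x y; rewrite f2M !mulg1.
Qed.

Lemma fp_lift_pi u : fp_lift (fp_pi u) = word_eval u.
Proof. exact/word_eval_congr/fp_repr. Qed.

Lemma fp_liftM : {morph fp_lift : a b / (a * b)%g}.
Proof.
elim/fp_ind=> u; elim/fp_ind=> v.
by rewrite [(_ * _)%g]fp_mul_pi !fp_lift_pi word_eval_cat.
Qed.

Lemma fp_lift_inl x : fp_lift (fp_inl x) = f1 x.
Proof. by rewrite fp_lift_pi /= mulg1. Qed.

Lemma fp_lift_inr y : fp_lift (fp_inr y) = f2 y.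
Proof. by rewrite fp_lift_pi /= mulg1. Qed.

End Lift.

Lemma fp_hom_ext (K : groupType) (f g : free_prod -> K) :
  {morph f : a b / (a * b)%g} -> {morph g : a b / (a * b)%g} ->
  (forall x, f (fp_inl x) = g (fp_inl x)) ->
  (forall y, f (fp_inr y) = g (fp_inr y)) -> f =1 g.
Proof.
move=> fM gM fgl fgr; elim/fp_ind; elim=> [|s u IHu].
  have h1 (h : free_prod -> K) : {morph h : a b / (a * b)%g} -> h 1%g = 1%g.
    by move=> hM; apply: (@mulgI _ (h 1%g)); rewrite -hM !mulg1.
  by rewrite -[fp_pi [::]]/(1%g : free_prod) !h1.
have -> : fp_pi (s :: u) = (fp_pi [:: s] * fp_pi u)%g by rewrite [RHS]fp_mul_pi.
by rewrite fM gM IHu; case: s => z; rewrite ?fgl ?fgr.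
Qed.

End FreeProduct.

(* The induced action is the coproduct of the two actions. *)
Section FreeProductAction.
Variables (L G1 G2 : groupType).
Variables (alpha1 : group_action L G1) (alpha2 : group_action L G2).

Definition fp_act (l : L) : free_prod G1 G2 -> free_prod G1 G2 :=
  fp_lift (fun x => fp_inl G2 (alpha1 l x)) (fun y => fp_inr G1 (alpha2 l y)).

Lemma fp_act_morph l : {morph fp_act l : a b / (a * b)%g}.
Proof.
by apply: fp_liftM => x y; rewrite act_morph (fp_inlM, fp_inrM).
Qed.

Lemma fp_act_inl l x : fp_act l (fp_inl G2 x) = fp_inl G2 (alpha1 l x).
Proof.
by apply: fp_lift_inl => ? ?; rewrite act_morph (fp_inlM, fp_inrM).
Qed.

Lemma fp_act_inr l y : fp_act l (fp_inr G1 y) = fp_inr G1 (alpha2 l y).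
Proof.
by apply: fp_lift_inr => ? ?; rewrite act_morph (fp_inlM, fp_inrM).
Qed.

Lemma fp_act1 a : fp_act 1%g a = a.
Proof.
apply: (@fp_hom_ext _ _ _ (fp_act 1%g) id) => // [|x|y].
- exact: fp_act_morph.
- by rewrite fp_act_inl act1.
- by rewrite fp_act_inr act1.
Qed.

Lemma fp_actM l m a : fp_act (l * m)%g a = fp_act l (fp_act m a).
Proof.
apply: (@fp_hom_ext _ _ _ (fp_act (l * m)%g) (fp_act l \o fp_act m)) => [| |x|y].
- exact: fp_act_morph.
- by move=> b c; rewrite /= !fp_act_morph.
- by rewrite /= !fp_act_inl actM.
- by rewrite /= !fp_act_inr actM.
Qed.

Definition free_prod_action : group_action L (free_prod G1 G2) :=
  GroupAct fp_act fp_act_morph fp_act1 fp_actM.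

End FreeProductAction.

(* Main.v *)
From HB Require Import structures.
From mathcomp Require Import all_boot all_order all_algebra all_fingroup finmap.
From mathcomp Require Import all_classical all_reals all_analysis complex.
From mathcomp Require multinomials.monalg.
Import (canonicals, coercions) mathcomp.multinomials.monalg.
From mathcomp Require Import ring lra zify.
Require Import Defs.

Set Implicit Arguments.
Unset Strict Implicit.
Unset Printing Implicit Defensive.

Import Order.TTheory GRing.Theory Num.Theory.
Import numFieldNormedType.Exports.
Local Open Scope classical_set_scope.
Local Open Scope ring_scope.
Local Open Scope complex_scope.
Local Open Scope quotient_scope.
Local Open Scope sesquilinear_scope.

(** Let G be the free product of G1 and G2. Call an action of G on a finite set C
    finite when the maps g |-> alpha_l(g) from G to the self-maps of C, for l in L,
    are finitely many. The permutation representation of G on l2(C) then factors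
    through a finite quotient and has a finite L-orbit ([perm_rep_FD_class]). So it
    suffices to find, for a unitary representation pi of G, an element a of the group
    algebra and a unit vector v, a finite action whose permutation representation
    gives a norm at least |pi(a) v| - e ([approx_rep]).

    Let v_1, ..., v_k be the vectors pi(u) v, for u a suffix of a word of the support
    of a. The restrictions of pi to G1 and to G2 are first treated separately.
    Property FD yields finite actions that approximate finitely many coefficients
    <pi(g) v_i, v_j> at once ([FD_approx]). Indeed finite actions may be put side by
    side, so that their tables of coefficients form a convex cone; if the table of pi
    is not in the closure of this cone, a separating functional is a self-adjoint
    matrix T over the group algebra which is negative on the dense class and not on
    pi. The positive part of T in the matrices over the full C*-algebra is then
    nonzero, yet killed by the dense class ([dense_negative]). Adding coordinates on
    which the group acts trivially makes the Gram matrix exactly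
    M = (<v_i, v_j>) + d 1 ([FD_exact_gram]).

    Now G1 permutes n1 coordinates and there are vectors W1_i in C^n1, G2 permutes n2
    coordinates and there are vectors W2_i in C^n2, with the same invertible Gram
    matrix M. A unitary U of C^N, N = n1 + n2, carries W1 to W2, but it does not
    permute coordinates, and the two actions have to live on one finite set. The
    idea is to turn this unitary into a permutation, up to a small error ([glue]).
    Replace C^N by the finite grid of N-tuples of Gaussian integers modulo 2p+1.
    Permutations of coordinates act on the grid, and a vector w becomes the function
    x |-> <w, x> on it, cut off radially at a scale r. By the symmetries of the grid
    this multiplies all inner products by the same number ([wave_gram]). The matrix
    U is a product of three block shears ([rot]), and a shear rounded to the grid is
    still a bijection ([shear_bij]); so U becomes a permutation theta of the grid
    whose distance to U is bounded independently of p and r ([shear_tracks],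
    [tracks_comp]). For r large this is invisible to the cut off functionals. Let G1
    permute the coordinates, and let G2 permute them after conjugation by theta: by
    the universal property this is an action of G on the grid, and it is finite
    because each of the two actions is ([fin_action_free_prod]).

    In this representation a letter of G1 or G2 carries the function of pi(u) v
    nearly to that of pi(s u) v ([word_model]); following the words of the support
    letter by letter gives [approx_rep]. *)

(** * Positive semidefinite real forms *)

Section RealForm.
Variables (R : realType) (V : lmodType R[i]).

(** Complex spaces are treated through the real part of their inner product, which
    is enough for norms, symmetric operators and separation. Definiteness is not
    asked for, so that a positive operator also gives a form, with its own
    Cauchy-Schwarz inequality. *)
Record real_form (r : V -> V -> R) : Prop := RealForm {
  rformDl : forall u v w, r (u + v) w = r u w + r v w;
  rformZl : forall (c : R) u v, r (c%:C *: u) v = c * r u v;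
  rformC : forall u v, r u v = r v u;
  rform_ge0 : forall v, 0 <= r v v }.

Variables (r : V -> V -> R) (rP : real_form r).

Lemma rformDr u v w : r u (v + w) = r u v + r u w.
Proof. by rewrite rformC// rformDl// !(rformC rP _ u). Qed.

Lemma rformZr (c : R) u v : r u (c%:C *: v) = c * r u v.
Proof. by rewrite rformC// rformZl// (rformC rP _ u). Qed.

Lemma rform0l u : r 0 u = 0.
Proof. by apply: (@addrI _ (r 0 u)); rewrite -rformDl// !addr0. Qed.

Lemma rform0r u : r u 0 = 0.
Proof. by rewrite rformC// rform0l. Qed.

Lemma rformNl u v : r (- u) v = - r u v.
Proof. by apply: (@addrI _ (r u v)); rewrite -rformDl// !subrr rform0l. Qed.

Lemma rformNr u v : r u (- v) = - r u v.
Proof. by rewrite rformC// rformNl (rformC rP u). Qed.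

Lemma rformBl u v w : r (u - v) w = r u w - r v w.
Proof. by rewrite rformDl// rformNl. Qed.

Lemma rformBr u v w : r u (v - w) = r u v - r u w.
Proof. by rewrite rformDr// rformNr. Qed.

Definition rformE := (rformBl, rformBr, rformDl rP, rformDr, rformNl, rformNr,
  rformZl rP, rformZr).

Lemma rform_suml (I : Type) (s : seq I) (F : I -> V) v :
  r (\sum_(i <- s) F i) v = \sum_(i <- s) r (F i) v.
Proof.
elim: s => [|i s IHs]; first by rewrite !big_nil rform0l.
by rewrite !big_cons rformDl// IHs.
Qed.

Lemma rform_sumr (I : Type) (s : seq I) (F : I -> V) v :
  r v (\sum_(i <- s) F i) = \sum_(i <- s) r v (F i).
Proof.
by rewrite rformC// rform_suml; apply: eq_bigr => i _; rewrite rformC.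
Qed.

Lemma rform_CS u v : r u v ^+ 2 <= r u u * r v v.
Proof.
have q t : 0 <= r u u * t ^+ 2 + 2 * r u v * t + r v v.
  have := rform_ge0 rP (t%:C *: u + v); rewrite !rformE (rformC rP v u); lra.
have [u0|u0] := eqVneq (r u u) 0.
  have [->|uv0] := eqVneq (r u v) 0; first by rewrite u0 mul0r expr0n.
  have := q (- (r v v + 1) / (2 * r u v)); rewrite u0 mul0r add0r mulrC.
  by rewrite divfK ?mulf_neq0 ?pnatr_eq0//; lra.
have u1 : 0 < r u u by rewrite lt_def u0 rform_ge0.
have := q (- r u v / r u u).
have -> : r u u * (- r u v / r u u) ^+ 2 + 2 * r u v * (- r u v / r u u) + r v v
  = (r u u * r v v - r u v ^+ 2) / r u u by field.
by rewrite pmulr_lge0 ?invr_gt0// subr_ge0.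
Qed.

Definition rnorm v := Num.sqrt (r v v).

Lemma rnorm_ge0 v : 0 <= rnorm v. Proof. exact: sqrtr_ge0. Qed.

Lemma sqr_rnorm v : rnorm v ^+ 2 = r v v.
Proof. by rewrite sqr_sqrtr// rform_ge0. Qed.

Lemma rform_le u v : r u v <= rnorm u * rnorm v.
Proof.
apply: le_trans (ler_norm _) _.
rewrite -(ler_pXn2r (ltn0Sn 1)) ?nnegrE ?mulr_ge0 ?rnorm_ge0//.
by rewrite exprMn !sqr_rnorm real_normK ?num_real// rform_CS.
Qed.

Lemma rnormD u v : rnorm (u + v) <= rnorm u + rnorm v.
Proof.
rewrite -(ler_pXn2r (ltn0Sn 1)) ?nnegrE ?addr_ge0 ?rnorm_ge0//.
rewrite sqr_rnorm sqrrD !sqr_rnorm !rformE (rformC rP v u).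
have := rform_le u v; lra.
Qed.

Lemma rnormN u : rnorm (- u) = rnorm u.
Proof. by rewrite /rnorm !rformE opprK. Qed.

Lemma rnormB u v : rnorm (u - v) <= rnorm u + rnorm v.
Proof. by rewrite -(rnormN v); exact: rnormD. Qed.

Lemma rnormZ (c : R) u : 0 <= c -> rnorm (c%:C *: u) = c * rnorm u.
Proof.
move=> c0; rewrite /rnorm !rformE mulrA -expr2 sqrtrM ?sqr_ge0//.
by rewrite sqrtr_sqr ger0_norm.
Qed.

Lemma rnorm0 : rnorm 0 = 0. Proof. by rewrite /rnorm rform0l sqrtr0. Qed.

Lemma rnorm_sum (I : Type) (s : seq I) (F : I -> V) :
  rnorm (\sum_(i <- s) F i) <= \sum_(i <- s) rnorm (F i).
Proof.
elim: s => [|i s IHs]; first by rewrite !big_nil rnorm0.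
by rewrite !big_cons; apply: le_trans (rnormD _ _) _; rewrite lerD2l.
Qed.

Lemma rnorm_le u (c : R) : 0 <= c -> (rnorm u <= c) = (r u u <= c ^+ 2).
Proof.
by move=> c0; rewrite -(ler_pXn2r (ltn0Sn 1)) ?nnegrE ?rnorm_ge0// sqr_rnorm.
Qed.

End RealForm.

(** * The positive part of a symmetric contraction *)

Section SqrtScalars.
Variable R : realType.

(** The iteration [sqrt_iter] below for T = 0, where it is a scalar. It is the worst
    case: the polynomials of [sqrt_iter] in 1 - T^2 and their successive differences
    have nonnegative coefficients. *)
Fixpoint sqrt_scalar (n : nat) : R :=
  if n is m.+1 then (1 + sqrt_scalar m ^+ 2) / 2 else 0.

Local Notation c := sqrt_scalar.

Lemma sqrt_scalar_bound n : 0 <= c n <= 1.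
Proof.
by elim: n => [|n /andP[IH0 IH1]] /=; first lra; apply/andP; split; nra.
Qed.

Lemma sqrt_scalar_incr n : c n <= c n.+1.
Proof. by have /andP[? ?] := sqrt_scalar_bound n; rewrite /=; nra. Qed.

Lemma sqrt_scalar_nondecreasing : nondecreasing_seq c.
Proof. exact/nondecreasing_seqP/sqrt_scalar_incr. Qed.

Lemma sqrt_scalar_cauchy (e : R) : 0 < e ->
  exists N, forall m n, (N <= m)%N -> (m <= n)%N -> c n - c m < e.
Proof.
move=> e0; have cc : cvgn c.
  apply: nondecreasing_is_cvgn sqrt_scalar_nondecreasing _.
  by exists 1 => _ [n _ <-]; have /andP[] := sqrt_scalar_bound n.
have /cvgrPdist_lt/(_ (e / 2)) := cc; case; first by lra.
move=> N _ NP; exists N => m n Nm mn.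
have := NP m Nm; have := NP n (leq_trans Nm mn) => /=.
by rewrite !ltr_distl => /andP[? ?] /andP[? ?]; lra.
Qed.

End SqrtScalars.

Section OperatorSqrt.
Variables (R : realType) (V : lmodType R[i]) (r : V -> V -> R).
Hypothesis rP : real_form r.
Variable T : V -> V.
Hypothesis TD : forall u v, T (u + v) = T u + T v.
Hypothesis TZ : forall (a : R) u, T (a%:C *: u) = a%:C *: T u.
Hypothesis Tsym : forall u v, r (T u) v = r u (T v).
Hypothesis Tle : forall v, r (T v) (T v) <= r v v.

Local Notation nrm := (rnorm r).
Local Notation c := (@sqrt_scalar R).

(** The operator p = 1 - |T| solves p = (x + p^2) / 2 for x = 1 - T^2, and this is
    the iteration from 0 for that equation. Each iterate is a polynomial in T, so the
    iterates of an element of a group algebra stay in the group algebra. *)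
Fixpoint sqrt_iter (n : nat) (v : V) : V :=
  if n is m.+1 then
    (2^-1)%:C *: (v - T (T v) + sqrt_iter m (sqrt_iter m v))
  else 0.

Local Notation p := sqrt_iter.

Definition real_linear (S : V -> V) :=
  (forall u v, S (u + v) = S u + S v) /\
  (forall (a : R) u, S (a%:C *: u) = a%:C *: S u).

Lemma real_linear0 S : real_linear S -> S 0 = 0.
Proof. by move=> [SD _]; apply: (@addrI _ (S 0)); rewrite -SD !addr0. Qed.

Lemma real_linearB S u v : real_linear S -> S (u - v) = S u - S v.
Proof.
move=> Slin; have [SD _] := Slin; rewrite SD; congr (_ + _).
by apply: (@addrI _ (S v)); rewrite -SD !subrr real_linear0.
Qed.

Let Tlin : real_linear T. Proof. by []. Qed.

Lemma sqrt_iter_linear n : real_linear (p n).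
Proof.
elim: n => [|n [IHD IHZ]]; first by split=> *; rewrite /= ?addr0 ?scaler0.
split=> [u v|a u] /=.
  by rewrite !IHD !TD -scalerDr opprD (addrACA u v) (addrACA (u - _)).
rewrite !IHZ !TZ -scalerBr -scalerDr !scalerA; congr (_ *: _).
by rewrite mulrC.
Qed.

Lemma sqrt_iter_commute S n : real_linear S -> (forall v, S (T v) = T (S v)) ->
  forall v, S (p n v) = p n (S v).
Proof.
move=> Slin ST; have [SD SZ] := Slin.
elim: n => [|n IHn] v /=; first exact: real_linear0.
by rewrite SZ SD real_linearB// !ST !IHn.
Qed.

Lemma sqrt_iterT n v : T (p n v) = p n (T v).
Proof. exact: sqrt_iter_commute. Qed.

Lemma sqrt_iterC m n v : p m (p n v) = p n (p m v).
Proof.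
apply: sqrt_iter_commute => [|w]; first exact: sqrt_iter_linear.
by rewrite sqrt_iterT.
Qed.

Lemma sqrt_iter_sym n u v : r (p n u) v = r u (p n v).
Proof.
elim: n u v => [|n IHn] u v /=; first by rewrite rform0l// rform0r.
by rewrite !(rformE rP) !Tsym !IHn.
Qed.

Lemma T_nrm v : nrm (T v) <= nrm v.
Proof. by rewrite rnorm_le ?rnorm_ge0// sqr_rnorm. Qed.

Lemma x_nrm v : nrm (v - T (T v)) <= nrm v.
Proof.
rewrite rnorm_le ?rnorm_ge0// sqr_rnorm// !(rformE rP).
rewrite (rformC rP v (T _)) (Tsym (T v) v).
have := Tle v; have := Tle (T v); have := rform_ge0 rP (T v); lra.
Qed.

Lemma sqrt_iter_nrm n v : nrm (p n v) <= c n * nrm v.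
Proof.
elim: n v => [|n IHn] v /=; first by rewrite rnorm0// mul0r.
rewrite rnormZ ?invr_ge0//; apply: le_trans (_ : 2^-1 * (nrm v + c n ^+ 2 * nrm v) <= _).
  rewrite ler_wpM2l ?invr_ge0//; apply: le_trans (rnormD rP _ _) _.
  apply: lerD; first exact: x_nrm.
  have /andP[c0 _] := sqrt_scalar_bound R n.
  by apply: le_trans (IHn _) _; rewrite expr2 -mulrA ler_wpM2l.
have := rnorm_ge0 r v; lra.
Qed.

(** The iterates commute, so that
    p_(n+2) - p_(n+1) = (p_(n+1) - p_n) (p_(n+1) + p_n) / 2. The scalars satisfy the
    same identity, and the bound propagates. *)
Lemma sqrt_iter_step n v : nrm (p n.+1 v - p n v) <= (c n.+1 - c n) * nrm v.
Proof.
elim: n v => [|n IHn] v.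
  have := sqrt_iter_nrm 1 v; rewrite [p 0 v]/= [c 0]/= !subr0; exact.
have [/andP[c0 c1] /andP[c0' c1']] := (sqrt_scalar_bound R n, sqrt_scalar_bound R n.+1).
have eqp : p n.+2 v - p n.+1 v =
    (2^-1)%:C *: (p n.+1 (p n.+1 v + p n v) - p n (p n.+1 v + p n v)).
  have [pD pZ] := sqrt_iter_linear n; have [pD' pZ'] := sqrt_iter_linear n.+1.
  have e2 : p n.+2 v = (2^-1)%:C *: (v - T (T v) + p n.+1 (p n.+1 v)) by [].
  have e1 : p n.+1 v = (2^-1)%:C *: (v - T (T v) + p n (p n v)) by [].
  rewrite pD pD' e2 [X in _ - X]e1 -scalerBr; congr (_ *: _).
  rewrite opprD addrACA subrr add0r opprD [p n (p n.+1 v)]sqrt_iterC.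
  by rewrite addrA addrK.
rewrite eqp rnormZ ?invr_ge0//.
have h1 := IHn (p n.+1 v + p n v).
have h2 : nrm (p n.+1 v + p n v) <= (c n.+1 + c n) * nrm v.
  apply: le_trans (rnormD rP _ _) _; rewrite mulrDl; apply: lerD; exact: sqrt_iter_nrm.
apply: le_trans (_ : 2^-1 * ((c n.+1 - c n) * ((c n.+1 + c n) * nrm v)) <= _).
  rewrite ler_wpM2l ?invr_ge0//; apply: le_trans h1 _.
  by rewrite ler_wpM2l// subr_ge0 sqrt_scalar_incr.
have -> : c n.+2 = (1 + c n.+1 ^+ 2) / 2 by [].
suff -> : (1 + c n.+1 ^+ 2) / 2 - c n.+1 = 2^-1 * ((c n.+1 - c n) * (c n.+1 + c n)).
  by rewrite -!mulrA.
have : c n.+1 = (1 + c n ^+ 2) / 2 by [].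
move: (c n.+1) (c n) => x y xy; rewrite -subr_sqr; lra.
Qed.

Lemma sqrt_iter_lip m n v : (m <= n)%N ->
  nrm (p n v - p m v) <= (c n - c m) * nrm v.
Proof.
move=> /subnKC <-; elim: (n - m)%N => [|k IHk].
  by rewrite addn0 !subrr rnorm0// mul0r.
rewrite addnS -(subrK (p (m + k) v) (p (m + k).+1 v)) -addrA.
apply: le_trans (rnormD rP _ _) _.
apply: le_trans (lerD (sqrt_iter_step _ _) IHk) _.
by rewrite -mulrDl ler_wpM2r ?rnorm_ge0//; lra.
Qed.

(** Approximates |T| + T, twice the positive part of T. *)
Definition pos_part_iter (n : nat) (v : V) : V := v - p n v + T v.

Local Notation D := pos_part_iter.

Lemma pos_part_iter_lip m n v : (m <= n)%N ->
  nrm (D n v - D m v) <= (c n - c m) * nrm v.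
Proof.
move=> mn; rewrite -(rnormN rP).
have -> : - (D n v - D m v) = p n v - p m v; last exact: sqrt_iter_lip.
rewrite /D [X in - (_ + X)]opprD addrACA subrr addr0 [- (v - _)]opprB.
by rewrite addrC addrA subrK opprB.
Qed.

(** Since p_n is a contraction, 1 - p_n is positive. *)
Lemma pos_part_iter_ge n v : r (T v) v <= r (D n v) v.
Proof.
rewrite /D !(rformE rP); have /andP[c0 c1] := sqrt_scalar_bound R n.
have := rform_le rP (p n v) v; have := sqrt_iter_nrm n v.
have := rnorm_ge0 r v; rewrite -(sqr_rnorm rP); nra.
Qed.

(** Put P = 1 - p_n, D = P + T and w = D v. Then
    (P - T) D = P^2 - T^2 = 2 (p_(n+1) - p_n) is small, hence so is <(P - T) w, w>.
    When T <= 0 this is a sum of two nonnegative terms, so that P w and T w are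
    small, and |w|^2 = <P w + T w, v>. *)
Lemma pos_part_iter_small n v : (forall u, r (T u) u <= 0) ->
  r (D n v) (D n v) <= 6 * Num.sqrt (c n.+1 - c n) * r v v.
Proof.
move=> Tle0; set w := D n v.
have [c0 c1] := andP (sqrt_scalar_bound R n).
have [pD pZ] := sqrt_iter_linear n.
set d := c n.+1 - c n; have d0 : 0 <= d by rewrite subr_ge0 sqrt_scalar_incr.
pose P u := u - p n u.
have Plin : real_linear P.
  split=> [u1 u2|a u1]; rewrite /P ?pD ?pZ ?scalerBr// opprD addrACA //.
have Psym u1 u2 : r (P u1) u2 = r u1 (P u2).
  by rewrite /P !(rformE rP) sqrt_iter_sym.
have Pge0 u : 0 <= r (P u) u.
  rewrite /P !(rformE rP).
  have := rform_le rP (p n u) u; have := sqrt_iter_nrm n u.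
  have := rnorm_ge0 r u; rewrite -(sqr_rnorm rP u); nra.
have Pn u : nrm (P u) <= 2 * nrm u.
  have := rnormB rP u (p n u); have := sqrt_iter_nrm n u.
  have := rnorm_ge0 r u; rewrite -/(P u); nra.
have wn : nrm w <= 3 * nrm v.
  have := rnormD rP (P v) (T v); have := Pn v; have := T_nrm v.
  by rewrite -/(D n v) -/w; lra.
have PTw : P w - T w = 2%:C *: (p n.+1 v - p n v).
  have Tl : real_linear T by [].
  rewrite /P /w /D -/(P v) pD -sqrt_iterT TD.
  have -> : p n (P v) = p n v - p n (p n v) by rewrite /P real_linearB.
  have -> : T (P v) = T v - T (p n v) by rewrite /P real_linearB.
  have -> : p n.+1 v = (2^-1)%:C *: (v - T (T v) + p n (p n v)) by [].
  rewrite scalerBr scalerA -rmorphM divff ?pnatr_eq0// scale1r.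
  rewrite [2%:C]rmorph_nat scaler_nat mulr2n /P !opprD !opprK !addrA.
  rewrite [LHS](ACl (1*9*5*(2*4)*(3*7)*(6*8)))/= subrr addNr !addr0 -opprD.
  by rewrite opprD addrA.
have hE : r (P w - T w) w <= 6 * d * r v v.
  rewrite PTw !(rformZl rP).
  have := rform_le rP (p n.+1 v - p n v) w; have := sqrt_iter_step n v.
  rewrite -(sqr_rnorm rP v) -/d; have := rnorm_ge0 r v; have := rnorm_ge0 r w.
  have := rnorm_ge0 r (p n.+1 v - p n v).
  move: (nrm _) (nrm w) (nrm v) wn => x y z; nra.
have Pw : r (P w) w <= 6 * d * r v v.
  by have := Tle0 w; move: hE; rewrite !(rformE rP); lra.
have Tw : - r (T w) w <= 6 * d * r v v.
  by have := Pge0 w; move: hE; rewrite !(rformE rP); lra.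
have Pform : real_form (fun u1 u2 => r (P u1) u2).
  split=> [u1 u2 u3|a u1 u2|u1 u2|u]; first 1 last.
  - by rewrite Plin.2 (rformZl rP).
  - by rewrite Psym rformC.
  - exact: Pge0.
  - by rewrite Plin.1 (rformDl rP).
have Tform : real_form (fun u1 u2 => - r (T u1) u2).
  split=> [u1 u2 u3|a u1 u2|u1 u2|u]; first 1 last.
  - by rewrite TZ (rformZl rP) mulrN.
  - by rewrite Tsym rformC.
  - by rewrite oppr_ge0.
  - by rewrite TD (rformDl rP) opprD.
(* for S positive, |S w|^4 <= <S w, w> <S S w, S w> <= |S| <S w, w> |S w|^2 *)
have rPw : nrm (P w) ^+ 2 <= 12 * d * r v v.
  have := rform_CS Pform w (P w); rewrite /= -(sqr_rnorm rP (P w)).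
  have h1 := rform_le rP (P (P w)) (P w); have h2 := Pn (P w).
  have h3 := rnorm_ge0 r (P w).
  have h4 : r (P (P w)) (P w) <= 2 * nrm (P w) ^+ 2 by nra.
  have [->|z0] := eqVneq (nrm (P w)) 0.
    by move=> _; rewrite expr0n !mulr_ge0// (rform_ge0 rP).
  have zp : 0 < nrm (P w) ^+ 2 by rewrite exprn_gt0// lt_def z0.
  have a0 := Pge0 w.
  move: (r (P w) w) (r (P (P w)) _) (nrm (P w) ^+ 2) Pw h4 zp a0 => a b z Pw h4 zp a0 zz.
  have : z ^+ 2 <= 2 * a * z by apply: le_trans zz _; nra.
  rewrite expr2 ler_pM2r//; nra.
have rTw : nrm (T w) ^+ 2 <= 6 * d * r v v.
  have := rform_CS Tform w (T w); rewrite /= sqrrN -(sqr_rnorm rP (T w)).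
  have h1 := rform_le rP (- T (T w)) (T w); have h2 := T_nrm (T w).
  rewrite (rnormN rP) (rformNl rP) in h1.
  have h3 := rnorm_ge0 r (T w).
  have h4 : - r (T (T w)) (T w) <= nrm (T w) ^+ 2 by nra.
  have [->|z0] := eqVneq (nrm (T w)) 0.
    by move=> _; rewrite expr0n !mulr_ge0// (rform_ge0 rP).
  have zp : 0 < nrm (T w) ^+ 2 by rewrite exprn_gt0// lt_def z0.
  have a0 := Tle0 w.
  move: (r (T w) w) (r (T (T w)) _) (nrm (T w) ^+ 2) Tw h4 zp a0 => a b z Tw h4 zp a0 zz.
  have : z ^+ 2 <= - a * z by apply: le_trans zz _; nra.
  rewrite expr2 ler_pM2r//; nra.
have hw : r w w <= (nrm (P w) + nrm (T w)) * nrm v.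
  have -> : r w w = r (P w + T w) v.
    by rewrite (rformDl rP) Psym Tsym -(rformDr rP).
  apply: le_trans (rform_le rP _ _) _; rewrite ler_wpM2r ?rnorm_ge0//.
  exact: rnormD.
apply: le_trans hw _; rewrite -(sqr_rnorm rP v) expr2 mulrA ler_wpM2r ?rnorm_ge0//.
have [s0 v0] := (sqrtr_ge0 d, rnorm_ge0 r v).
have sd : Num.sqrt d ^+ 2 = d by rewrite sqr_sqrtr.
rewrite -sd -(sqr_rnorm rP v) in rPw rTw.
have k1 : nrm (P w) <= 7 / 2 * (Num.sqrt d * nrm v).
  rewrite -(ler_pXn2r (ltn0Sn 1)) ?nnegrE ?mulr_ge0 ?rnorm_ge0//.
  apply: le_trans rPw _; nra.
have k2 : nrm (T w) <= 5 / 2 * (Num.sqrt d * nrm v).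
  rewrite -(ler_pXn2r (ltn0Sn 1)) ?nnegrE ?mulr_ge0 ?rnorm_ge0//.
  apply: le_trans rTw _; nra.
lra.
Qed.
End OperatorSqrt.

(** * Operators given by matrices over a group algebra *)

Section HilbertRealForm.
Variables (R : realType) (H : hilbertSpace R).

Lemma hs_dotDl (u v w : H) : hs_dot H (u + v) w = hs_dot H u w + hs_dot H v w.
Proof. by rewrite linearDl. Qed.

Lemma hs_dotZl a (u v : H) : hs_dot H (a *: u) v = a * hs_dot H u v.
Proof. by rewrite linearZl_LR. Qed.

Lemma hs_dotZr a (u v : H) : hs_dot H u (a *: v) = Num.conj a * hs_dot H u v.
Proof. by rewrite linearZr_LR. Qed.

Lemma hs_dotC (u v : H) : hs_dot H u v = Num.conj (hs_dot H v u).
Proof. by rewrite hermC expr0 mul1r. Qed.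

Lemma cRe_conj (z : R[i]) : complex.Re (Num.conj z) = complex.Re z.
Proof. by case: z. Qed.

Lemma cReD (z w : R[i]) : complex.Re (z + w) = complex.Re z + complex.Re w.
Proof. by case: z; case: w. Qed.

Lemma cReN (z : R[i]) : complex.Re (- z) = - complex.Re z.
Proof. by case: z. Qed.

Lemma cReB (z w : R[i]) : complex.Re (z - w) = complex.Re z - complex.Re w.
Proof. by rewrite cReD cReN. Qed.

Lemma cImB (z w : R[i]) : complex.Im (z - w) = complex.Im z - complex.Im w.
Proof. by case: z; case: w. Qed.

Lemma cReZ (a : R) (z : R[i]) : complex.Re (a%:C * z) = a * complex.Re z.
Proof. by case: z => x y /=; rewrite mul0r subr0. Qed.

Lemma hs_dot_real_form : real_form (fun u v : H => complex.Re (hs_dot H u v)).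
Proof.
split=> [u v w|c u v|u v|v].
- by rewrite hs_dotDl cReD.
- by rewrite hs_dotZl cReZ.
- by rewrite hs_dotC cRe_conj.
- have : 0 <= hs_dot H v v by rewrite -hs_normE exprn_ge0.
  by rewrite lecE /= => /andP[].
Qed.

Lemma hs_dotvvE (v : H) : hs_dot H v v = (complex.Re (hs_dot H v v))%:C.
Proof. by rewrite complex_ge0_Re// -hs_normE exprn_ge0. Qed.

Lemma hs_norm_rnorm (v : H) :
  `|v| = (rnorm (fun u v : H => complex.Re (hs_dot H u v)) v)%:C.
Proof.
apply/eqP; rewrite -(@eqrXn2 _ 2)//; last by rewrite lecR rnorm_ge0.
rewrite hs_normE hs_dotvvE -[X in X == _]/(_%:C) -(sqr_rnorm hs_dot_real_form v).
by rewrite rmorphXn.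
Qed.

Variable k : nat.

Definition fdot (u v : {ffun 'I_k -> H}) : R :=
  \sum_i complex.Re (hs_dot H (u i) (v i)).

Lemma fdot_real_form : real_form fdot.
Proof.
have hP := hs_dot_real_form.
split=> [u v w|c u v|u v|v].
- by rewrite -big_split; apply: eq_bigr => i _; rewrite ffunE (rformDl hP).
- by rewrite mulr_sumr; apply: eq_bigr => i _; rewrite ffunE (rformZl hP).
- by apply: eq_bigr => i _; rewrite (rformC hP).
- by apply: sumr_ge0 => i _; rewrite (rform_ge0 hP).
Qed.

End HilbertRealForm.

Section RepAlg.
Variables (R : realType) (G : groupType).

Lemma rep_algD (H : hilbertSpace R) (pi : unirep G H) (a b : group_algebra R G) v :
  rep_alg pi (a + b) v = rep_alg pi a v + rep_alg pi b v.
Proof.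
by apply/eqP; rewrite -subr_eq -rep_algB addrK.
Qed.

Lemma rep_alg_sum (H : hilbertSpace R) (pi : unirep G H) (I : Type) (s : seq I)
   (a : I -> group_algebra R G) v :
  rep_alg pi (\sum_(i <- s) a i) v = \sum_(i <- s) rep_alg pi (a i) v.
Proof.
elim: s => [|i s IHs]; first by rewrite !big_nil rep_alg0.
by rewrite !big_cons rep_algD IHs.
Qed.

Lemma rep_algU (H : hilbertSpace R) (pi : unirep G H) g (c : R[i]) v :
  rep_alg pi (monalg.mkmalgU g c) v = c *: pi g v.
Proof.
rewrite (@rep_algEw _ _ _ _ _ [fset g]%fset) ?monalg.msuppU_le//.
by rewrite big_seq_fset1 monalg.mcoeffUU.
Qed.

Lemma rep_algDr (H : hilbertSpace R) (pi : unirep G H) (a : group_algebra R G) u v :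
  rep_alg pi a (u + v) = rep_alg pi a u + rep_alg pi a v.
Proof.
by rewrite /rep_alg -big_split; apply: eq_bigr => g _; rewrite linearD scalerDr.
Qed.

Lemma rep_alg_comp (a b : group_algebra R G) :
  exists c : group_algebra R G, forall (H : hilbertSpace R) (pi : unirep G H) v,
    rep_alg pi c v = rep_alg pi a (rep_alg pi b v).
Proof.
exists (\sum_(g <- monalg.msupp a) \sum_(h <- monalg.msupp b)
  monalg.mkmalgU (g * h)%g (monalg.mcoeff g a * monalg.mcoeff h b)).
move=> H pi v; rewrite rep_alg_sum [RHS]/rep_alg; apply: eq_bigr => g _.
rewrite rep_alg_sum [rep_alg pi b v]/rep_alg linear_sum scaler_sumr.
by apply: eq_bigr => h _; rewrite rep_algU rep_mapM linearZ scalerA.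
Qed.

Lemma rep_alg_scale (a : group_algebra R G) (z : R[i]) :
  exists c : group_algebra R G, forall (H : hilbertSpace R) (pi : unirep G H) v,
    rep_alg pi c v = z *: rep_alg pi a v.
Proof.
have [c cP] := rep_alg_comp (monalg.mkmalgU 1%g z) a.
by exists c => H pi v; rewrite cP rep_algU rep_map1.
Qed.

End RepAlg.

Section Algebraic.
Variables (R : realType) (G : groupType) (k : nat).

(** A matrix over the group algebra acts on H^k for every representation on H, and
    is used through this family of operators only. [algebraic] says that a family
    comes from some matrix, which saves computing in the ring of matrices. *)
Definition opfam := forall H : hilbertSpace R, unirep G H ->
  {ffun 'I_k -> H} -> {ffun 'I_k -> H}.

Definition algebraic (D : opfam) := exists a : 'I_k -> 'I_k -> group_algebra R G,
  forall (H : hilbertSpace R) (pi : unirep G H) v j,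
    D H pi v j = \sum_i rep_alg pi (a i j) (v i).

Lemma algebraic_id : algebraic (fun H pi v => v).
Proof.
exists (fun i j => monalg.mkmalgU 1%g (i == j)%:R) => H pi v j.
rewrite (bigD1 j)//= rep_algU eqxx scale1r rep_map1 big1 ?addr0// => i /negPf ij.
by rewrite rep_algU ij scale0r.
Qed.

Lemma algebraic_ext (D E : opfam) : (forall H pi v, D H pi v = E H pi v) ->
  algebraic E -> algebraic D.
Proof. by move=> DE [a aP]; exists a => H pi v j; rewrite DE aP. Qed.

Lemma algebraicD (D E : opfam) : algebraic D -> algebraic E ->
  algebraic (fun H pi v => D H pi v + E H pi v).
Proof.
move=> [a aP] [b bP]; exists (fun i j => a i j + b i j) => H pi v j.
by rewrite ffunE aP bP -big_split; apply: eq_bigr => i _; rewrite rep_algD.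
Qed.

Lemma algebraicZ (z : R[i]) (D : opfam) : algebraic D ->
  algebraic (fun H pi v => z *: D H pi v).
Proof.
move=> [a aP]; have [b bP] := choice (fun ij => rep_alg_scale (a ij.1 ij.2) z).
exists (fun i j => b (i, j)) => H pi v j.
by rewrite ffunE aP scaler_sumr; apply: eq_bigr => i _; rewrite bP.
Qed.

Lemma algebraicN (D : opfam) : algebraic D -> algebraic (fun H pi v => - D H pi v).
Proof.
move=> Dalg; apply: algebraic_ext (algebraicZ (-1) Dalg) => H pi v.
by rewrite scaleN1r.
Qed.

Lemma algebraic0 : algebraic (fun H pi v => 0).
Proof.
by apply: algebraic_ext (algebraicZ 0 algebraic_id) => H pi v; rewrite scale0r.
Qed.

Lemma algebraic_comp (D E : opfam) : algebraic D -> algebraic E ->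
  algebraic (fun H pi v => D H pi (E H pi v)).
Proof.
move=> [a aP] [b bP].
have [c cP] := choice (fun x : 'I_k * 'I_k * 'I_k =>
  rep_alg_comp (a x.1.2 x.2) (b x.1.1 x.1.2)).
exists (fun i j => \sum_l c (i, l, j)) => H pi v j.
rewrite aP (eq_bigr (fun l => \sum_i rep_alg pi (c (i, l, j)) (v i))).
  by rewrite exchange_big; apply: eq_bigr => i _; rewrite rep_alg_sum.
move=> l _; rewrite bP.
elim/big_rec2: _ => [|i _ y _ <-]; last by rewrite rep_algDr cP.
by rewrite -[X in rep_alg _ _ X](scale0r (0 : H)) rep_algZ scale0r.
Qed.

Lemma algebraic_linear (D : opfam) (H : hilbertSpace R) (pi : unirep G H) :
  algebraic D -> real_linear (D H pi).
Proof.
move=> [a aP]; split=> [u v|c u]; apply/ffunP => j; rewrite ?ffunE !aP.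
  by rewrite -big_split; apply: eq_bigr => i _; rewrite ffunE rep_algDr.
by rewrite scaler_sumr; apply: eq_bigr => i _; rewrite ffunE rep_algZ.
Qed.

Lemma algebraic_sqrt_iter (D : opfam) n : algebraic D ->
  algebraic (fun H pi => sqrt_iter (D H pi) n).
Proof.
move=> Dalg; elim: n => [|n IHn]; first exact: algebraic0.
apply: (algebraic_ext _ (algebraicZ (2^-1)%:C (algebraicD
  (algebraicD algebraic_id (algebraicN (algebraic_comp Dalg Dalg)))
  (algebraic_comp IHn IHn)))) => H pi v.
by [].
Qed.

Lemma algebraic_pos_part (D : opfam) n : algebraic D ->
  algebraic (fun H pi => pos_part_iter (D H pi) n).
Proof.
move=> Dalg.
apply: (algebraic_ext _ (algebraicD (algebraicD algebraic_id
  (algebraicN (algebraic_sqrt_iter n Dalg))) Dalg)) => H pi v.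
by [].
Qed.

End Algebraic.

Section CoordinateNorm.
Variables (R : realType) (H : hilbertSpace R) (k : nat).
Implicit Types (u v : {ffun 'I_k -> H}).

Let hdot := fun u v : H => complex.Re (hs_dot H u v).
Let hP := hs_dot_real_form H : real_form hdot.
Let fP := fdot_real_form H k.

Lemma Re_norm_rnorm (v : H) : complex.Re `|v| = rnorm hdot v.
Proof. by rewrite hs_norm_rnorm. Qed.

Lemma coord_rnorm u j : rnorm hdot (u j) <= rnorm (@fdot R H k) u.
Proof.
rewrite (rnorm_le hP) ?rnorm_ge0// sqr_rnorm//.
by rewrite [leRHS](bigD1 j)//= lerDl sumr_ge0// => i _; exact: (rform_ge0 hP (u i)).
Qed.

Definition fsingle (i : 'I_k) (w : H) : {ffun 'I_k -> H} :=
  [ffun i' => if i' == i then w else 0].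

Lemma fdot_single i w u : fdot (fsingle i w) u = hdot w (u i).
Proof.
rewrite /fdot (bigD1 i)//= ffunE eqxx big1 ?addr0// => j /negPf ji.
by rewrite ffunE ji; exact: (rform0l hP).
Qed.

Lemma rnorm_single i w : rnorm (@fdot R H k) (fsingle i w) = rnorm hdot w.
Proof. by rewrite /rnorm fdot_single ffunE eqxx. Qed.

End CoordinateNorm.

Section Terms.
Variables (R : realType) (G : groupType) (k : nat).

(** A triple (c, g, (i, j)) stands for the matrix that carries coordinate i to
    coordinate j through c g. *)
Definition term := (R[i] * G * ('I_k * 'I_k))%type.

Definition term_adj (t : term) : term :=
  (Num.conj t.1.1, t.1.2^-1%g, (t.2.2, t.2.1)).

Definition term_op (t : term) (H : hilbertSpace R) (pi : unirep G H)
    (v : {ffun 'I_k -> H}) : {ffun 'I_k -> H} :=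
  fsingle t.2.2 (t.1.1 *: pi t.1.2 (v t.2.1)).

Lemma term_op_algebraic t : algebraic (term_op t).
Proof.
exists (fun i j => if (i == t.2.1) && (j == t.2.2) then
  monalg.mkmalgU t.1.2 t.1.1 else 0) => H pi v j.
rewrite ffunE; case: (j == t.2.2); last first.
  by rewrite big1// => i _; rewrite andbF rep_alg0.
rewrite (bigD1 t.2.1)//= eqxx rep_algU big1 ?addr0// => i /negPf ->.
by rewrite rep_alg0.
Qed.

Lemma term_op_adj t (H : hilbertSpace R) (pi : unirep G H) u v :
  fdot (term_op t pi u) v = fdot u (term_op (term_adj t) pi v).
Proof.
rewrite (rformC (fdot_real_form H k) u) !fdot_single /=.
rewrite -(rep_unitary pi t.1.2 _ (u _)) linearZ /= -rep_mapM mulgV rep_map1.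
by rewrite [in RHS]hs_dotC cRe_conj hs_dotZr conjCK hs_dotZl.
Qed.

Lemma term_op_le t (H : hilbertSpace R) (pi : unirep G H) v :
  rnorm (@fdot R H k) (term_op t pi v) <=
  complex.Re `|t.1.1| * rnorm (@fdot R H k) v.
Proof.
rewrite rnorm_single -Re_norm_rnorm normrZ rep_isometry.
rewrite -[in leLHS](@complex_ge0_Re _ `|t.1.1|)// cReZ.
rewrite ler_wpM2l ?Re_norm_rnorm ?coord_rnorm//.
exact: (@Re_norm_ge0 R R[i]^o).
Qed.

(** Adding the adjoints makes the operator symmetric. *)
Definition terms_op (s : seq term) (H : hilbertSpace R) (pi : unirep G H)
    (v : {ffun 'I_k -> H}) : {ffun 'I_k -> H} :=
  \sum_(t <- s) (term_op t pi v + term_op (term_adj t) pi v).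

Lemma terms_op_algebraic s : algebraic (terms_op s).
Proof.
elim: s => [|t s IHs].
  by apply: algebraic_ext (algebraic0 R G k) => H pi v; rewrite /terms_op big_nil.
apply: (algebraic_ext _ (algebraicD (algebraicD (term_op_algebraic t)
  (term_op_algebraic (term_adj t))) IHs)) => H pi v.
by rewrite /terms_op big_cons.
Qed.

Lemma term_adjK t : term_adj (term_adj t) = t.
Proof. by case: t => [[c g] [i j]]; rewrite /term_adj /= conjCK invgK. Qed.

Lemma terms_op_sym s (H : hilbertSpace R) (pi : unirep G H) u v :
  fdot (terms_op s pi u) v = fdot u (terms_op s pi v).
Proof.
have fP := fdot_real_form H k.
rewrite (rform_suml fP) (rform_sumr fP); apply: eq_bigr => t _.
by rewrite (rformDl fP) (rformDr fP) !term_op_adj term_adjK addrC.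
Qed.

Lemma terms_op_dot s (H : hilbertSpace R) (pi : unirep G H) v :
  fdot (terms_op s pi v) v = 2 * \sum_(t <- s)
    complex.Re (t.1.1 * hs_dot H (pi t.1.2 (v t.2.1)) (v t.2.2)).
Proof.
have fP := fdot_real_form H k.
rewrite (rform_suml fP) mulr_sumr; apply: eq_bigr => t _.
rewrite (rformDl fP) [X in _ + X]term_op_adj term_adjK (rformC fP v).
by rewrite fdot_single hs_dotZl mulr2n mulrDl mul1r.
Qed.

Definition terms_bound (s : seq term) : R := 1 + \sum_(t <- s) 2 * complex.Re `|t.1.1|.

Lemma terms_bound_gt0 s : 0 < terms_bound s.
Proof.
rewrite ltr_wpDr// sumr_ge0// => t _.
by rewrite mulr_ge0//; exact: (@Re_norm_ge0 R R[i]^o).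
Qed.

Lemma terms_op_le s (H : hilbertSpace R) (pi : unirep G H) v :
  rnorm (@fdot R H k) (terms_op s pi v) <= terms_bound s * rnorm (@fdot R H k) v.
Proof.
have fP := fdot_real_form H k.
apply: le_trans (rnorm_sum fP _ _) _; rewrite mulrDl mul1r mulr_suml ler_wpDl ?rnorm_ge0//.
apply: ler_sum => t _; apply: le_trans (rnormD fP _ _) _.
have h1 := term_op_le t pi v; have h2 := term_op_le (term_adj t) pi v.
have e : `|(term_adj t).1.1| = `|t.1.1| by exact: norm_conjC.
by rewrite e in h2; lra.
Qed.

End Terms.

(** * Negativity passes from a dense class to all representations *)

Section DenseNegative.
Variables (R : realType) (G : groupType) (k : nat).
Variable S : forall H : hilbertSpace R, unirep G H -> Prop.
Hypothesis Sdense : fell_dense S.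

Local Notation c := (@sqrt_scalar R).

(** Scale the operator to a contraction T. The polynomials D_n that approximate twice
    the positive part of T are Cauchy in the full norm, uniformly over all
    representations, so that their matrix entries converge in the full C*-algebra. On
    the class S the operators D_n tend to 0, so density forces the limits to vanish;
    but <D_n v, v> >= <T v, v> for all n. *)
Lemma dense_negative (s : seq (term R G k)) :
  (forall H (pi : unirep G H) v, S pi -> fdot (terms_op s pi v) v <= 0) ->
  forall H (pi : unirep G H) v, fdot (terms_op s pi v) v <= 0.
Proof.
move=> Sneg H pi v; rewrite leNgt; apply/negP => v_gt0.
have L0 := terms_bound_gt0 s; set L := terms_bound s in L0.
pose T : opfam R G k := fun H pi v => (L^-1)%:C *: terms_op s pi v.
have Talg : algebraic T by apply: algebraicZ; exact: terms_op_algebraic.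
have Tlin K (rho : unirep G K) := algebraic_linear rho Talg.
have Tsym K (rho : unirep G K) u w : fdot (T K rho u) w = fdot u (T K rho w).
  have fP := fdot_real_form K k.
  by rewrite (rformZl fP) (rformZr fP) terms_op_sym.
have Tle K (rho : unirep G K) u : fdot (T K rho u) (T K rho u) <= fdot u u.
  have fP := fdot_real_form K k.
  rewrite -(sqr_rnorm fP u) -(rnorm_le fP) ?rnorm_ge0//.
  by rewrite (rnormZ fP) ?invr_ge0 ?(ltW L0)// ler_pdivrMl ?terms_op_le.
pose D n : opfam R G k := fun H pi => pos_part_iter (T H pi) n.
have /choice[a aP] n : algebraic (D n) by exact: algebraic_pos_part.
have Dlip m n K (rho : unirep G K) u : (m <= n)%N ->
    rnorm (@fdot _ K k) (D n K rho u - D m K rho u) <=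
    (c n - c m) * rnorm (@fdot _ K k) u.
  by move=> mn; apply: (pos_part_iter_lip (fdot_real_form K k) (Tlin K rho).1 (Tlin K rho).2).
have Dsingle n K (rho : unirep G K) i w j :
    D n K rho (fsingle i w) j = rep_alg rho (a n i j) w.
  rewrite aP (bigD1 i)//= ffunE eqxx big1 ?addr0// => l /negPf li.
  by rewrite ffunE li -[X in rep_alg _ _ X](scale0r (0 : K)) rep_algZ scale0r.
have alip m n i j : (m <= n)%N -> full_norm (a n i j - a m i j) <= c n - c m.
  move=> mn; have cnm : 0 <= c n - c m by rewrite subr_ge0 sqrt_scalar_nondecreasing.
  apply: full_norm_le => // K rho; apply: opnorm_le => w w1.
  rewrite rep_algB -!Dsingle Re_norm_rnorm.
  have := coord_rnorm (D n K rho (fsingle i w) - D m K rho (fsingle i w)) j.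
  rewrite !ffunE => /le_trans; apply; apply: le_trans (Dlip _ _ _ _ _ mn) _.
  rewrite rnorm_single ler_piMr// -Re_norm_rnorm -lecR complex_ge0_Re//.
have acauchy i j : `[< full_cauchy (fun n => a n i j) >].
  apply/asboolP => e e0; have [N NP] := sqrt_scalar_cauchy e0.
  exists N => m n Nm Nn; have [mn|nm] := leqP m n.
    by rewrite full_norm_distC; apply: le_lt_trans (alip _ _ _ _ mn) (NP _ _ _ _).
  by apply: le_lt_trans (alip _ _ _ _ (ltnW nm)) (NP _ _ _ (ltnW nm)).
pose acs i j : cauchy_seq R G := exist _ (fun n => a n i j) (acauchy i j).
pose A i j : full_cstar R G := \pi_(full_cstar R G) (acs i j).
(* if all the limits vanish, D_n is small on pi, against <T v, v> > 0 *)
have [A0|] := pselect (forall i j, A i j = cstar0 R G).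
  have fP := fdot_real_form H k; have hP := hs_dot_real_form H.
  pose t := fdot (T H pi v) v.
  have t0 : 0 < t by rewrite /t (rformZl fP) mulr_gt0// invr_gt0.
  pose hn := rnorm (fun u v : H => complex.Re (hs_dot H u v)).
  pose M := \sum_j \sum_i hn (v i) * hn (v j).
  have M0 : 0 <= M by do 2 (apply: sumr_ge0 => ? _); rewrite mulr_ge0 ?rnorm_ge0.
  pose e := t / (M + 1).
  have e0 : 0 < e by rewrite divr_gt0// ltr_wpDl.
  have : \forall n \near \oo, forall ij, full_norm (a n ij.1 ij.2) < e.
    apply: filter_forall => -[i j] /=.
    have /(@eqquotP _ (cauchy_equivR R G) (full_cstar R G)) := A0 i j.
    move=> /asboolP/cvgr0Pnorm_lt/(_ e e0); apply: filterS => n.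
    by rewrite subr0 ger0_norm// full_norm_ge0.
  move=> [N _ /(_ N (leqnn N)) aN].
  have := pos_part_iter_ge (fdot_real_form H k) (Tsym H pi) (Tle H pi) N v.
  rewrite -/t -/(D N H pi); apply/negP; rewrite -ltNge.
  apply: (@le_lt_trans _ _ (e * M)); last first.
    by rewrite /e mulrAC ltr_pdivrMr ?ltr_wpDl// ltr_pM2l// ltrDl.
  rewrite /fdot /M mulr_sumr; apply: ler_sum => j _.
  apply: le_trans (rform_le hP _ _) _; rewrite -mulr_suml mulrA.
  rewrite ler_wpM2r ?rnorm_ge0// aP; apply: le_trans (rnorm_sum hP _ _) _.
  rewrite mulr_sumr; apply: ler_sum => i _.
  have := rep_alg_le_full pi (a N i j) (v i).
  rewrite !hs_norm_rnorm -rmorphM/= lecR => /le_trans; apply.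
  by rewrite ler_wpM2r ?rnorm_ge0// ltW// (aN (i, j)).
(* a nonzero limit is seen by a representation of S, where D_n tends to 0 *)
move=> /existsNP[i /existsNP[j Aij]].
have [K [sigma [Ssigma [w]]]] := Sdense Aij; apply.
rewrite -(cvg_lim (@norm_hausdorff _ _) (@rep_cstarE R G K sigma (acs i j) w)).
apply: cvg_lim; first exact: norm_hausdorff.
apply/cvgr0Pnorm_lt => e e0.
have de : (complex.Re e)%:C = e by exact/complex_ge0_Re/ltW.
have d0 : 0 < complex.Re e by rewrite -ltcR de.
move: (complex.Re e) de d0 => x <- x0.
have fP := fdot_real_form K k; have hP := hs_dot_real_form K.
pose M := fdot (fsingle i w) (fsingle i w).
have M0 : 0 <= M by exact: (rform_ge0 fP).
pose d := x ^+ 2 / (6 * (M + 1)).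
have d0 : 0 < d by rewrite divr_gt0 ?exprn_gt0// mulr_gt0// ltr_wpDl.
have [N NP] := sqrt_scalar_cauchy (exprn_gt0 2 d0).
exists N => // n /= Nn.
rewrite -Dsingle hs_norm_rnorm ltcR; apply: le_lt_trans (coord_rnorm _ _) _.
rewrite -(ltr_pXn2r (ltn0Sn 1)) ?nnegrE ?rnorm_ge0 ?(ltW x0)// (sqr_rnorm fP).
have small := pos_part_iter_small fP (Tlin K sigma).1 (Tlin K sigma).2
  (Tsym K sigma) (Tle K sigma) n (fsingle i w).
apply: le_lt_trans (small _) _.
  by move=> u; rewrite (rformZl fP) mulr_ge0_le0 ?invr_ge0 ?(ltW L0)// Sneg.
have sd : Num.sqrt (c n.+1 - c n) < d.
  rewrite -(ltr_pXn2r (ltn0Sn 1)) ?nnegrE ?sqrtr_ge0 ?(ltW d0)//.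
  by rewrite sqr_sqrtr ?subr_ge0 ?sqrt_scalar_incr// NP.
rewrite -/M; apply: (@le_lt_trans _ _ (6 * d * M)).
  by rewrite ler_wpM2r// ler_wpM2l// ltW.
have -> : x ^+ 2 = 6 * d * (M + 1).
  by rewrite /d; field; rewrite lt0r_neq0 ?ltr_wpDl.
rewrite ltr_pM2l; first by rewrite ltrDl.
by rewrite mulr_gt0.
Qed.
End DenseNegative.

(** * Factorization of Gram matrices and separation from a cone *)

(** Take square roots of the eigenvalues in a spectral decomposition. *)
Lemma psd_factor (C : numClosedFieldType) n (A : 'M[C]_n) :
  A^t* = A -> (forall x : 'rV[C]_n, 0 <= (x *m A *m x^t*) 0 0) ->
  exists B : 'M[C]_n, A = B *m B^t*.
Proof.
move=> Aherm Apos.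
have Anormal : A \is normalmx by apply/normalmxP; rewrite Aherm.
have /orthomx_spectralP := Anormal.
set P := spectralmx A; set D := spectral_diag A => AE.
have Pu : P \is unitarymx by exact: spectral_unitarymx.
rewrite (invmx_unitary Pu) in AE.
have PAP : P *m A *m P^t* = diag_mx D.
  rewrite AE !mulmxA (unitarymxP Pu) mul1mx -mulmxA (unitarymxP Pu).
  by rewrite mulmx1.
have Dpos i : 0 <= D 0 i.
  have := Apos (row i P); rewrite -row_mul.
  suff -> : (row i (P *m A) *m (row i P)^t*) 0 0 = (P *m A *m P^t*) i i.
    by rewrite PAP mxE eqxx.
  by rewrite !mxE; apply: eq_bigr => j _; rewrite !mxE.
pose S := diag_mx (\row_i sqrtC (D 0 i)).
have SS : S *m S^t* = diag_mx D.
  rewrite tr_diag_mx map_diag_mx mulmx_diag; congr diag_mx.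
  apply/rowP => i; rewrite !mxE.
  have e : Num.conj (sqrtC (D 0 i)) = sqrtC (D 0 i).
    by apply/conj_Creal; rewrite ger0_real// sqrtC_ge0.
  by rewrite [X in _ * X]e -expr2 sqrtCK.
exists (P^t* *m S).
rewrite trmx_mul map_mxM/= trmxCK mulmxA -(mulmxA _ S) SS.
exact: AE.
Qed.

(** This is how orbits under L are shown to be finite: a family indexed by L takes
    finitely many values if it is determined by families that do. *)
Lemma finite_range2 (L : choiceType) (T1 T2 T : Type) (l0 : L) (f1 : L -> T1) (f2 : L -> T2)
    (h : L -> T) :
  finite_set (range f1) -> finite_set (range f2) ->
  (forall l l', f1 l = f1 l' -> f2 l = f2 l' -> h l = h l') ->
  finite_set (range h).
Proof.
move=> fin1 fin2 fh.
pose H (p : T1 * T2) := h (xget l0 [set l | f1 l = p.1 /\ f2 l = p.2]).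
apply: (@sub_finite_set _ _ (H @` (range f1 `*` range f2))); last first.
  exact/finite_image/finite_setX.
move=> _ [l _ <-]; exists (f1 l, f2 l); first by split; exists l.
rewrite /H; have [] := @xgetPex _ l0 [set m | f1 m = f1 l /\ f2 m = f2 l].
  by exists l.
exact: fh.
Qed.

Section ConeSeparation.
Variables (R : realType) (V : lmodType R[i]) (r : V -> V -> R).
Hypothesis rP : real_form r.
Variables (K : V -> Prop) (tau : V) (B : R).
Hypothesis KD : forall u v, K u -> K v -> K (u + v).
Hypothesis KZ : forall (c : R) u, 0 <= c -> K u -> K (c%:C *: u).
Hypothesis K0 : exists u, K u.
Hypothesis Kbound : forall u, K u -> rnorm r u <= B * r u tau.

(** A closest point to phi in K may not exist. If k0 is only almost closest, then
    q = phi - k0 satisfies <u, q> <= s |u| on K with s small, instead of <u, q> <= 0.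
    The assumption |u| <= B <u, tau> turns this error into one that a small multiple
    of tau compensates. *)
Lemma cone_separation (phi : V) (e : R) : 0 < e -> 0 <= B ->
  (forall u, K u -> e <= r (phi - u) (phi - u)) ->
  exists l : V, (forall u, K u -> r u l <= 0) /\ 0 < r phi l.
Proof.
move=> e0 B0 far.
pose E := [set r (phi - u) (phi - u) | u in K].
have E0 : E !=set0 by have [u Ku] := K0; exists (r (phi - u) (phi - u)), u.
have Elb : lbound E e by move=> _ [u Ku <-]; exact: far.
have Einf : has_inf E by split => //; exists e.
pose D := inf E; have De : e <= D by exact: lb_le_inf.
have Dle u : K u -> D <= r (phi - u) (phi - u).
  by move=> Ku; apply: (ge_inf Einf.2); exists u.
pose M := rnorm r phi + Num.sqrt (D + 1).
have M0 : 0 <= M by rewrite addr_ge0 ?rnorm_ge0 ?sqrtr_ge0.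
(* With this Q, the bound s (M + 1) on - <q, k0> and the cost s B |<phi, tau>| of
   the correction by tau add up to at most half of D <= <q, q>. *)
pose Q := M + 1 + B * `|r phi tau|.
have Q0 : 1 <= Q by rewrite /Q -addrA addrC -addrA lerDl addr_ge0// mulr_ge0.
pose s := Num.min 1 (D / (2 * Q)).
have D0 : 0 < D by exact: lt_le_trans De.
have s0 : 0 < s by rewrite lt_min ltr01 divr_gt0// mulr_gt0//; lra.
have s1 : s <= 1 by rewrite ge_min lexx.
have sQ : s * Q <= D / 2.
  have : s <= D / (2 * Q) by rewrite ge_min lexx orbT.
  by rewrite ler_pdivlMr; [lra|lra].
have [_ [k0 Kk0 <-] k0D] := inf_adherent (exprn_gt0 2 s0) Einf.
rewrite -/D in k0D; have [q qE] : exists q, q = phi - k0 by eexists.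
rewrite -qE in k0D.
(* k0 + t u is in K, hence not much closer to phi than k0 *)
have qk u : K u -> r q u <= s * rnorm r u.
  move=> Ku; have [u0|u0] := eqVneq (rnorm r u) 0.
    by rewrite u0 mulr0; apply: le_trans (rform_le rP _ _) _; rewrite u0 mulr0.
  have up : 0 < rnorm r u by rewrite lt_def u0 rnorm_ge0.
  set t := s / rnorm r u; have t0 : 0 < t by rewrite divr_gt0.
  have := Dle _ (KD Kk0 (KZ (ltW t0) Ku)).
  rewrite opprD addrA -qE !(rformE rP) (rformC rP u q) -(sqr_rnorm rP u) => h.
  have : t * (2 * r q u) <= t * (2 * (s * rnorm r u)).
    have -> : t * (2 * (s * rnorm r u)) = s ^+ 2 + t * t * rnorm r u ^+ 2.
      by rewrite /t; field.
    lra.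
  by rewrite ler_pM2l//; lra.
have k0n : rnorm r k0 <= M.
  have -> : k0 = phi - q by rewrite qE opprB addrC subrK.
  apply: le_trans (rnormB rP _ _) _; rewrite lerD2l.
  rewrite ler_wsqrtr//; apply: le_trans (ltW k0D) _; rewrite lerD2l; nra.
(* the same for (1 - t) k0 *)
have kq : - r q k0 <= s * (M + 1).
  set t := s / (M + 1).
  have t0 : 0 < t by rewrite divr_gt0//; lra.
  have t1 : t <= 1 by rewrite ler_pdivrMr; lra.
  have Kt : K ((1 - t)%:C *: k0) by apply: KZ => //; lra.
  have tM : t * M <= s by rewrite /t mulrAC ler_pdivrMr ?ltr_wpDl// ler_wpM2l ?(ltW s0)// lerDl.
  have := Dle _ Kt.
  have -> : phi - (1 - t)%:C *: k0 = q + t%:C *: k0.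
    by rewrite rmorphB rmorph1 scalerBl scale1r opprB addrA qE addrAC.
  rewrite !(rformE rP) (rformC rP k0 q) -(sqr_rnorm rP k0) => h.
  have : t * (- r q k0) <= t * (s * (M + 1)).
    have -> : t * (s * (M + 1)) = s ^+ 2 by rewrite /t; field; lra.
    have rk := rnorm_ge0 r k0.
    have tk : t * rnorm r k0 <= s by apply: le_trans tM; rewrite ler_wpM2l// ltW.
    have tk2 : (t * rnorm r k0) ^+ 2 <= s ^+ 2.
      rewrite (ler_pXn2r (ltn0Sn 1)) // nnegrE; first by rewrite mulr_ge0// ltW.
      exact: ltW.
    lra.
  by rewrite ler_pM2l.
exists (q - (s * B)%:C *: tau); split=> [u Ku|].
  rewrite !(rformE rP) (rformC rP u q).
  have := qk u Ku; have := Kbound Ku; nra.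
rewrite !(rformE rP).
have -> : r phi q = r q q + r q k0.
  have qk0 : q + k0 = phi by rewrite qE subrK.
  by rewrite -(rformDr rP) qk0 (rformC rP).
have : D <= r q q by rewrite qE Dle.
have : s * B * r phi tau <= s * B * `|r phi tau|.
  by rewrite ler_wpM2l ?ler_norm// mulr_ge0// ltW.
by move: sQ; rewrite /Q; lra.
Qed.

End ConeSeparation.

Lemma morph_one (K G : groupType) (h : K -> G) :
  {morph h : x y / (x * y)%g} -> h 1%g = 1%g.
Proof. by move=> hM; apply: (@mulgI _ (h 1%g)); rewrite -hM !mulg1. Qed.

Lemma morph_inv (K G : groupType) (h : K -> G) :
  {morph h : x y / (x * y)%g} -> forall x, (h x)^-1%g = h x^-1%g.
Proof.
by move=> hM x; apply: (@mulgI _ (h x)); rewrite mulgV -hM mulgV morph_one.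
Qed.

(** * Finite actions whose orbit under L is finite *)

Section FinAction.
Variables (L G : groupType) (alpha : group_action L G).

Lemma actionV l g : (alpha l g)^-1%g = alpha l g^-1%g.
Proof. exact/morph_inv/act_morph. Qed.

(** The set-theoretic counterpart of the representations in property FD. Here the
    orbit is finite on the nose and not up to isomorphism: this is what allows two
    such actions on the same set to be combined into one of a free product. *)
Record fin_action (C : finType) (a : G -> C -> C) : Prop := FinAction {
  fin_act1 : forall c, a 1%g c = c;
  fin_actM : forall g h c, a (g * h)%g c = a g (a h c);
  fin_act_orbit : finite_set (range (fun l g c => a (alpha l g) c)) }.

Lemma fin_actK (C : finType) (a : G -> C -> C) : fin_action a ->
  forall g, cancel (a g) (a g^-1%g).
Proof. by move=> aP g c; rewrite -(fin_actM aP) mulVg (fin_act1 aP). Qed.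

Lemma fin_actVK (C : finType) (a : G -> C -> C) : fin_action a ->
  forall g, cancel (a g^-1%g) (a g).
Proof. by move=> aP g c; rewrite -(fin_actM aP) mulgV (fin_act1 aP). Qed.

Lemma fin_act_bij (C : finType) (a : G -> C -> C) : fin_action a ->
  forall g, bijective (a g).
Proof. by move=> aP g; exists (a g^-1%g); [exact: fin_actK|exact: fin_actVK]. Qed.

Lemma fin_action_sum (C1 C2 : finType) (a1 : G -> C1 -> C1) (a2 : G -> C2 -> C2) :
  fin_action a1 -> fin_action a2 ->
  fin_action (fun g (c : C1 + C2) =>
    match c with inl x => inl (a1 g x) | inr y => inr (a2 g y) end).
Proof.
move=> aP1 aP2; split=> [[]c|g h []c|].
- by rewrite (fin_act1 aP1).
- by rewrite (fin_act1 aP2).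
- by rewrite (fin_actM aP1).
- by rewrite (fin_actM aP2).
- apply: (finite_range2 (1%g : L) (fin_act_orbit aP1) (fin_act_orbit aP2)).
  move=> l l' e1 e2; apply/funext => g; apply/funext => -[]c; congr (_ _).
    exact: (congr1 (fun f => f g c) e1).
  exact: (congr1 (fun f => f g c) e2).
Qed.

Lemma fin_action_trivial (C : finType) : fin_action (fun _ (c : C) => c).
Proof.
split=> //; apply: (@sub_finite_set _ _ [set fun _ c => c]) => //.
by move=> _ [l _ <-].
Qed.

Variable R : realType.

(** The coefficient <g u, v> of the permutation representation on l2(C). *)
Definition coef (C : finType) (a : G -> C -> C) (u v : C -> R[i]) (g : G) : R[i] :=
  \sum_c u (a g^-1%g c) * Num.conj (v c).

End FinAction.

(** * Coefficients of representations with finite quotient and finite orbit *)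

Section Gram.
Variables (R : realType) (H : hilbertSpace R).

(** Finitely many vectors can be moved isometrically into some C^n. *)
Lemma gram_factor (T : finType) (u : T -> H) : exists n (B : T -> 'I_n -> R[i]),
  forall s t, hs_dot H (u s) (u t) = \sum_c B s c * Num.conj (B t c).
Proof.
pose A : 'M[R[i]]_(#|T|) :=
  \matrix_(i, j) hs_dot H (u (enum_val i)) (u (enum_val j)).
have Aherm : A^t* = A by apply/matrixP => i j; rewrite !mxE -hs_dotC.
have sumDl (x : H) n (F : 'I_n -> H) :
    hs_dot H (\sum_i F i) x = \sum_i hs_dot H (F i) x.
  by elim/big_rec2: _ => [|i z y _ <-]; rewrite ?linear0l// hs_dotDl.
have Apos (x : 'rV_(#|T|)) : 0 <= (x *m A *m x^t*) 0 0.
  suff -> : (x *m A *m x^t*) 0 0 =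
      hs_dot H (\sum_i x 0 i *: u (enum_val i)) (\sum_i x 0 i *: u (enum_val i)).
    by rewrite -hs_normE exprn_ge0.
  rewrite !mxE hs_dotC sumDl rmorph_sum; apply: eq_bigr => j _ /=.
  rewrite hs_dotZl rmorphM /= -hs_dotC sumDl !mxE mulrC; congr (_ * _).
  by apply: eq_bigr => i _; rewrite hs_dotZl mxE.
have [B AB] := psd_factor Aherm Apos.
exists #|T|, (fun s c => B (enum_rank s) c) => s t.
have := congr1 (fun M : 'M[R[i]]_(#|T|) => M (enum_rank s) (enum_rank t)) AB.
rewrite !mxE !enum_rankK => ->; apply: eq_bigr => c _; by rewrite !mxE.
Qed.

End Gram.

Section FiniteQuotient.
Variables (R : realType) (L G : groupType) (alpha : group_action L G).
Variables (H : hilbertSpace R) (pi : unirep G H).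

(** Divide the given quotient by the kernel of its representation. The resulting
    kernel depends on pi only up to unitary equivalence, which the next lemma uses. *)
Lemma faithful_finite_quotient : factors_through_finite_quotient pi ->
  exists (Q : finGroupType) (q : G -> Q),
    [/\ {morph q : x y / (x * y)%g}, forall z, exists x, q x = z &
        forall x y, q x = q y <-> forall v, pi x v = pi y v].
Proof.
move=> [Q [q [rho [qM qsurj piE]]]].
pose Kset : {set Q} := [set z | `[< forall v, rho z v = v >]]%SET.
have Kgroup : group_set Kset.
  apply/group_setP; split=> [|x y]; rewrite !inE.
    by apply/asboolP => v; rewrite rep_map1.
  by move=> /asboolP xK /asboolP yK; apply/asboolP => v; rewrite rep_mapM yK xK.
pose K := Group Kgroup.
have rhoVK x v : rho x (rho x^-1%g v) = v by rewrite -rep_mapM mulgV rep_map1.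
have rhoK x v : rho x^-1%g (rho x v) = v by rewrite -rep_mapM mulVg rep_map1.
have Knorm x : x \in 'N(K)%g.
  apply/normP/setP => y; rewrite mem_conjg !inE; apply: asbool_equiv_eq.
  split=> yK v; last first.
    by rewrite conjgE !rep_mapM yK invgK rhoVK.
  have := yK (rho x v); rewrite conjgE !rep_mapM invgK rhoK.
  by move=> /(congr1 (rho x^-1%g)); rewrite !rhoK.
exists (coset_of K), (fun x => coset K (q x)); split.
- by move=> x y; rewrite qM coset_morphM.
- move=> z; have [x _ ->] := cosetP z; have [y <-] := qsurj x; by exists y.
- move=> x y; split.
    move=> /(rcoset_kercosetP (Knorm _) (Knorm _)); rewrite mem_rcoset inE.
    move=> /asboolP xy v; rewrite !piE -[in LHS](mulgKV (q y) (q x)) rep_mapM.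
    exact: xy.
  move=> xy; apply/(rcoset_kercosetP (Knorm _) (Knorm _)); rewrite mem_rcoset inE.
  apply/asboolP => v; rewrite rep_mapM -piE xy piE; exact: rhoVK.
Qed.

(** Equivalent twists of pi have the same kernel, so if l and l' give equivalent
    twists, q o alpha_l and q o alpha_l' differ by a self-map of Q. There are finitely
    many classes and finitely many self-maps. *)
Lemma finite_orbit_quotient (Q : finGroupType) (q : G -> Q) :
  (forall z, exists x, q x = z) ->
  (forall x y, q x = q y <-> forall v, pi x v = pi y v) ->
  finite_orbit_up_to_equivalence alpha pi ->
  finite_set (range (fun l g => q (alpha l g))).
Proof.
move=> qsurj qE fin.
pose f l := [set rho : unirep G H | unitarily_equivalent rho (twist alpha pi l)].
have feq l l' g h : f l = f l' ->
    q (alpha l g) = q (alpha l h) -> q (alpha l' g) = q (alpha l' h).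
  move=> e /qE gh; have : f l (twist alpha pi l).
    by exists idfun; split=> //; split=> // x _; exists x.
  rewrite e => -[U [Ubij _ UE]]; apply/qE => v.
  have [w _ <-] : [set U x | x in setT] v by apply: (set_bij_surj Ubij).
  have := UE g w; have := UE h w; rewrite /= gh => <- <-.
  by [].
(* rp S is a fixed l in the class S, and phi l compares l to it *)
pose rp S := xget 1%g [set l | f l = S].
have rpE l : f (rp (f l)) = f l.
  by apply: (@xgetPex _ 1%g [set m | f m = f l]); exists l.
pose phi l := [ffun z => q (alpha l (xget 1%g [set g | q (alpha (rp (f l)) g) = z]))].
have phiE l g : q (alpha l g) = phi l (q (alpha (rp (f l)) g)).
  rewrite ffunE; apply: (feq (rp (f l))); first exact: rpE.
  apply: esym; apply: (@xgetPex _ 1%g [set h | q (alpha (rp (f l)) h) = q (alpha (rp (f l)) g)]).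
  by exists g.
apply: (finite_range2 (1%g : L) fin (f2 := phi)).
  exact: finite_finset.
move=> l l' e1 e2; apply/funext => g; rewrite phiE (phiE l') e2.
by rewrite -[f l']e1.
Qed.

End FiniteQuotient.

(** * Real-valued absolute value and square-summable functions *)

Section ComplexAbs.
Variable R : realType.
Implicit Types z w : R[i].

(** The norm of R[i] takes its values in R[i]; estimates need it in R. *)
Definition cabs z : R := complex.Re `|z|.

Lemma cabsE z : `|z| = (cabs z)%:C.
Proof. by rewrite /cabs complex_ge0_Re. Qed.

Lemma cabs_ge0 z : 0 <= cabs z.
Proof. by rewrite -lecR -cabsE normr_ge0. Qed.

Lemma cabsM z w : cabs (z * w) = cabs z * cabs w.
Proof. by rewrite {1}/cabs normrM !cabsE -rmorphM. Qed.

Lemma cabsD z w : cabs (z + w) <= cabs z + cabs w.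
Proof. by rewrite -lecR rmorphD/= -!cabsE ler_normD. Qed.

Lemma cabs_conj z : cabs (Num.conj z) = cabs z.
Proof. by rewrite /cabs norm_conjC. Qed.

Lemma cabs_real (c : R) : 0 <= c -> cabs c%:C = c.
Proof. by move=> c0; rewrite /cabs ger0_norm// lecR. Qed.

Lemma cabs0 : cabs 0 = 0. Proof. by rewrite /cabs normr0. Qed.

Lemma cabsN z : cabs (- z) = cabs z. Proof. by rewrite /cabs normrN. Qed.

Lemma cabs_sqr z : (cabs z ^+ 2)%:C = z * Num.conj z.
Proof. by rewrite rmorphXn/= -cabsE normCK. Qed.

Lemma cabs_sqr_Re z : cabs z ^+ 2 = complex.Re (z * Num.conj z).
Proof. by rewrite -cabs_sqr. Qed.

Lemma cabs_sqr_ReIm (z : R[i]) : cabs z ^+ 2 = complex.Re z ^+ 2 + complex.Im z ^+ 2.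
Proof. by rewrite cabs_sqr_Re; case: z => x y /=; rewrite mulrN opprK !expr2. Qed.

Lemma Re_le_abs (z : R[i]) : `|complex.Re z| <= cabs z.
Proof.
rewrite -(ler_pXn2r (ltn0Sn 1)) ?nnegrE ?cabs_ge0//.
by rewrite cabs_sqr_ReIm real_normK ?num_real// lerDl sqr_ge0.
Qed.

Lemma Im_le_abs (z : R[i]) : `|complex.Im z| <= cabs z.
Proof.
rewrite -(ler_pXn2r (ltn0Sn 1)) ?nnegrE ?cabs_ge0//.
by rewrite cabs_sqr_ReIm real_normK ?num_real// lerDr sqr_ge0.
Qed.

Lemma Re_le_cabs z : complex.Re z <= cabs z.
Proof. exact: le_trans (ler_norm _) (Re_le_abs z). Qed.

Lemma cabs_sum (I : Type) (s : seq I) (F : I -> R[i]) :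
  cabs (\sum_(i <- s) F i) <= \sum_(i <- s) cabs (F i).
Proof.
elim: s => [|i s IHs]; first by rewrite !big_nil cabs0.
by rewrite !big_cons; apply: le_trans (cabsD _ _) _; rewrite lerD2l.
Qed.

Lemma cRe_sum (I : Type) (s : seq I) (F : I -> R[i]) :
  complex.Re (\sum_(i <- s) F i) = \sum_(i <- s) complex.Re (F i).
Proof. by elim/big_rec2: _ => [|i z y _ <-]; rewrite ?cReD. Qed.

Section FunForm.
Variable X : finType.
Local Notation V := {ffun X -> R[i]^o}.

Definition l2form (u v : V) : R := \sum_x complex.Re (u x * Num.conj (v x)).

Lemma l2formP : real_form l2form.
Proof.
split=> [u v w|c u v|u v|v].
- by rewrite -big_split; apply: eq_bigr => x _; rewrite ffunE mulrDl cReD.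
- by rewrite mulr_sumr; apply: eq_bigr => x _; rewrite ffunE -mulrA cReZ.
- apply: eq_bigr => x _; rewrite -cRe_conj rmorphM/= mulrC.
  by rewrite conjCK.
- by apply: sumr_ge0 => x _; rewrite -cabs_sqr_Re exprn_ge0// cabs_ge0.
Qed.

Lemma l2formvv (v : V) : l2form v v = \sum_x cabs (v x) ^+ 2.
Proof. by apply: eq_bigr => x _; rewrite cabs_sqr_Re. Qed.

End FunForm.
End ComplexAbs.

(** * Approximation of coefficients by finite actions *)

Definition FD_class (R : realType) (L G : groupType) (alpha : group_action L G)
  (H : hilbertSpace R) (pi : unirep G H) :=
  factors_through_finite_quotient pi /\ finite_orbit_up_to_equivalence alpha pi.

Section Coefficients.
Variables (R : realType) (L G : groupType) (alpha : group_action L G).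
Local Notation fin_action := (fin_action alpha).

(** Every coefficient of a representation of a finite group Q is one of a multiple of
    the regular representation. Move the vectors pi(p) w_i into C^n, let Q act on
    Q x {1, ..., n} by translations, and let the i-th function take at (p, c) the
    value |Q|^(-1/2) times the c-th coordinate of pi(p^-1) w_i. By unitarity each p
    contributes the same amount to an inner product. *)
Lemma FD_class_coef k (H : hilbertSpace R) (pi : unirep G H) (w : 'I_k -> H) :
  FD_class alpha pi ->
  exists (C : finType) (a : G -> C -> C) (W : 'I_k -> C -> R[i]),
    fin_action a /\ forall g i j,
      hs_dot H (pi g (w i)) (w j) = coef a (W i) (W j) g.
Proof.
move=> [/faithful_finite_quotient[Q [q [qM qsurj qE]]] /(finite_orbit_quotient qsurj qE) qfin].
have q1 := morph_one qM.
have [s sK] := choice qsurj.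
pose u (t : Q * 'I_k) := pi (s t.1) (w t.2).
have [n [B uB]] := gram_factor u.
pose a g (c : Q * 'I_n) := (q g * c.1, c.2)%g.
pose z : R[i] := (Num.sqrt (#|Q|%:R^-1))%:C.
pose W i (c : Q * 'I_n) := z * B (c.1^-1%g, i) c.2.
exists (Q * 'I_n)%type, a, W; split.
  split=> [[x c]|g h [x c]|]; first by rewrite /a q1 mul1g.
    by rewrite /a /= qM mulgA.
  apply: (finite_range2 (1%g : L) qfin qfin) => l l' e _.
  apply/funext => g; apply/funext => c; congr (_ * _, _)%g.
  exact: (congr1 (fun f => f g) e).
move=> g i j; rewrite /coef -(pair_bigA _ (fun p c => W i (a g^-1%g (p, c)) * Num.conj (W j (p, c))))/=.
have zz : z * Num.conj z = #|Q|%:R^-1.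
  rewrite -cabs_sqr cabs_real ?sqrtr_ge0// sqr_sqrtr ?invr_ge0//.
  by rewrite fmorphV rmorph_nat.
transitivity (\sum_(p : Q) #|Q|%:R^-1 * hs_dot H (pi g (w i)) (w j)).
  rewrite sumr_const -[RHS]mulr_natl mulrA divff ?mul1r// pnatr_eq0 -lt0n.
  by apply/card_gt0P; exists 1%g.
apply: eq_bigr => p _.
have -> : hs_dot H (pi g (w i)) (w j) = hs_dot H (u ((q g^-1 * p)^-1%g, i)) (u (p^-1%g, j)).
  have e v : pi (s p^-1 * g)%g v = pi (s (q g^-1 * p)^-1)%g v.
    apply: (qE _ _).1; rewrite qM !sK invMg; congr (_ * _)%g.
    by apply: (@mulIg _ (q g^-1%g)); rewrite -qM mulgV mulVg q1.
  by rewrite /u /= -(rep_unitary pi (s p^-1%g) (pi g _)) -rep_mapM e.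
rewrite uB -zz mulr_sumr; apply: eq_bigr => c _.
by rewrite /W /= rmorphM mulrACA.
Qed.

Lemma coefD (C1 C2 : finType) (a1 : G -> C1 -> C1) (a2 : G -> C2 -> C2)
  (u1 v1 : C1 -> R[i]) (u2 v2 : C2 -> R[i]) g :
  coef (fun g (c : C1 + C2) =>
    match c with inl x => inl (a1 g x) | inr y => inr (a2 g y) end)
    (fun c => match c with inl x => u1 x | inr y => u2 y end)
    (fun c => match c with inl x => v1 x | inr y => v2 y end) g =
  coef a1 u1 v1 g + coef a2 u2 v2 g.
Proof. by rewrite /coef big_sumType. Qed.

Lemma coefZ (C : finType) (a : G -> C -> C) (u v : C -> R[i]) (z : R[i]) g :
  coef a (fun c => z * u c) (fun c => z * v c) g = z * Num.conj z * coef a u v g.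
Proof.
by rewrite /coef mulr_sumr; apply: eq_bigr => c _; rewrite rmorphM mulrACA.
Qed.

Lemma coef_le (C : finType) (a : G -> C -> C) (u v : C -> R[i]) g : fin_action a ->
  2 * cabs (coef a u v g) <= \sum_c cabs (u c) ^+ 2 + \sum_c cabs (v c) ^+ 2.
Proof.
move=> aP; rewrite (reindex (a g^-1%g)) /=; last first.
  exact: onW_bij (fin_act_bij aP _).
apply: (@le_trans _ _ (2 * \sum_c cabs (u (a g^-1%g c) * Num.conj (v c)))).
  by rewrite ler_wpM2l// cabs_sum.
rewrite mulr_sumr -big_split; apply: ler_sum => c _ /=.
rewrite cabsM cabs_conj; move: (cabs _) (cabs _) => x y.
have := sqr_ge0 (x - y); nra.
Qed.

End Coefficients.

Section Approximation.
Variables (R : realType) (L G : groupType) (alpha : group_action L G).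
Hypothesis FD : property_FD_relative R alpha.
Variables (H : hilbertSpace R) (pi : unirep G H) (k : nat) (v : 'I_k -> H).
Variables (J : finType) (E : J -> G).

Let X := (option J * ('I_k * 'I_k))%type.
(* The unit element is added to E: the coefficients at 1 give the squared norms,
   which bound all the others. *)
Let E' (j : option J) : G := if j is Some j' then E j' else 1%g.
Local Notation V := {ffun X -> R[i]^o}.

Let phi : V := [ffun x => hs_dot H (pi (E' x.1) (v x.2.1)) (v x.2.2)].

Let K (f : V) : Prop := exists (C : finType) (a : G -> C -> C) (W : 'I_k -> C -> R[i]),
  fin_action alpha a /\ forall x, f x = coef a (W x.2.1) (W x.2.2) (E' x.1).

Let rP := @l2formP R X.

Let KD (f g : V) : K f -> K g -> K (f + g).
Proof.
move=> [C1 [a1 [W1 [a1P fE]]]] [C2 [a2 [W2 [a2P gE]]]].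
exists (C1 + C2)%type; eexists; exists (fun i c => match c with inl x => W1 i x | inr y => W2 i y end).
split; first exact: (fin_action_sum a1P a2P).
by move=> x; rewrite ffunE fE gE -coefD.
Qed.

Let KZ (c : R) (f : V) : 0 <= c -> K f -> K (c%:C *: f).
Proof.
move=> c0 [C [a [W [aP fE]]]]; pose z : R[i] := (Num.sqrt c)%:C.
exists C, a, (fun i x => z * W i x); split=> // x.
rewrite ffunE coefZ -cabs_sqr cabs_real ?sqrtr_ge0// sqr_sqrtr// fE //.
Qed.

Let K0 : exists f, K f.
Proof.
exists 0, unit, (fun _ c => c), (fun _ _ => 0); split; first exact: fin_action_trivial.
by move=> x; rewrite ffunE /coef big1// => c _; rewrite mul0r.
Qed.

(* Pairing with tau is the sum of the squared norms of the vectors. *)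
Let tau : V := [ffun x => if (x.1 == None) && (x.2.1 == x.2.2) then 1 else 0].

Let tauE (f : V) : l2form f tau = \sum_i complex.Re (f (None, (i, i))).
Proof.
rewrite /l2form (bigID (fun x : X => (x.1 == None) && (x.2.1 == x.2.2)))/=.
rewrite [X in _ + X]big1 ?addr0; last first.
  by move=> x /negPf xE; rewrite ffunE xE conjC0 mulr0.
rewrite (reindex_onto (fun i => (None, (i, i))) (fun x : X => x.2.1)) /=.
  apply: eq_big => [i|i _]; first by rewrite !eqxx.
  by rewrite ffunE !eqxx conjC1 mulr1.
by move=> [j [i i']] /= /andP[/eqP -> /eqP ->].
Qed.

Let B : R := Num.sqrt #|{: X}|%:R.

Let Kbound (f : V) : K f -> rnorm (@l2form R X) f <= B * l2form f tau.
Proof.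
move=> [C [a [W [aP fE]]]].
pose n i := \sum_c cabs (W i c) ^+ 2.
have n0 i : 0 <= n i by apply: sumr_ge0 => c _; rewrite exprn_ge0// cabs_ge0.
have tE : l2form f tau = \sum_i n i.
  rewrite tauE; apply: eq_bigr => i _; rewrite fE /coef cRe_sum.
  apply: eq_bigr => c _; rewrite cabs_sqr_Re.
  by have := fin_actK aP 1%g c; rewrite (fin_act1 aP) => ->.
have t0 : 0 <= \sum_i n i by exact: sumr_ge0.
have nle i : n i <= \sum_i n i by rewrite (bigD1 i)//= lerDl sumr_ge0.
have fle x : cabs (f x) <= \sum_i n i.
  rewrite fE; have := coef_le (W x.2.1) (W x.2.2) (E' x.1) aP.
  rewrite -/(n _) -/(n _); have := nle x.2.1; have := nle x.2.2; lra.
rewrite tE (rnorm_le rP) ?mulr_ge0 ?sqrtr_ge0// l2formvv exprMn sqr_sqrtr ?ler0n//.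
rewrite mulr_natl -sumr_const; apply: ler_sum => x _.
by rewrite (ler_pXn2r (ltn0Sn 1)) ?nnegrE ?cabs_ge0.
Qed.

(** If the table phi of coefficients of pi is not approximated by tables of finite
    actions, a functional l separates it from the cone K of all these tables. As an
    element of the matrices over the group algebra, l is negative on every
    representation of the dense class, because its tables are in K, and therefore
    negative on pi: a contradiction. *)
Lemma FD_approx (e : R) : 0 < e ->
  exists (C : finType) (a : G -> C -> C) (W : 'I_k -> C -> R[i]),
    [/\ fin_action alpha a,
      forall j i i',
        cabs (coef a (W i) (W i') (E j) - hs_dot H (pi (E j) (v i)) (v i')) < e &
      forall i i', cabs (coef a (W i) (W i') 1%g - hs_dot H (v i) (v i')) < e].
Proof.
move=> e0; apply: contrapT => far.
have KF (f : V) : K f -> e ^+ 2 <= l2form (phi - f) (phi - f).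
  move=> [C [a [W [aP fE]]]]; rewrite leNgt; apply/negP => small; apply: far.
  have xs x : cabs (f x - phi x) < e.
    rewrite -(ltr_pXn2r (ltn0Sn 1)) ?nnegrE ?cabs_ge0 ?(ltW e0)//.
    apply: le_lt_trans small; rewrite l2formvv (bigD1 x)//= !ffunE.
    rewrite -cabsN opprB lerDl sumr_ge0// => y _.
    by rewrite exprn_ge0// cabs_ge0.
  exists C, a, W; split=> [//|j i i'|i i'].
    by have := xs (Some j, (i, i')); rewrite fE ffunE.
  by have := xs (None, (i, i')); rewrite fE ffunE/= rep_map1.
have [l [lneg lpos]] := cone_separation rP KD KZ K0 Kbound (exprn_gt0 2 e0) (sqrtr_ge0 _) KF.
pose s : seq (term R G k) := [seq (Num.conj (l x), E' x.1, x.2) | x <- index_enum X].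
have sE (K' : hilbertSpace R) (sigma : unirep G K') (w : {ffun 'I_k -> K'}) :
    fdot (terms_op s sigma w) w =
    2 * l2form [ffun x : X => hs_dot K' (sigma (E' x.1) (w x.2.1)) (w x.2.2) : R[i]^o] l.
  rewrite terms_op_dot big_map; congr (2 * _); apply: eq_bigr => x _ /=.
  by rewrite ffunE mulrC.
have : fdot (terms_op s pi [ffun i => v i]) [ffun i => v i] <= 0.
  apply: (dense_negative FD) => K' sigma w Ssigma.
  have [C [a [W [aP cE]]]] := FD_class_coef w Ssigma.
  rewrite sE pmulr_rle0//; apply: lneg; exists C, a, W; split=> // x.
  by rewrite ffunE cE.
rewrite sE pmulr_rle0// leNgt => /negP; apply.
suff -> : [ffun x : X => hs_dot H (pi (E' x.1) ([ffun i => v i] x.2.1))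
    ([ffun i => v i] x.2.2) : R[i]^o] = phi by [].
by apply/ffunP => x; rewrite !ffunE.
Qed.

End Approximation.

(** * Prescribing the Gram matrix *)

Section RowForm.
Variables (R : realType) (n : nat).
Local Notation V := 'rV[R[i]]_n.

Definition rvform (x y : V) : R := complex.Re ((x *m y^t*) 0 0).

Lemma rvformE x y : rvform x y = \sum_c complex.Re (x 0 c * Num.conj (y 0 c)).
Proof. by rewrite /rvform mxE cRe_sum; apply: eq_bigr => c _; rewrite !mxE. Qed.

Lemma rvformP : real_form rvform.
Proof.
split=> [u v w|c u v|u v|v].
- by rewrite /rvform mulmxDl mxE cReD.
- by rewrite /rvform -scalemxAl mxE cReZ.
- rewrite !rvformE; apply: eq_bigr => c _; rewrite -cRe_conj rmorphM/= mulrC.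
  by rewrite conjCK.
- rewrite rvformE; apply: sumr_ge0 => c _; rewrite -cabs_sqr_Re.
  by rewrite exprn_ge0// cabs_ge0.
Qed.

Lemma rvformvv x : rvform x x = \sum_c cabs (x 0 c) ^+ 2.
Proof. by rewrite rvformE; apply: eq_bigr => c _; rewrite cabs_sqr_Re. Qed.

Lemma rvdotvv x : (x *m x^t*) 0 0 = (rvform x x)%:C.
Proof.
rewrite rvformvv mxE (raddf_sum (real_complex R)); apply: eq_bigr => c _.
by rewrite /= cabs_sqr !mxE.
Qed.

Lemma rvdotC (x y : V) : (x *m y^t*) 0 0 = Num.conj ((y *m x^t*) 0 0).
Proof.
rewrite !mxE rmorph_sum; apply: eq_bigr => c _.
by rewrite !mxE rmorphM/= conjCK mulrC.
Qed.

Lemma cabs_le_rnorm (x : V) c : cabs (x 0 c) <= rnorm rvform x.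
Proof.
rewrite -(ler_pXn2r (ltn0Sn 1)) ?nnegrE ?cabs_ge0 ?rnorm_ge0// (sqr_rnorm rvformP).
rewrite rvformvv (bigD1 c)//= lerDl sumr_ge0// => i _.
by rewrite exprn_ge0// cabs_ge0.
Qed.

Lemma rnorm_le_coord (y : V) b :
  (forall c, cabs (y 0 c) <= b) -> rnorm rvform y <= n%:R * b.
Proof.
move=> yb; have [n0|Npos] := posnP n.
  rewrite /rnorm rvformvv big1 ?sqrtr0; last by move=> c; move: (ltn_ord c); rewrite [X in (_ < X)%N]n0.
  by rewrite n0 mul0r.
have b0 : 0 <= b by apply: le_trans (yb (Ordinal Npos)); exact: cabs_ge0.
rewrite (rnorm_le rvformP) ?mulr_ge0// rvformvv.
apply: (@le_trans _ _ (\sum_(c < n) b ^+ 2)).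
  by apply: ler_sum => c _; rewrite (ler_pXn2r (ltn0Sn 1)) ?nnegrE ?cabs_ge0.
rewrite sumr_const card_ord -[leLHS]mulr_natl exprMn ler_wpM2r ?sqr_ge0//.
by rewrite expr2 ler_peMl ?ler0n// ler1n.
Qed.

End RowForm.

Section ExactGram.
Variables (R : realType) (L G : groupType) (alpha : group_action L G).
Hypothesis FD : property_FD_relative R alpha.
Variables (H : hilbertSpace R) (pi : unirep G H) (k : nat) (v : 'I_k -> H).

Definition gram_mx : 'M[R[i]]_k := \matrix_(i, j) hs_dot H (v i) (v j).

Lemma mulmx3E (x : 'rV[R[i]]_k) (A : 'M[R[i]]_k) :
  (x *m A *m x^t*) 0 0 = \sum_i \sum_j x 0 i * A i j * Num.conj (x 0 j).
Proof.
rewrite mxE exchange_big; apply: eq_bigr => j _; rewrite !mxE mulr_suml.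
by apply: eq_bigr => i _.
Qed.

Lemma gram_mx_ge0 (x : 'rV[R[i]]_k) : 0 <= (x *m gram_mx *m x^t*) 0 0.
Proof.
have [n [B gB]] := gram_factor v.
pose Bm : 'M[R[i]]_(k, n) := \matrix_(i, c) B i c.
have -> : gram_mx = Bm *m Bm^t*.
  apply/matrixP => i j; rewrite !mxE gB; apply: eq_bigr => c _; by rewrite !mxE.
rewrite !mulmxA -[x *m Bm *m _ *m _]mulmxA -map_mxM -trmx_mul rvdotvv lecR.
exact: (rform_ge0 (rvformP R n)).
Qed.

(** An approximation within e, where k e <= d, has its Gram matrix below that of the
    v_i plus d. The difference is then a Gram matrix; its vectors are appended on
    coordinates that the group fixes, which changes the coefficients by the small
    difference. *)
Lemma FD_exact_gram (J : finType) (E : J -> G) (d : R) : 0 < d ->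
  exists (n : nat) (a : G -> 'I_n -> 'I_n) (W : 'M[R[i]]_(k, n)),
    [/\ fin_action alpha a, W *m W^t* = gram_mx + (d%:C)%:M &
      forall j i i',
        cabs (coef a (W i) (W i') (E j) - hs_dot H (pi (E j) (v i)) (v i')) <= 3 * d].
Proof.
move=> d0; pose e := d / (k%:R + 1).
have k0 : 0 < k%:R + 1 :> R by rewrite ltr_wpDl.
have e0 : 0 < e by rewrite divr_gt0.
have ed : e <= d by rewrite ler_pdivrMr// ler_peMr ?(ltW d0)// lerDr.
have [C [a [W [aP WE W1]]]] := FD_approx FD pi v E e0.
pose A : 'M[R[i]]_k := gram_mx + (d%:C)%:M - \matrix_(i, j) coef a (W i) (W j) 1%g.
have W1herm i j : Num.conj (coef a (W j) (W i) 1%g) = coef a (W i) (W j) 1%g.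
  rewrite /coef rmorph_sum; apply: eq_bigr => c _; rewrite rmorphM/= conjCK mulrC.
  by have := fin_actK aP 1%g c; rewrite (fin_act1 aP) => ->.
have Aherm : A^t* = A.
  have dc : Num.conj (d%:C : R[i]) = d%:C by exact: conjc_real.
  apply/matrixP => i j; rewrite !mxE rmorphB rmorphD/= -hs_dotC W1herm eq_sym.
  by rewrite rmorphMn/= dc.
have Apos (x : 'rV_k) : 0 <= (x *m A *m x^t*) 0 0.
  set z := (x *m A *m x^t*) 0 0.
  pose D i j := coef a (W i) (W j) 1%g - hs_dot H (v i) (v j).
  have zE : z = (d * rvform x x)%:C - \sum_i \sum_j x 0 i * D i j * Num.conj (x 0 j).
    rewrite /z; have -> : A = (d%:C)%:M - \matrix_(i, j) D i j.
      apply/matrixP => i j; rewrite !mxE /D; ring.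
    rewrite mulmxBr mulmxBl !mxE; congr (_ - _).
      rewrite rmorphM/= -rvdotvv !mxE mulr_sumr; apply: eq_bigr => i _.
      rewrite mul_mx_scalar !mxE; ring.
    by have := mulmx3E x (\matrix_(i, j) D i j); rewrite mxE => ->;
       do 2 (apply: eq_bigr => ? _); rewrite mxE.
  have zreal : Num.conj z = z.
    have := rvdotC (x *m A) x; rewrite trmx_mul map_mxM Aherm mulmxA => e1.
    by rewrite /z -e1.
  have Rez : 0 <= complex.Re z.
    rewrite zE cReB subr_ge0; apply: le_trans (Re_le_cabs _) _.
    apply: le_trans (cabs_sum _ _) _.
    apply: (@le_trans _ _ (\sum_i \sum_j e / 2 * (cabs (x 0 i) ^+ 2 + cabs (x 0 j) ^+ 2))).
      apply: ler_sum => i _; apply: le_trans (cabs_sum _ _) _; apply: ler_sum => j _.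
      rewrite !cabsM cabs_conj; have := W1 i j; rewrite -/(D i j).
      have := cabs_ge0 (D i j); have := cabs_ge0 (x 0 i); have := cabs_ge0 (x 0 j).
      move: (cabs _) (cabs (x 0 i)) (cabs (x 0 j)) => y s t t0 s0 y0 ye.
      have := sqr_ge0 (s - t); have : 0 <= s * t by rewrite mulr_ge0.
      nra.
    under eq_bigr => i _ do rewrite -mulr_sumr big_split/= sumr_const card_ord -rvformvv.
    rewrite -mulr_sumr big_split/= sumr_const card_ord sumrMnl -rvformvv.
    rewrite -(mulr_natl (rvform x x)).
    have := rform_ge0 (rvformP R k) x; have : e * k%:R <= d.
      by rewrite /e mulrAC ler_pdivrMr// ler_pM2l// lerDl.
    move: (rvform x x) => N; nra.
  have : (complex.Re z)%:C = z.
    case: z zreal {zE Rez} => zr zi [] /eqP; rewrite eqNr => /eqP -> //.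
  by move=> <-; rewrite lecR.
have [B AB] := psd_factor Aherm Apos.
have AE i j : A i j = hs_dot H (v i) (v j) + (d%:C) *+ (i == j) - coef a (W i) (W j) 1%g.
  by rewrite !mxE.
pose a' g (c : C + 'I_k) := match c with inl x => inl (a g x) | inr y => inr y end.
have a'P : fin_action alpha a' by exact: (fin_action_sum aP (fin_action_trivial _ _)).
pose W' i (c : C + 'I_k) := match c with inl x => W i x | inr y => B i y end.
have W'E g i j : coef a' (W' i) (W' j) g = coef a (W i) (W j) g + A i j.
  rewrite [LHS](@coefD _ _ _ _ a (fun _ c => c)); congr (_ + _).
  by rewrite /coef AB !mxE; apply: eq_bigr => c _; rewrite !mxE.
pose a'' g (i : 'I_#|{: C + 'I_k}|) := enum_rank (a' g (enum_val i)).
exists #|{: C + 'I_k}|, a'', (\matrix_(i, c) W' i (enum_val c)).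
have a''E g i j : coef a'' ((\matrix_(i, c) W' i (enum_val c)) i) ((\matrix_(i, c) W' i (enum_val c)) j) g =
    coef a' (W' i) (W' j) g.
  rewrite /coef [RHS](reindex_onto enum_val enum_rank) /=; last first.
    by move=> c _; rewrite enum_rankK.
  by apply: eq_big => [c|c _]; rewrite ?enum_valK ?eqxx// !mxE /a'' enum_rankK.
split.
- split=> [c|g h c|]; rewrite /a''.
  + by rewrite (fin_act1 a'P) enum_valK.
  + by rewrite (fin_actM a'P) enum_rankK.
  + apply: (finite_range2 (1%g : L) (fin_act_orbit a'P) (fin_act_orbit a'P)).
    move=> l l' e1 _; apply/funext => g; apply/funext => c; congr enum_rank.
    exact: (congr1 (fun f => f g (enum_val c)) e1).
- apply/matrixP => i j.
  have := W'E 1%g i j; rewrite -a''E AE addrC subrK => W''E.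
  rewrite mxE [RHS]mxE [gram_mx _ _]mxE [_%:M _ _]mxE -W''E.
  apply: eq_bigr => c _; rewrite !mxE /a'' invg1 (fin_act1 a'P) enum_valK //.
- move=> j i i'; rewrite a''E W'E AE.
  have -> : coef a (W i) (W i') (E j) + (hs_dot H (v i) (v i') + d%:C *+ (i == i') -
     coef a (W i) (W i') 1) - hs_dot H (pi (E j) (v i)) (v i') =
     (coef a (W i) (W i') (E j) - hs_dot H (pi (E j) (v i)) (v i')) -
     (coef a (W i) (W i') 1 - hs_dot H (v i) (v i')) + d%:C *+ (i == i') by ring.
  have h3 : cabs (d%:C *+ (i == i')) <= d.
    by case: eqP => _; rewrite ?mulr1n ?mulr0n ?cabs0 ?cabs_real ?(ltW d0).
  apply: le_trans (cabsD _ _) _; apply: le_trans (lerD (cabsD _ _) (lexx _)) _.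
  rewrite cabsN; have := WE j i i'; have := W1 i i'; lra.
Qed.

End ExactGram.

(** * Actions of a free product *)

Section FreeProductFinAction.
Variables (L G1 G2 : groupType).
Variables (alpha1 : group_action L G1) (alpha2 : group_action L G2).

Lemma fp_inlV (x : G1) : (fp_inl G2 x)^-1%g = fp_inl G2 x^-1%g.
Proof. exact: (morph_inv (@fp_inlM G1 G2)). Qed.

Lemma fp_inrV (x : G2) : (fp_inr G1 x)^-1%g = fp_inr G1 x^-1%g.
Proof. exact: (morph_inv (@fp_inrM G1 G2)). Qed.

(** The action composed with the automorphism of l is again an action of the free
    product, so it is determined by its restrictions to the factors, and these take
    finitely many values as l varies. *)
Lemma fin_action_free_prod (C : finType) (a1 : G1 -> C -> C) (a2 : G2 -> C -> C) :
  fin_action alpha1 a1 -> fin_action alpha2 a2 ->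
  exists a : free_prod G1 G2 -> C -> C,
    [/\ fin_action (free_prod_action alpha1 alpha2) a,
        forall x, a (fp_inl G2 x) = a1 x & forall y, a (fp_inr G1 y) = a2 y].
Proof.
move=> aP1 aP2.
have inj1 x : injective (a1 x) by exact: can_inj (fin_actK aP1 x).
have inj2 y : injective (a2 y) by exact: can_inj (fin_actK aP2 y).
pose h1 x : {perm C} := perm (@inj1 x^-1%g).
pose h2 y : {perm C} := perm (@inj2 y^-1%g).
have h1M : {morph h1 : x y / (x * y)%g}.
  by move=> x y; apply/permP => c; rewrite permM !permE invMg (fin_actM aP1).
have h2M : {morph h2 : x y / (x * y)%g}.
  by move=> x y; apply/permP => c; rewrite permM !permE invMg (fin_actM aP2).
pose h := fp_lift h1 h2.
have hM : {morph h : x y / (x * y)%g} by exact: fp_liftM.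
have h_1 := morph_one hM.
(* permutations compose from left to right, whence the inverses *)
exists (fun g c => (h g^-1%g : {perm C}) c); split.
- split=> [c|g g' c|]; first by rewrite invg1 h_1 perm1.
    by rewrite invMg hM permM.
  apply: (finite_range2 (1%g : L) (fin_act_orbit aP1) (fin_act_orbit aP2)).
  move=> l l' e1 e2.
  have hl : h \o fp_act alpha1 alpha2 l =1 h \o fp_act alpha1 alpha2 l'.
    apply: fp_hom_ext.
    - by move=> x y; rewrite /= fp_act_morph hM.
    - by move=> x y; rewrite /= fp_act_morph hM.
    - move=> x; rewrite /= !fp_act_inl /h !fp_lift_inl//.
      apply/permP => c; rewrite !permE.
      rewrite !actionV; exact: (congr1 (fun f => f x^-1%g c) e1).
    - move=> y; rewrite /= !fp_act_inr /h !fp_lift_inr//.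
      apply/permP => c; rewrite !permE.
      rewrite !actionV; exact: (congr1 (fun f => f y^-1%g c) e2).
  apply/funext => g; apply/funext => c; rewrite /=.
  have /= -> := actionV (free_prod_action alpha1 alpha2) l g.
  have /= -> := actionV (free_prod_action alpha1 alpha2) l' g.
  by have /= -> := hl g^-1%g.
- move=> x; apply/funext => c; rewrite fp_inlV /h fp_lift_inl// permE invgK //.
- move=> y; apply/funext => c; rewrite fp_inrV /h fp_lift_inr// permE invgK //.
Qed.

End FreeProductFinAction.

(** * The Hilbert space of functions on a finite set *)

(** A name of its own, to carry the l2 norm. *)
Definition l2space (R : realType) (C : finType) := {ffun C -> R[i]^o}.

Section L2Space.
Variables (R : realType) (C : finType).
Local Notation V := (l2space R C).

HB.instance Definition _ := GRing.Lmodule.on V.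

Definition l2norm (v : V) : R[i] := (rnorm (@l2form R C) v)%:C.

Lemma l2normD u v : l2norm (u + v) <= l2norm u + l2norm v.
Proof. by rewrite -rmorphD/= lecR (rnormD (@l2formP R C)). Qed.

Lemma l2normZ (z : R[i]) v : l2norm (z *: v) = `|z| * l2norm v.
Proof.
rewrite /l2norm cabsE -rmorphM/=; congr (_%:C).
rewrite /rnorm !l2formvv; under eq_bigr => x _ do rewrite ffunE cabsM exprMn.
by rewrite -mulr_sumr sqrtrM ?sqr_ge0// sqrtr_sqr ger0_norm ?cabs_ge0.
Qed.

Lemma cabs_le_l2 (v : V) c : cabs (v c) <= rnorm (@l2form R C) v.
Proof.
rewrite -(ler_pXn2r (ltn0Sn 1)) ?nnegrE ?cabs_ge0 ?rnorm_ge0// (sqr_rnorm (@l2formP R C)).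
rewrite l2formvv (bigD1 c)//= lerDl sumr_ge0// => i _.
by rewrite exprn_ge0// cabs_ge0.
Qed.

Lemma l2norm_eq0 v : l2norm v = 0 -> v = 0.
Proof.
move=> /complexI v0; apply/ffunP => c; rewrite ffunE.
have := cabs_le_l2 v c; rewrite v0 => vc.
apply/eqP; rewrite -normr_eq0 cabsE; apply/eqP; congr (_%:C).
by apply/eqP; rewrite eq_le vc cabs_ge0.
Qed.

HB.instance Definition _ := Lmodule_isNormed.Build R[i] V l2normD l2normZ l2norm_eq0.

(** Convergence can be tested on the real and imaginary parts of each value. *)
Lemma l2_complete (F : set_system V) : ProperFilter F -> cauchy F -> cvg F.
Proof.
move=> FF Fc.
have coord (p : R[i] -> R) : (forall x y, p (x - y) = p x - p y) ->
    (forall x, `|p x| <= cabs x) -> forall c, cvg ((fun v : V => p (v c)) @ F).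
  move=> pB ple c; apply: cauchy_cvg; apply: cauchy_exP => e e0.
  have /cauchyP/(_ e%:C) := Fc; rewrite ltcR => /(_ e0)[x Fx].
  exists (p (x c)); change (F [set v : V | ball (p (x c)) e (p (v c))]).
  apply: filterS Fx => v.
  rewrite -!ball_normE => xv'.
  have xv : rnorm (@l2form R C) (x - v) < e by rewrite -ltcR; exact: xv'.
  rewrite /= -pB.
  apply: le_lt_trans (ple _) _; apply: le_lt_trans xv.
  by have := cabs_le_l2 (x - v) c; rewrite !ffunE.
have cRe := coord _ (@cReB R) (@Re_le_abs R).
have cIm := coord _ (@cImB R) (@Im_le_abs R).
pose w : V := [ffun c => Complex (lim ((fun v : V => complex.Re (v c)) @ F))
                                 (lim ((fun v : V => complex.Im (v c)) @ F))].
apply/cvg_ex; exists w; apply/cvgrPdist_lt => e e0.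
have de : (complex.Re e)%:C = e by exact/complex_ge0_Re/ltW.
have d0 : 0 < complex.Re e by rewrite -ltcR de.
move: (complex.Re e) de d0 => d <- d0 {e e0}.
pose n : R := #|C|%:R; have n0 : 0 <= n by rewrite ler0n.
pose t := d / (2 * (n + 1)).
have t0 : 0 < t by rewrite divr_gt0// mulr_gt0// ltr_wpDl.
have nRe : F [set v : V | forall c, `|complex.Re (w c) - complex.Re (v c)| < t].
  apply: filter_forall => c; rewrite ffunE /=.
  by have /cvgrPdist_lt := cRe c; exact.
have nIm : F [set v : V | forall c, `|complex.Im (w c) - complex.Im (v c)| < t].
  apply: filter_forall => c; rewrite ffunE /=.
  by have /cvgrPdist_lt := cIm c; exact.
apply: filterS2 nRe nIm => v vRe vIm.
suff small : rnorm (@l2form R C) (w - v) < d by move: small; rewrite -ltcR; exact.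
rewrite -(ltr_pXn2r (ltn0Sn 1)) ?nnegrE ?rnorm_ge0 ?(ltW d0)//.
rewrite (sqr_rnorm (@l2formP R C)) l2formvv.
apply: (@le_lt_trans _ _ (\sum_(c : C) 2 * t ^+ 2)).
  apply: ler_sum => c _; rewrite !ffunE cabs_sqr_ReIm cReB cImB.
  have h1 := vRe c; have h2 := vIm c; rewrite !ffunE in h1 h2.
  move: h1 h2; rewrite !ltr_norml => /andP[h1 h2] /andP[h3 h4]; nra.
rewrite sumr_const -mulr_natl -/n.
have -> : d ^+ 2 = 4 * (n + 1) ^+ 2 * t ^+ 2 by rewrite /t; field; lra.
have : 0 < t ^+ 2 by rewrite exprn_gt0.
move: (t ^+ 2) => s; nra.
Qed.

HB.instance Definition _ := Uniform_isComplete.Build V l2_complete.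

Definition l2dot (u v : V) : R[i] := \sum_c u c * Num.conj (v c).

Lemma l2dot_bilinear : bilinear_for (GRing.Scale.Law.clone _ _ *%R _)
  (GRing.Scale.Law.clone _ _ (Num.conj \; *%R) _) l2dot.
Proof.
split=> [u a x y|u a x y]; rewrite /l2dot /= mulr_sumr -big_split;
  apply: eq_bigr => c _; rewrite !ffunE /=.
- by rewrite mulrDl mulrA.
- by rewrite rmorphD rmorphM mulrDr mulrCA.
Qed.

HB.instance Definition _ := bilinear_isBilinear.Build R[i] V V R[i] _ _ l2dot l2dot_bilinear.

Lemma l2dot_herm u v : l2dot u v = (-1) ^+ false * Num.conj (l2dot v u).
Proof.
rewrite expr0 mul1r rmorph_sum; apply: eq_bigr => c _.
by rewrite rmorphM/= conjCK mulrC.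
Qed.

HB.instance Definition _ := isHermitianSesquilinear.Build R[i] V false Num.conj l2dot l2dot_herm.

Lemma l2dotvv u : l2dot u u = (l2form u u)%:C.
Proof.
rewrite l2formvv (raddf_sum (real_complex R)); apply: eq_bigr => c _ /=.
by rewrite cabs_sqr.
Qed.

Lemma l2dot_gt0 u : u != 0 -> 0 < l2dot u u.
Proof.
move=> u0; rewrite l2dotvv ltcR lt_def (rform_ge0 (@l2formP R C)) andbT.
apply: contra_neq u0 => uu; apply: l2norm_eq0; rewrite /l2norm /rnorm uu.
by rewrite sqrtr0.
Qed.

HB.instance Definition _ := isDotProduct.Build R[i] V l2dot l2dot_gt0.

Lemma l2_hs_normE (v : V) : `|v| ^+ 2 = l2dot v v.
Proof. by rewrite l2dotvv -(sqr_rnorm (@l2formP R C)) rmorphXn. Qed.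

Definition l2hilbert : hilbertSpace R :=
  @HilbertSpace R (V : completeNormedModType R[i]) (l2dot : {dot V for Num.conj}) l2_hs_normE.

End L2Space.

(** * Permutation representations *)

Section PermRep.
Variables (R : realType) (C : finType).

(** An element g of an acting group acts on functions by pulling back along the
    action of its inverse. *)
Definition pullback (s : C -> C) (f : l2hilbert R C) : l2hilbert R C :=
  [ffun c => (f : {ffun C -> R[i]^o}) (s c)].

Lemma pullback_linear s : linear (pullback s).
Proof. by move=> z f g; apply/ffunP => c; rewrite !ffunE. Qed.

HB.instance Definition _ s :=
  GRing.isLinear.Build R[i] (l2hilbert R C) (l2hilbert R C) _ (pullback s)
    (pullback_linear s).

Lemma pullback_dot s f g : bijective s ->
  hs_dot (l2hilbert R C) (pullback s f) (pullback s g) =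
  hs_dot (l2hilbert R C) f g.
Proof.
move=> sbij; rewrite [RHS](reindex s) /=; last exact: onW_bij.
by apply: eq_bigr => c _; rewrite !ffunE.
Qed.

Section PermRepDef.
Variables (G : groupType) (a : G -> C -> C).
Hypothesis a1 : forall c, a 1%g c = c.
Hypothesis aM : forall g h c, a (g * h)%g c = a g (a h c).

Fact perm_rep1 f : pullback (a 1^-1%g) f = f.
Proof. by apply/ffunP => c; rewrite ffunE invg1 a1. Qed.

Fact perm_repM g h f : pullback (a (g * h)^-1%g) f =
  pullback (a g^-1%g) (pullback (a h^-1%g) f).
Proof. by apply/ffunP => c; rewrite !ffunE invMg aM. Qed.

Fact perm_rep_unitary g u v :
  hs_dot (l2hilbert R C) (pullback (a g^-1%g) u) (pullback (a g^-1%g) v) =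
  hs_dot (l2hilbert R C) u v.
Proof.
by apply: pullback_dot; exists (a g) => c; rewrite -aM (mulVg, mulgV) a1.
Qed.

Definition perm_rep : unirep G (l2hilbert R C) :=
  @UniRep R G (l2hilbert R C) (fun g => pullback (a g^-1%g))
    perm_rep1 perm_repM perm_rep_unitary.

Lemma perm_repE g f c : (perm_rep g f : {ffun C -> R[i]^o}) c =
  (f : {ffun C -> R[i]^o}) (a g^-1%g c).
Proof. by rewrite /perm_rep /= ffunE. Qed.

End PermRepDef.

Variables (L G : groupType) (alpha : group_action L G).
Variables (a : G -> C -> C).
Hypothesis aP : fin_action alpha a.

Let pi := perm_rep (fin_act1 aP) (fin_actM aP).

(** The quotient is the group of the permutations of C by which G acts. *)
Lemma perm_rep_finite_quotient : factors_through_finite_quotient pi.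
Proof.
have inja g : injective (a g) by exact: can_inj (fin_actK aP g).
pose h g : {perm C} := perm (@inja g^-1%g).
have hM : {morph h : x y / (x * y)%g}.
  by move=> x y; apply/permP => c; rewrite permM !permE invMg (fin_actM aP).
have h1 := morph_one hM.
pose Aset : {set {perm C}} := [set p | `[< exists g, h g = p >]]%SET.
have Agroup : group_set Aset.
  apply/group_setP; split=> [|x y]; rewrite !inE; first by exists 1%g.
  by move=> [g <-] [g' <-]; exists (g * g')%g.
pose A := Group Agroup.
have hA g : h g \in A by rewrite !inE; exists g.
pose act (z : subg_of A) c := (sgval z^-1%g : {perm C}) c.
have act1 c : act 1%g c = c by rewrite /act invg1 perm1.
have actM (g g' : subg_of A) c : act (g * g')%g c = act g (act g' c).
  by rewrite /act invMg permM.
exists (subg_of A), (fun g => subg A (h g)), (perm_rep act1 actM); split.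
- by move=> x y; rewrite hM; apply: val_inj; rewrite /= !subgK// groupM.
- move=> z; have := subgP z; rewrite !inE => -[g hg]; exists g.
  by apply: val_inj; rewrite /= subgK// hg.
- move=> x v; apply/ffunP => c; rewrite !perm_repE /act invgK /=.
  by rewrite subgK// permE.
Qed.

Lemma perm_rep_finite_orbit : finite_orbit_up_to_equivalence alpha pi.
Proof.
apply: (finite_range2 (1%g : L) (fin_act_orbit aP) (fin_act_orbit aP)) => l l' e _.
have piE g v : twist alpha pi l g v = twist alpha pi l' g v.
  apply/ffunP => c; rewrite !perm_repE !actionV; congr (_ _).
  exact: (congr1 (fun f => f g^-1%g c) e).
apply/seteqP; split=> rho [U [Ubij Uiso UE]]; exists U; split=> // g v.
  by rewrite UE piE.
by rewrite UE piE.
Qed.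

Lemma perm_rep_FD_class : FD_class alpha pi.
Proof.
by split; [exact: perm_rep_finite_quotient|exact: perm_rep_finite_orbit].
Qed.

End PermRep.

(** * The discrete torus and rounded shears *)

Section Torus.
Variable p : nat.

(** Z/(2p+1), with representatives in [-p, p]. The modulus is odd so that the
    choice of representatives commutes with opposites. *)
Definition circ := 'I_(p.*2).+1.

Definition circ_of_int (z : int) : circ := (inZp 1 : circ) *~ z.

Definition circ_lift (k : circ) : int :=
  if (k <= p)%N then (k : nat)%:Z else (k : nat)%:Z - (p.*2).+1%:Z.

Lemma circ_of_nat n : circ_of_int n%:Z = inZp n.
Proof.
rewrite /circ_of_int -pmulrn Zp_mulrn; apply: val_inj => /=.
by rewrite modnMml mul1n.
Qed.

Lemma circ_of_intD z w : circ_of_int (z + w) = circ_of_int z + circ_of_int w.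
Proof. by rewrite /circ_of_int mulrzDr. Qed.

Lemma circ_of_intN z : circ_of_int (- z) = - circ_of_int z.
Proof. by rewrite /circ_of_int mulrNz. Qed.

Lemma circ_period : circ_of_int (p.*2).+1%:Z = 0.
Proof. by rewrite circ_of_nat; apply: val_inj; rewrite /= modnn. Qed.

Lemma circ_liftK k : circ_of_int (circ_lift k) = k.
Proof.
rewrite /circ_lift; case: ifP => _; last first.
  by rewrite circ_of_intD circ_of_intN circ_period subr0 circ_of_nat valZpK.
by rewrite circ_of_nat valZpK.
Qed.

Lemma circ_lift_le k : `|circ_lift k| <= p%:Z.
Proof. rewrite /circ_lift; have := ltn_ord k; case: ifP; lia. Qed.

Lemma circ_of_intK z : `|z| <= p%:Z -> circ_lift (circ_of_int z) = z.
Proof.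
case: z => n zp.
  rewrite circ_of_nat /circ_lift /= modn_small; last lia.
  by case: ifP => //; lia.
rewrite NegzE circ_of_intN -[- _]add0r -circ_period -circ_of_intN -circ_of_intD.
have -> : (p.*2).+1%:Z - n.+1%:Z = ((p.*2).+1 - n.+1)%N%:Z by lia.
rewrite circ_of_nat /circ_lift /= modn_small; last lia.
by case: ifP; lia.
Qed.

Lemma circ_liftD k z : `|circ_lift k + z| <= p%:Z ->
  circ_lift (k + circ_of_int z) = circ_lift k + z.
Proof. by move=> kz; rewrite -[in LHS](circ_liftK k) -circ_of_intD circ_of_intK. Qed.

Lemma circ_liftN k : circ_lift (- k) = - circ_lift k.
Proof.
by rewrite -[in LHS](circ_liftK k) -circ_of_intN circ_of_intK// normrN circ_lift_le.
Qed.

Variable R : realType.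

(** Gaussian integers modulo 2p+1. *)
Definition gauss := (circ * circ)%type.

Definition gauss_lift (t : gauss) : R[i] :=
  Complex (circ_lift t.1)%:~R (circ_lift t.2)%:~R.

Definition gauss_round (w : R[i]) : gauss :=
  (circ_of_int (Num.floor (complex.Re w)), circ_of_int (Num.floor (complex.Im w))).

Lemma gauss_liftN t : gauss_lift (- t) = - gauss_lift t.
Proof. by rewrite /gauss_lift /= !circ_liftN !rmorphN. Qed.

Lemma gauss_round0 : gauss_round 0 = 0.
Proof. by rewrite /gauss_round /= floor0. Qed.

Lemma circ_liftD_floor k (a : R) : `|(circ_lift k)%:~R| + `|a| + 1 <= p%:R :> R ->
  (circ_lift (k + circ_of_int (Num.floor a)))%:~R =
  (circ_lift k)%:~R + (Num.floor a)%:~R :> R.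
Proof.
move=> ka; rewrite circ_liftD ?rmorphD//.
rewrite -(ler_int R) intr_norm rmorphD/= -pmulrn; apply: le_trans ka.
apply: le_trans (ler_normD _ _) _; rewrite -addrA lerD2l.
have := floor_le a; have := floorD1_gt a; rewrite rmorphD/=.
rewrite !ler_norml; have := ler_norm a; have := ler_norm (- a); rewrite normrN.
by move=> *; apply/andP; split; lra.
Qed.

Lemma gauss_liftD_round t (w : R[i]) : cabs (gauss_lift t) + cabs w + 1 <= p%:R ->
  cabs (gauss_lift (t + gauss_round w) - (gauss_lift t + w)) <= 2.
Proof.
move=> tw; have h1 := Re_le_abs (gauss_lift t); have h2 := Im_le_abs (gauss_lift t).
have h3 := Re_le_abs w; have h4 := Im_le_abs w.
rewrite -(ler_pXn2r (ltn0Sn 1)) ?nnegrE ?cabs_ge0// cabs_sqr_ReIm.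
case: w tw h3 h4 => a b tw h3 h4; rewrite /= in h1 h2 h3 h4.
rewrite /gauss_lift /gauss_round /= !circ_liftD_floor; [|lra|lra].
have ha1 := floor_le a; have ha2 := floorD1_gt a.
have hb1 := floor_le b; have hb2 := floorD1_gt b.
rewrite !rmorphD/= in ha2 hb2.
move: (Num.floor a)%:~R (Num.floor b)%:~R ha1 ha2 hb1 hb2 => fa fb *; nra.
Qed.

Variable N : nat.

Definition grid := {ffun 'I_N -> gauss}.

Definition grid_lift (x : grid) : 'rV[R[i]]_N := \row_c gauss_lift (x c).

Definition grid_round (w : 'rV[R[i]]_N) : grid := [ffun c => gauss_round (w 0 c)].

Local Notation nrm := (rnorm (@rvform R N)).

Lemma grid_liftD_round x w : nrm (grid_lift x) + nrm w + 1 <= p%:R ->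
  nrm (grid_lift (x + grid_round w) - (grid_lift x + w)) <= 2 * N%:R.
Proof.
move=> xw; rewrite mulrC; apply: rnorm_le_coord => c; rewrite !mxE !ffunE.
apply: gauss_liftD_round; apply: le_trans xw; rewrite lerD2r; apply: lerD.
  by have := cabs_le_rnorm (grid_lift x) c; rewrite mxE.
exact: cabs_le_rnorm.
Qed.

(** Right multiplication by 1 + A, rounded to the grid. *)
Definition shear (A : 'M[R[i]]_N) (x : grid) : grid :=
  x + grid_round (grid_lift x *m A).

(** The coordinates in D are translated by a function of the coordinates outside D,
    which are kept. Such a map can be undone, whatever the rounding. *)
Lemma shear_bij (D : pred 'I_N) (A : 'M[R[i]]_N) :
  (forall c c', A c c' != 0 -> ~~ D c && D c') -> bijective (shear A).
Proof.
move=> AD.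
have outside x c : ~~ D c -> grid_round (grid_lift x *m A) c = 0.
  move=> Dc; rewrite ffunE mxE big1 ?gauss_round0// => c' _.
  have [->|/AD/andP[_]] := eqVneq (A c' c) 0; first by rewrite mulr0.
  by rewrite (negPf Dc).
have key (x y : grid) : (forall c, ~~ D c -> x c = y c) ->
    grid_lift x *m A = grid_lift y *m A.
  move=> xy; apply/rowP => c'; rewrite !mxE; apply: eq_bigr => c _; rewrite !mxE.
  have [->|/AD/andP[Dc _]] := eqVneq (A c c') 0; first by rewrite !mulr0.
  by rewrite xy.
exists (fun x => x - grid_round (grid_lift x *m A)) => x; rewrite /shear.
  rewrite [grid_lift (x + _) *m A](key _ x) ?addrK// => c Dc.
  by rewrite ffunE outside ?addr0.
rewrite [grid_lift (x - _) *m A](key _ x) ?subrK// => c Dc.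
have subE (f g : grid) : (f - g) c = f c - g c by rewrite !ffunE.
by rewrite subE outside ?subr0.
Qed.

End Torus.

Section Tracks.
Variables (R : realType) (N : nat).
Local Notation nrm := (rnorm (@rvform R N)).
Local Notation lift := (@grid_lift _ R N).

Lemma mx_bounded (M : 'M[R[i]]_N) :
  exists m, 0 <= m /\ forall y, nrm (y *m M) <= m * nrm y.
Proof.
pose S := \sum_i \sum_j cabs (M i j).
have S0 : 0 <= S by do 2 (apply: sumr_ge0 => ? _); exact: cabs_ge0.
exists (N%:R * S); split=> [|y]; first by rewrite mulr_ge0.
rewrite -mulrA; apply: rnorm_le_coord => j; rewrite mxE.
apply: le_trans (cabs_sum _ _) _; rewrite mulr_suml; apply: ler_sum => i _.
rewrite cabsM mulrC; apply: ler_pM; rewrite ?cabs_ge0 ?cabs_le_rnorm//.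
by rewrite (bigD1 j)//= lerDl sumr_ge0// => j' _; exact: cabs_ge0.
Qed.

(** The maps f p approximate right multiplication by M on the grids, with an error
    that depends neither on p nor on the point, provided that p is so large compared
    with the norm of the point that the torus does not wrap around. *)
Definition tracks (f : forall p, grid p N -> grid p N) (M : 'M[R[i]]_N) :=
  exists c, 0 <= c /\ forall p (r : R) (x : grid p N), 0 <= r ->
    c * (r + 1) <= p%:R -> nrm (lift x) <= r ->
    nrm (lift (f p x) - lift x *m M) <= c.

Lemma shear_tracks (A : 'M[R[i]]_N) : tracks (fun p => @shear p R N A) (1%:M + A).
Proof.
have [m [m0 mA]] := mx_bounded A; have rP := rvformP R N.
exists (2 * N%:R + m + 1); split=> [|p r x r0 rp xr].
  by rewrite !addr_ge0// mulr_ge0.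
rewrite mulmxDr mulmx1 /shear; apply: le_trans (grid_liftD_round _) _.
  have := mA (lift x); have : 0 <= N%:R :> R by [].
  have := ler_wpM2l m0 xr.
  move: (N%:R) (nrm _) (nrm _) xr rp => n u w; nra.
lra.
Qed.

Lemma tracks_comp f g M M' : tracks f M -> tracks g M' ->
  tracks (fun p => g p \o f p) (M *m M').
Proof.
move=> [c [c0 cf]] [d [d0 dg]]; have rP := rvformP R N.
have [m [m0 mM]] := mx_bounded M; have [m' [m'0 mM']] := mx_bounded M'.
exists (c + d * (m + c + 1) + m' * c + d); split=> [|p r x r0 rp xr].
  by rewrite !addr_ge0 ?mulr_ge0 ?addr_ge0.
have dm : 0 <= d * (m + c + 1) by rewrite mulr_ge0 ?addr_ge0.
have m'c : 0 <= m' * c by rewrite mulr_ge0.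
have h1 : nrm (lift (f p x) - lift x *m M) <= c by apply: cf xr => //; nra.
have fx : nrm (lift (f p x)) <= m * r + c.
  rewrite -[lift (f p x)](subrK (lift x *m M)).
  apply: le_trans (rnormD rP _ _) _; rewrite addrC; apply: lerD => //.
  by apply: le_trans (mM _) _; rewrite ler_wpM2l.
have h2 : nrm (lift (g p (f p x)) - lift (f p x) *m M') <= d.
  apply: dg fx; first by rewrite addr_ge0 ?mulr_ge0.
  apply: le_trans rp; apply: (@le_trans _ _ (d * (m + c + 1) * (r + 1))); last nra.
  rewrite -mulrA ler_wpM2l//; nra.
rewrite mulmxA /= -[_ - _](subrKA (lift (f p x) *m M')).
apply: le_trans (rnormD rP _ _) _; rewrite -mulmxBl.
apply: le_trans (lerD h2 (le_trans (mM' _) (ler_wpM2l m'0 h1))) _.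
by move: (d * _) dm (m' * c) m'c => u u0 w w0 {h1 h2 rp}; lra.
Qed.

End Tracks.

(** * Swapping two families of vectors by shears *)

Section PartialIsometry.
Variables (C : numClosedFieldType) (n1 n2 : nat) (V : 'M[C]_(n1, n2)).
Hypothesis VVV : V *m V^t* *m V = V.

Definition rot_lower : 'M[C]_(n1 + n2) := block_mx 0 0 (- V^t*) 0.
Definition rot_upper : 'M[C]_(n1 + n2) := block_mx 0 V 0 0.
(** The factorization of a plane rotation by a right angle into three shears, with V
    in place of 1. For a partial isometry V it rotates the initial and the final
    space of V into each other and is the identity on their complements. *)
Definition rot : 'M[C]_(n1 + n2) :=
  (1%:M + rot_lower) *m (1%:M + rot_upper) *m (1%:M + rot_lower).

Let VtVVt : V^t* *m V *m V^t* = V^t*.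
Proof.
by have := congr1 (fun X => X^t*) VVV; rewrite !trmx_mul !map_mxM trmxCK mulmxA.
Qed.

Lemma rotE : rot = block_mx (1%:M - V *m V^t*) V (- V^t*) (1%:M - V^t* *m V).
Proof.
rewrite /rot /rot_lower /rot_upper (scalar_mx_block n1 n2) !add_block_mx !addr0 !add0r.
rewrite !mulmx_block !mul1mx !mulmx1 !mul0mx !mulmx0 !addr0 !add0r.
rewrite !mulNmx !mulmxN; congr block_mx; last by rewrite addrC.
by rewrite mulmxDl mulNmx VtVVt mul1mx addNr oppr0 addr0.
Qed.

Lemma rot_unitary : rot *m rot^t* = 1%:M.
Proof.
have trB m n (A B : 'M[C]_(m, n)) : (A - B)^t* = A^t* - B^t*.
  by rewrite linearB map_mxB.
have tr1 n : (1%:M : 'M[C]_n)^t* = 1%:M by rewrite trmx1 map_mx1.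
have trM m n p (A : 'M[C]_(m, n)) (B : 'M[C]_(n, p)) : (A *m B)^t* = B^t* *m A^t*.
  by rewrite trmx_mul map_mxM.
have trN m n (A : 'M[C]_(m, n)) : (- A)^t* = - A^t* by rewrite linearN map_mxN.
rewrite rotE tr_block_mx map_block_mx !(trB, trM, trN, tr1) !trmxCK mulmx_block.
rewrite (scalar_mx_block n1 n2); congr block_mx.
- rewrite mulmxBr mulmx1 mulmxBl mul1mx [V *m V^t* *m _]mulmxA VVV subrr subr0 subrK //.
- rewrite mulmxN mulmxBl mul1mx VVV subrr oppr0 mulmxBr mulmx1 mulmxA VVV subrr addr0 //.
- rewrite mulNmx mulmxBr mulmx1 mulmxA VtVVt subrr oppr0 mulmxBl mul1mx VtVVt subrr addr0 //.
- rewrite mulNmx mulmxN opprK mulmxBr mulmx1 mulmxBl mul1mx [V^t* *m V *m (_ *m _)]mulmxA VtVVt subrr subr0 addrC subrK //.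
Qed.

Lemma rot_swap k (W1 : 'M[C]_(k, n1)) (W2 : 'M[C]_(k, n2)) :
  W1 *m V = W2 -> W2 *m V^t* = W1 -> row_mx W1 0 *m rot = row_mx 0 W2.
Proof.
move=> WV VW; rewrite rotE mul_row_block !mul0mx !addr0 mulmxBr mulmx1 mulmxA.
by rewrite WV VW subrr.
Qed.

End PartialIsometry.

(** * Linear functionals cut off at a scale *)

Section Wave.
Variables (R : realType) (N : nat).
Local Notation nrm := (rnorm (@rvform R N)).
Let rP := rvformP R N.

Definition rvdot (w y : 'rV[R[i]]_N) : R[i] := (w *m y^t*) 0 0.

Lemma rvdotE w y : rvdot w y = \sum_c w 0 c * Num.conj (y 0 c).
Proof. by rewrite /rvdot mxE; apply: eq_bigr => c _; rewrite !mxE. Qed.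

Lemma rnormZ_complex (z : R[i]) y : nrm (z *: y) = cabs z * nrm y.
Proof.
rewrite /rnorm !rvformvv; under eq_bigr => x _ do rewrite mxE cabsM exprMn.
by rewrite -mulr_sumr sqrtrM ?sqr_ge0// sqrtr_sqr ger0_norm ?cabs_ge0.
Qed.

Lemma rvdot_le w y : cabs (rvdot w y) <= nrm w * nrm y.
Proof.
have [z0|z0] := eqVneq (cabs (rvdot w y)) 0.
  by rewrite z0 mulr_ge0 ?rnorm_ge0.
have zp : 0 < cabs (rvdot w y) by rewrite lt_def z0 cabs_ge0.
rewrite -(ler_pM2l zp).
have := rform_le rP w (rvdot w y *: y); rewrite rnormZ_complex mulrCA.
apply: le_trans; rewrite /rvform linearZ map_mxZ -scalemxAr mxE mulrC.
rewrite -expr2 cabs_sqr_Re mulrC; exact: lexx.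
Qed.

Lemma rvdotBr w y y' : rvdot w (y - y') = rvdot w y - rvdot w y'.
Proof. by rewrite /rvdot linearB map_mxB mulmxBr !mxE. Qed.

Variable r : R.
Hypothesis r0 : 0 < r.

(** Quadratic in y, so that it is radial and its Lipschitz constant is of order
    1/r. *)
Definition cutoff (y : 'rV[R[i]]_N) : R := Num.max 0 (1 - rvform y y / r ^+ 2).

Lemma cutoff_ge0 y : 0 <= cutoff y.
Proof. by rewrite /cutoff le_max lexx. Qed.

Lemma cutoff_le1 y : cutoff y <= 1.
Proof.
rewrite /cutoff ge_max ler01/= lerBlDr lerDl divr_ge0 ?sqr_ge0//.
exact: (rform_ge0 rP).
Qed.

Lemma cutoff_out y : r <= nrm y -> cutoff y = 0.
Proof.
move=> ry; apply/max_idPl; rewrite subr_le0 ler_pdivlMr ?exprn_gt0// mul1r.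
rewrite -(sqr_rnorm rP) ler_pXn2r ?nnegrE ?rnorm_ge0//; exact: ltW.
Qed.

Lemma cutoff_lip y y' : r ^+ 2 * `|cutoff y - cutoff y'| <= `|rvform y y - rvform y' y'|.
Proof.
have r2 : 0 < r ^+ 2 by rewrite exprn_gt0.
have h (s t : R) : `|Num.max 0 s - Num.max 0 t| <= `|s - t|.
  rewrite !ler_norml; have := ler_norm (s - t); have := ler_norm (- (s - t)).
  rewrite normrN; case: (lerP 0 s) => ?; case: (lerP 0 t) => ? ? ?;
    by apply/andP; split; lra.
apply: le_trans (ler_wpM2l (ltW r2) (h _ _)) _.
rewrite -[X in X * _]gtr0_norm// -normrM distrC.
by have -> : r ^+ 2 * (1 - rvform y y / r ^+ 2 - (1 - rvform y' y' / r ^+ 2)) =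
  rvform y' y' - rvform y y by field; rewrite lt0r_neq0.
Qed.

Definition wave (w y : 'rV[R[i]]_N) : R[i] := rvdot w y * (cutoff y)%:C.

(** Let y1 be within c of y U. The functionals at y1 and y U differ by at most c |w|;
    the cutoffs differ by a multiple of c / r, against a functional of size at most
    r |w|. The scale r cancels: the change of a wave does not depend on r, whereas
    its typical size grows with r. *)
Lemma wave_lip (U : 'M[R[i]]_N) (w w' y y1 : 'rV[R[i]]_N) (c : R) :
  U *m U^t* = 1%:M -> w *m U = w' -> nrm y <= r -> nrm (y1 - y *m U) <= c -> c <= r ->
  cabs (wave w' y1 - wave w y) <= 4 * c * nrm w.
Proof.
move=> Uu wU yr y1c cr.
have rvU (a b : 'rV[R[i]]_N) : rvdot (a *m U) (b *m U) = rvdot a b.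
  by rewrite /rvdot trmx_mul map_mxM mulmxA -[a *m U *m _]mulmxA Uu mulmx1.
have rfU a b : rvform (a *m U) (b *m U) = rvform a b.
  by rewrite /rvform -/(rvdot _ _) rvU.
have nU a : nrm (a *m U) = nrm a by rewrite /rnorm rfU.
have c0 : 0 <= c by apply: le_trans y1c; exact: rnorm_ge0.
have h1 : cabs (rvdot w' y1 - rvdot w y) <= c * nrm w.
  rewrite -(rvU w y) wU -rvdotBr; apply: le_trans (rvdot_le _ _) _.
  by rewrite -wU nU mulrC ler_wpM2r ?rnorm_ge0.
have h2 : cabs (rvdot w y) <= r * nrm w.
  by apply: le_trans (rvdot_le _ _) _; rewrite mulrC ler_wpM2r ?rnorm_ge0.
have h3 : r * `|cutoff y1 - cutoff y| <= 3 * c.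
  rewrite -(ler_pM2l r0) mulrA -expr2; apply: le_trans (cutoff_lip _ _) _.
  have [e eE] : exists e, e = y1 - y *m U by eexists.
  rewrite -eE in y1c; have -> : y1 = y *m U + e by rewrite eE addrC subrK.
  rewrite !(rformE rP) (rformC rP e) rfU.
  have -> : rvform y y + rvform (y *m U) e + (rvform (y *m U) e + rvform e e) - rvform y y
   = 2 * rvform (y *m U) e + rvform e e by ring.
  have k1 := rform_CS rP (y *m U) e.
  have k2 : `|rvform (y *m U) e| <= r * c.
    apply: (@le_trans _ _ (nrm (y *m U) * nrm e)); last first.
      by rewrite nU; apply: ler_pM; rewrite ?rnorm_ge0.
    rewrite -(ler_pXn2r (ltn0Sn 1)) ?nnegrE ?mulr_ge0 ?rnorm_ge0//.
    by rewrite real_normK ?num_real// exprMn !(sqr_rnorm rP).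
  have k3 : rvform e e <= c * r.
    rewrite -(sqr_rnorm rP) expr2; apply: ler_pM; rewrite ?rnorm_ge0//.
    exact: le_trans cr.
  apply: le_trans (ler_normD _ _) _; rewrite normrM ger0_norm//.
  rewrite (ger0_norm (rform_ge0 rP e)); lra.
have -> : wave w' y1 - wave w y = (rvdot w' y1 - rvdot w y) * (cutoff y1)%:C +
   rvdot w y * (cutoff y1 - cutoff y)%:C.
  by rewrite /wave rmorphB/=; ring.
apply: le_trans (cabsD _ _) _; rewrite !cabsM cabs_real ?cutoff_ge0//.
have cr1 (s : R) : cabs s%:C = `|s|.
  by rewrite /cabs normc_def /= expr0n addr0 sqrtr_sqr.
rewrite cr1; have n0 := rnorm_ge0 (@rvform R N) w.
have k1 : cabs (rvdot w' y1 - rvdot w y) * cutoff y1 <= c * nrm w.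
  apply: le_trans h1; rewrite ler_piMr ?cabs_ge0 ?cutoff_le1//.
have k2 : cabs (rvdot w y) * `|cutoff y1 - cutoff y| <= 3 * c * nrm w.
  apply: (@le_trans _ _ (r * nrm w * `|cutoff y1 - cutoff y|)).
    by rewrite ler_wpM2r.
  by rewrite mulrAC ler_wpM2r.
lra.
Qed.

End Wave.

Lemma cutoff_ext (R : realType) N (r : R) (y y' : 'rV[R[i]]_N) :
  rvform y y = rvform y' y' -> cutoff r y = cutoff r y'.
Proof. by rewrite /cutoff => ->. Qed.

(** * Isotropy of the grid *)

Section Isotropy.
Variables (R : realType) (N p : nat) (r : R) (c0 : 'I_N).
Local Notation nrm := (rnorm (@rvform R N)).
Local Notation lift := (@grid_lift p R N).
Local Notation gl := (@gauss_lift p R).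

(** The second moment of a coordinate for the weight cutoff^2. *)
Definition wave_mass : R :=
  \sum_(x : grid p N) cabs (gl (x c0)) ^+ 2 * cutoff r (lift x) ^+ 2.

(** Exchange the coordinates c and c0. *)
Lemma wave_massE c :
  \sum_(x : grid p N) cabs (gl (x c)) ^+ 2 * cutoff r (lift x) ^+ 2 = wave_mass.
Proof.
pose s (x : grid p N) : grid p N := [ffun i => x (tperm c c0 i)].
have ss : involutive s by move=> x; apply/ffunP => i; rewrite !ffunE tpermK.
rewrite (reindex s) /=; last exact: onW_bij (inv_bij ss).
apply: eq_bigr => x _; rewrite ffunE tpermL.
rewrite (@cutoff_ext _ _ _ (lift (s x)) (lift x))// !rvformvv.
rewrite [RHS](reindex (tperm c c0)) /=; last exact: onW_bij (inv_bij (tpermK _ _)).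
by apply: eq_bigr => i _; rewrite !mxE ffunE.
Qed.

(** Changing the sign of coordinate c preserves the grid and the cutoff, and reverses
    the sign of the sum. *)
Lemma grid_lift_off_diag c c' : c != c' ->
  \sum_(x : grid p N) gl (x c) * Num.conj (gl (x c')) * (cutoff r (lift x) ^+ 2)%:C = 0.
Proof.
move=> cc'; set S := \sum_x _.
pose s (x : grid p N) : grid p N := [ffun i => if i == c then - x i else x i].
have ss : involutive s.
  by move=> x; apply/ffunP => i; rewrite !ffunE; case: eqP => _; rewrite ?opprK.
suff SN : S = - S.
  apply/eqP; have : S + S = 0 by rewrite {2}SN subrr.
  by rewrite -mulr2n => /eqP; rewrite mulrn_eq0.
rewrite {1}/S (reindex s) /=; last exact: onW_bij (inv_bij ss).
rewrite -sumrN; apply: eq_bigr => x _; rewrite !ffunE eqxx eq_sym (negPf cc').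
rewrite gauss_liftN !mulNr.
rewrite (@cutoff_ext _ _ _ (lift (s x)) (lift x))// !rvformvv.
apply: eq_bigr => i _; rewrite !mxE ffunE; case: eqP => // _.
by rewrite gauss_liftN cabsN.
Qed.

(** The second moments of the coordinates form a scalar matrix. *)
Lemma wave_gram (w w' : 'rV[R[i]]_N) :
  \sum_(x : grid p N) wave r w (lift x) * Num.conj (wave r w' (lift x)) =
  wave_mass%:C * rvdot w w'.
Proof.
pose S c c' := \sum_(x : grid p N) gl (x c') * Num.conj (gl (x c)) * (cutoff r (lift x) ^+ 2)%:C.
transitivity (\sum_c \sum_c' w 0 c * Num.conj (w' 0 c') * S c c').
  under [RHS]eq_bigr => c _ do
    (under eq_bigr => c' _ do rewrite mulr_sumr; rewrite exchange_big).
  rewrite exchange_big; apply: eq_bigr => x _ /=.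
  have conj_cutoff : Num.conj (cutoff r (lift x))%:C = (cutoff r (lift x))%:C :> R[i].
    exact: conjc_real.
  rewrite /wave rmorphM/= conj_cutoff !rvdotE rmorph_sum/= mulrACA mulr_suml.
  rewrite mulr_suml; apply: eq_bigr => c _.
  rewrite mulr_sumr mulr_suml; apply: eq_bigr => c' _.
  by rewrite !mxE rmorphM/= conjCK rmorphXn/=; ring.
rewrite rvdotE mulr_sumr; apply: eq_bigr => c _.
rewrite (bigD1 c)//= big1 ?addr0; last first.
  by move=> c' cc'; rewrite /S grid_lift_off_diag ?mulr0.
rewrite -(wave_massE c) /S mulrC; congr (_ * _).
rewrite (raddf_sum (real_complex R)); apply: eq_bigr => x _ /=.
by rewrite -cabs_sqr -rmorphM.
Qed.

End Isotropy.

(** * Mass and cardinality of a ball *)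

Section Counting.
Variables (R : realType) (N p : nat) (c0 : 'I_N).
Local Notation nrm := (rnorm (@rvform R N)).
Local Notation lift := (@grid_lift p R N).
Local Notation gl := (@gauss_lift p R).

Lemma card_grid_ball (r : nat) :
  (#|[set x : grid p N | (nrm (lift x) <= r%:R)%R]%SET| <= (r.*2.+1 ^ N.*2))%N.
Proof.
pose f (x : grid p N) : {ffun 'I_N -> 'I_r.*2.+1 * 'I_r.*2.+1} :=
  [ffun c => (inord `|circ_lift (x c).1 + r%:Z|, inord `|circ_lift (x c).2 + r%:Z|)].
have bound (x : grid p N) c : nrm (lift x) <= r%:R ->
    `|circ_lift (x c).1| <= r%:Z /\ `|circ_lift (x c).2| <= r%:Z.
  move=> xr; have := le_trans (cabs_le_rnorm (lift x) c) xr; rewrite mxE => xc.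
  have := le_trans (Re_le_abs _) xc; have := le_trans (Im_le_abs _) xc.
  by rewrite /= -!intr_norm pmulrn !ler_int.
have finj : {in [set x : grid p N | (nrm (lift x) <= r%:R)%R]%SET &, injective f}.
  move=> x y; rewrite !inE => xr yr fxy; apply/ffunP => c.
  have [x1 x2] := bound x c xr; have [y1 y2] := bound y c yr.
  have := congr1 (fun h : {ffun 'I_N -> 'I_r.*2.+1 * 'I_r.*2.+1} => h c) fxy.
  rewrite !ffunE => -[e1 e2].
  apply: injective_projections.
    rewrite -[LHS]circ_liftK -[RHS]circ_liftK; congr circ_of_int.
    by have := congr1 val e1; rewrite /= !inordK; lia.
  rewrite -[LHS]circ_liftK -[RHS]circ_liftK; congr circ_of_int.
  by have := congr1 val e2; rewrite /= !inordK; lia.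
rewrite -(card_in_imset finj); apply: leq_trans (max_card _) _.
by rewrite card_ffun card_prod !card_ord mulnn -expnM mul2n.
Qed.

(** There are q^(2N) points all of whose real and imaginary parts lie in [q, 2q). For
    them |x_c0|^2 is at least 2 q^2, and the radius is chosen so that the cutoff is at
    least 1/2. *)
Lemma wave_mass_ge (q : nat) : (0 < q)%N -> (q.*2 <= p)%N ->
  (q ^ N.*2)%:R * (q%:R ^+ 2 / 2) <= wave_mass p (4 * q * N.+1)%:R c0 :> R.
Proof.
move=> q0 qp; set r : R := (4 * q * N.+1)%:R.
pose g (y : {ffun 'I_N -> 'I_q * 'I_q}) : grid p N :=
  [ffun c => (circ_of_int p (q + (y c).1)%N%:Z, circ_of_int p (q + (y c).2)%N%:Z)].
have gK (k : 'I_q) : circ_lift (circ_of_int p (q + k)%N%:Z) = (q + k)%N%:Z.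
  by apply: circ_of_intK; have := ltn_ord k; lia.
have ginj : injective g.
  move=> y z e; apply/ffunP => c.
  have := congr1 (fun h : grid p N => h c) e; rewrite !ffunE => -[e1 e2].
  apply: injective_projections; apply: val_inj => /=.
    by have := congr1 (@circ_lift p) e1; rewrite !gK; lia.
  by have := congr1 (@circ_lift p) e2; rewrite !gK; lia.
have sqrE (y : {ffun 'I_N -> 'I_q * 'I_q}) c :
    cabs (gl (g y c)) ^+ 2 = (q + (y c).1)%N%:R ^+ 2 + (q + (y c).2)%N%:R ^+ 2 :> R.
  by rewrite cabs_sqr_ReIm ffunE /= !gK -!pmulrn.
have kb (k : 'I_q) : (q%:R <= (q + k)%N%:R :> R) && ((q + k)%N%:R <= 2 * q%:R :> R).
  by rewrite -natrM !ler_nat; have := ltn_ord k; lia.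
have q1 : 1 <= q%:R :> R by rewrite ler1n.
have kb2 (k : 'I_q) : (q%:R ^+ 2 <= (q + k)%N%:R ^+ 2 :> R) &&
    ((q + k)%N%:R ^+ 2 <= 4 * q%:R ^+ 2 :> R).
  have /andP[] := kb k; move: (q%:R : R) ((q + k)%N%:R : R) q1 => x a *.
  by apply/andP; split; nra.
have cut (y : {ffun 'I_N -> 'I_q * 'I_q}) : 1 / 2 <= cutoff r (lift (g y)).
  rewrite /cutoff le_max; apply/orP; right.
  have : rvform (lift (g y)) (lift (g y)) <= 8 * q%:R ^+ 2 * N%:R.
    rewrite rvformvv; apply: (@le_trans _ _ (\sum_(c < N) 8 * q%:R ^+ 2)).
      apply: ler_sum => c _; rewrite mxE sqrE.
      have /andP[? ?] := kb2 (y c).1; have /andP[? ?] := kb2 (y c).2; lra.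
    by rewrite sumr_const card_ord mulr_natr.
  move: (rvform _ _) => s sle.
  have r2 : r ^+ 2 = 16 * q%:R ^+ 2 * (N%:R + 1) ^+ 2.
    by rewrite /r !natrM -natr1; ring.
  have N0 : 0 <= N%:R :> R by [].
  have q2 : 0 < q%:R ^+ 2 :> R by rewrite exprn_gt0// (lt_le_trans ltr01).
  suff : s / r ^+ 2 <= 1 / 2 by move: (s / _) => u hu; lra.
  rewrite r2 ler_pdivrMr; last by rewrite !mulr_gt0 ?exprn_gt0//; lra.
  apply: le_trans sle _; move: (q%:R ^+ 2) q2 (N%:R) N0 => a a0 n n0.
  have := mulr_ge0 (ltW a0) n0; have := mulr_ge0 (ltW a0) (sqr_ge0 n); nra.
rewrite /wave_mass.
apply: (@le_trans _ _ (\sum_(x in [set g y | y : {ffun 'I_N -> 'I_q * 'I_q}]%SET)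
    cabs (gl (x c0)) ^+ 2 * cutoff r (lift x) ^+ 2)); last first.
  rewrite [leRHS](bigID (mem [set g y | y : {ffun 'I_N -> 'I_q * 'I_q}]%SET))/= lerDl.
  by apply: sumr_ge0 => x _; rewrite mulr_ge0 ?sqr_ge0.
rewrite big_imset /=; last by move=> y z _ _; exact: ginj.
apply: (@le_trans _ _ (\sum_(y : {ffun 'I_N -> 'I_q * 'I_q}) q%:R ^+ 2 / 2)).
  rewrite sumr_const card_ffun card_prod !card_ord mulnn -expnM mul2n -[leRHS]mulr_natl //.
apply: ler_sum => y _; rewrite sqrE.
have /andP[h1 _] := kb2 (y c0).1; have /andP[h2 _] := kb2 (y c0).2.
have h3 : 1 / 4 <= cutoff r (lift (g y)) ^+ 2.
  by have := cut y; move: (cutoff _ _) => s hs; nra.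
have h4 : 0 <= q%:R ^+ 2 :> R by rewrite sqr_ge0.
move: h1 h2 h3 h4; set a := _ ^+ 2; set b := (q + _)%N%:R ^+ 2.
set d := (q + _)%N%:R ^+ 2; set e := _ ^+ 2 => *; nra.
Qed.

End Counting.

(** * Finite actions on grids *)

Section FinActionConstructions.
Variables (L G : groupType) (alpha : group_action L G).

Lemma fin_action_transport (C D : finType) (e : C -> D) (e' : D -> C)
    (a : G -> C -> C) : cancel e e' -> cancel e' e -> fin_action alpha a ->
  fin_action alpha (fun g d => e (a g (e' d))).
Proof.
move=> eK e'K aP; split=> [d|g h d|].
- by rewrite (fin_act1 aP) e'K.
- by rewrite (fin_actM aP) eK.
- apply: (finite_range2 (1%g : L) (fin_act_orbit aP) (fin_act_orbit aP)).
  move=> l l' e1 _; apply/funext => g; apply/funext => d; congr (e _).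
  exact: (congr1 (fun f => f g (e' d)) e1).
Qed.

Lemma fin_action_fun (C T : finType) (a : G -> C -> C) : fin_action alpha a ->
  fin_action alpha (fun g (z : {ffun C -> T}) => [ffun c => z (a g^-1%g c)]).
Proof.
move=> aP; split=> [z|g h z|].
- by apply/ffunP => c; rewrite ffunE invg1 (fin_act1 aP).
- by apply/ffunP => c; rewrite !ffunE invMg (fin_actM aP).
- apply: (finite_range2 (1%g : L) (fin_act_orbit aP) (fin_act_orbit aP)).
  move=> l l' e1 _; apply/funext => g; apply/funext => z; apply/ffunP => c.
  rewrite !ffunE !actionV; congr (z _).
  exact: (congr1 (fun f => f g^-1%g c) e1).
Qed.

Lemma coef_transport (R : realType) (C D : finType) (e : C -> D) (e' : D -> C)
    (a : G -> C -> C) (u v : D -> R[i]) g : cancel e e' -> cancel e' e ->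
  coef (fun g d => e (a g (e' d))) u v g = coef a (u \o e) (v \o e) g.
Proof.
move=> eK e'K; rewrite /coef (reindex e) /=; last first.
  by apply: onW_bij; exists e'.
by apply: eq_bigr => c _; rewrite eK.
Qed.

Section WaveCoef.
Variables (R : realType) (N p : nat) (r : R) (c0 : 'I_N).
Variable a : G -> 'I_N -> 'I_N.
Hypothesis aP : fin_action alpha a.

(** The cutoff is invariant under permutations of coordinates, so a permutation of x
    can be carried over to w. *)
Lemma wave_coef (w w' : 'rV[R[i]]_N) g :
  coef (fun g (z : grid p N) => [ffun c => z (a g^-1%g c)] : grid p N)
    (fun z => wave r w (grid_lift R z)) (fun z => wave r w' (grid_lift R z)) g =
  (wave_mass p r c0)%:C * coef a (w 0) (w' 0) g.
Proof.
pose wg : 'rV[R[i]]_N := \row_c w 0 (a g^-1%g c).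
have -> : coef a (w 0) (w' 0) g = rvdot wg w'.
  by rewrite rvdotE; apply: eq_bigr => c _; rewrite mxE.
rewrite -wave_gram; apply: eq_bigr => z _; congr (_ * _).
set z' := [ffun c => _].
have bij : bijective (a g) by exact: (fin_act_bij aP).
rewrite /wave (@cutoff_ext _ _ _ (grid_lift R z') (grid_lift R z)); last first.
  rewrite !rvformvv [RHS](reindex (a g)) /=; last exact: onW_bij bij.
  by apply: eq_bigr => c _; rewrite /z' !mxE ffunE invgK.
congr (_ * _); rewrite !rvdotE [RHS](reindex (a g)) /=; last exact: onW_bij bij.
by apply: eq_bigr => c _; rewrite /z' !mxE ffunE invgK (fin_actK aP).
Qed.

End WaveCoef.

(** The coordinates of the other block are fixed. *)
Lemma fin_action_lshift n1 n2 (a : G -> 'I_n1 -> 'I_n1) : fin_action alpha a ->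
  exists b : G -> 'I_(n1 + n2) -> 'I_(n1 + n2), fin_action alpha b /\
    forall (R : realType) (u v : 'rV[R[i]]_n1) g,
      coef b ((row_mx u 0 : 'rV_(n1 + n2)) 0) ((row_mx v 0 : 'rV_(n1 + n2)) 0) g = coef a (u 0) (v 0) g.
Proof.
move=> aP.
have sP := fin_action_sum aP (fin_action_trivial alpha 'I_n2).
eexists; split; first exact: (fin_action_transport (@unsplitK n1 n2) (@splitK n1 n2) sP).
move=> R u v g; rewrite (coef_transport _ _ _ _ (@unsplitK n1 n2) (@splitK n1 n2)).
rewrite /coef big_sumType /= [X in _ + X]big1 ?addr0.
  by apply: eq_bigr => c _; rewrite !row_mxEl.
by move=> c _; rewrite !row_mxEr !mxE mul0r.
Qed.

Lemma fin_action_rshift n1 n2 (a : G -> 'I_n2 -> 'I_n2) : fin_action alpha a ->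
  exists b : G -> 'I_(n1 + n2) -> 'I_(n1 + n2), fin_action alpha b /\
    forall (R : realType) (u v : 'rV[R[i]]_n2) g,
      coef b ((row_mx 0 u : 'rV_(n1 + n2)) 0) ((row_mx 0 v : 'rV_(n1 + n2)) 0) g = coef a (u 0) (v 0) g.
Proof.
move=> aP.
have sP := fin_action_sum (fin_action_trivial alpha 'I_n1) aP.
eexists; split; first exact: (fin_action_transport (@unsplitK n1 n2) (@splitK n1 n2) sP).
move=> R u v g; rewrite (coef_transport _ _ _ _ (@unsplitK n1 n2) (@splitK n1 n2)).
rewrite /coef big_sumType /= [X in X + _]big1 ?add0r.
  by apply: eq_bigr => c _; rewrite !row_mxEr.
by move=> c _; rewrite !row_mxEl !mxE mul0r.
Qed.

End FinActionConstructions.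

(** The ball of radius 4 q (N+1) has at most a multiple of q^(2N) points, while its
    mass is at least of order q^(2N+2). *)
Lemma wave_scale (R : realType) N (c0 : 'I_N) (c e : R) : 0 <= c -> 0 < e ->
  exists q : nat, [/\ (0 < q)%N, c <= (4 * q * N.+1)%:R &
    forall p, (q.*2 <= p)%N -> let mass := wave_mass p ((4 * q * N.+1)%:R : R) c0 in
    0 < mass /\
    #|[set x : grid p N |
      (rnorm (@rvform R N) (grid_lift R x) <= (4 * q * N.+1)%:R)%R]%SET|%:R <= e * mass].
Proof.
move=> c_ge0 e0; pose K : R := 2 * ((9 * N.+1) ^ N.*2)%:R / e.
have K0 : 0 <= K by rewrite /K divr_ge0 ?mulr_ge0// ltW.
pose q := (Num.bound (c + K)).+1.
have cK : c + K < q%:R.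
  apply: lt_trans (_ : (Num.bound (c + K))%:R < _); last by rewrite ltr_nat.
  by apply: archi_boundP; rewrite addr_ge0.
have q1 : 1 <= q%:R :> R by rewrite ler1n.
exists q; split=> //.
  apply: (@le_trans _ _ q%:R); first by apply: ltW; lra.
  by rewrite ler_nat; nia.
move=> p qp /=; have mass := wave_mass_ge R c0 (isT : (0 < q)%N) qp.
have qN : 0 < (q ^ N.*2)%:R :> R by rewrite ltr0n expn_gt0.
split; first by apply: lt_le_trans mass; rewrite mulr_gt0// divr_gt0// exprn_gt0//; lra.
apply: le_trans (_ : ((9 * N.+1) ^ N.*2 * q ^ N.*2)%:R <= _).
  rewrite ler_nat; apply: leq_trans (card_grid_ball _ _ _ _) _.
  rewrite -expnMn leq_exp2r ?double_gt0 ?(leq_ltn_trans _ (ltn_ord c0))//.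
  have : (0 < q * N.+1)%N by [].
  have -> : (4 * q * N.+1 = 4 * (q * N.+1))%N by rewrite mulnA.
  have -> : (9 * N.+1 * q = 9 * (q * N.+1))%N by rewrite -mulnA (mulnC q).
  by move: (q * N.+1)%N => m; lia.
apply: le_trans (ler_wpM2l (ltW e0) mass).
rewrite natrM mulrCA [leLHS]mulrC ler_pM2l//.
have : 2 * ((9 * N.+1) ^ N.*2)%:R <= e * q%:R.
  by rewrite [leRHS]mulrC -ler_pdivrMr//; apply: le_trans (ltW cK); rewrite /K; lra.
have := ler_wpM2l (mulr_ge0 (ltW e0) (ler0n R q)) q1.
by move: (((9 * N.+1) ^ N.*2)%:R : R) (q%:R : R) => s t; lra.
Qed.

(** * Gluing actions of two groups *)

Section Glue.
Variables (R : realType) (L G1 G2 : groupType).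
Variables (alpha1 : group_action L G1) (alpha2 : group_action L G2).
Variables (n1 n2 k : nat).
Variables (a1 : G1 -> 'I_n1 -> 'I_n1) (a2 : G2 -> 'I_n2 -> 'I_n2).
Hypothesis a1P : fin_action alpha1 a1.
Hypothesis a2P : fin_action alpha2 a2.
Variables (W1 : 'M[R[i]]_(k, n1)) (W2 : 'M[R[i]]_(k, n2)) (M : 'M[R[i]]_k).
Hypothesis W1M : W1 *m W1^t* = M.
Hypothesis W2M : W2 *m W2^t* = M.
Hypothesis Munit : M \in unitmx.
Variable c0 : 'I_(n1 + n2).

Local Notation N := (n1 + n2)%N.

(** Equal Gram matrices make W1_i |-> W2_i an isometry between the spans; V extends it
    by 0 on the orthogonal complement. *)
Lemma gram_partial_isometry : exists V : 'M[R[i]]_(n1, n2),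
  [/\ V *m V^t* *m V = V, W1 *m V = W2 & W2 *m V^t* = W1].
Proof.
have Mherm : M^t* = M by rewrite -W1M trmx_mul map_mxM trmxCK.
have MVherm : (invmx M)^t* = invmx M.
  rewrite trmx_inv map_invmx; congr invmx; exact: Mherm.
pose V := W1^t* *m invmx M *m W2.
have W1V : W1 *m V = W2 by rewrite /V !mulmxA W1M mulmxV// mul1mx.
have VtE : V^t* = W2^t* *m invmx M *m W1.
  by rewrite /V trmx_mul map_mxM trmx_mul map_mxM MVherm trmxCK mulmxA.
have W2V : W2 *m V^t* = W1 by rewrite VtE !mulmxA W2M mulmxV// mul1mx.
exists V; split=> //.
by rewrite {1}/V -[_ *m W2 *m _]mulmxA W2V -mulmxA W1V.
Qed.

(** The functions f i are the normalized waves of W1_i on the grid, and g i are those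
    of W2_i pulled back by theta, the rounded form of the unitary U that carries W1 to
    W2. The group G1 permutes coordinates and G2 permutes them after conjugation by
    theta, which accounts for the coefficients.

    To compare g i with f i, note that both have the same norm, so that
    |g i - f i|^2 = - 2 Re <g i - f i, f i>. Thus only the points of the ball outside
    of which f i vanishes matter, although g i may be nonzero elsewhere. On the ball,
    [wave_lip] bounds the difference by a constant over the square root of the mass,
    and the mass is large compared with the number of points. *)
Lemma glue (eta : R) : 0 < eta ->
  exists (X : finType) (b : free_prod G1 G2 -> X -> X) (f g : 'I_k -> X -> R[i]),
    [/\ fin_action (free_prod_action alpha1 alpha2) b,
        forall i j, coef b (f i) (f j) 1%g = M i j,
        forall x i j, coef b (f i) (f j) (fp_inl G2 x) = coef a1 (W1 i) (W1 j) x,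
        forall y i j, coef b (g i) (g j) (fp_inr G1 y) = coef a2 (W2 i) (W2 j) y &
        forall i, \sum_x cabs (g i x - f i x) ^+ 2 <= eta].
Proof.
move=> eta0; have [V [VVV W1V W2V]] := gram_partial_isometry.
pose U := rot V; have Uu : U *m U^t* = 1%:M by exact: rot_unitary.
have WU : row_mx W1 0 *m U = row_mx 0 W2 by exact: rot_swap.
pose theta p := @shear p R N (rot_lower V) \o
  (@shear p R N (rot_upper V) \o @shear p R N (rot_lower V)).
have theta_bij p : bijective (theta p).
  have lower_bij : bijective (@shear p R N (rot_lower V)).
    apply: (@shear_bij _ _ _ (fun c : 'I_N => (c < n1)%N)) => c c'.
    rewrite -(fintype.splitK c) -(fintype.splitK c'); case: (fintype.split c) => i; case: (fintype.split c') => j /=;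
      rewrite ?block_mxEul ?block_mxEur ?block_mxEdl ?block_mxEdr ?mxE ?eqxx// => _.
    by rewrite ltn_ord -leqNgt leq_addr.
  have upper_bij : bijective (@shear p R N (rot_upper V)).
    apply: (@shear_bij _ _ _ (fun c : 'I_N => (n1 <= c)%N)) => c c'.
    rewrite -(fintype.splitK c) -(fintype.splitK c'); case: (fintype.split c) => i; case: (fintype.split c') => j /=;
      rewrite ?block_mxEul ?block_mxEur ?block_mxEdl ?block_mxEdr ?mxE ?eqxx// => _.
    by rewrite -ltnNge ltn_ord leq_addr.
  exact: (bij_comp lower_bij (bij_comp upper_bij lower_bij)).
have [c [c_ge0 ctrack]] : tracks theta U.
  have lt := shear_tracks (rot_lower V); have ut := shear_tracks (rot_upper V).
  exact: tracks_comp (tracks_comp lt ut) lt.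
pose T : R := \sum_i rvform (row i W1) (row i W1) + 1.
have rv0 i : 0 <= rvform (row i W1) (row i W1) by exact: (rform_ge0 (rvformP R n1)).
have T0 : 0 < T by rewrite ltr_wpDl// sumr_ge0.
have Tge i : rvform (row i W1) (row i W1) <= T.
  by rewrite /T (bigD1 i)//= -addrA lerDl addr_ge0// sumr_ge0.
pose e : R := eta / (2 * T).
have e0 : 0 < e by rewrite divr_gt0// mulr_gt0.
pose e' : R := e ^+ 2 / (16 * c ^+ 2 + 1).
have c16 : 0 < 16 * c ^+ 2 + 1 by rewrite ltr_wpDl// mulr_ge0// sqr_ge0.
have e'0 : 0 < e' by rewrite divr_gt0// exprn_gt0.
have [q [q0 cr scale]] := wave_scale c0 c_ge0 e'0.
set r : R := (4 * q * N.+1)%:R in cr.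
have r0 : 0 < r by rewrite ltr0n !muln_gt0 q0.
(* p is large enough for theta to follow U on the ball of radius r *)
pose p := (q.*2 + Num.bound (c * (r + 1)))%N.
have cp : c * (r + 1) <= p%:R.
  apply: (@le_trans _ _ (Num.bound (c * (r + 1)))%:R); last by rewrite ler_nat leq_addl.
  by apply/ltW/archi_boundP; rewrite mulr_ge0// addr_ge0// ltW.
have [mass0 ball_small] := scale p (leq_addr _ _).
rewrite -/r in mass0 ball_small; set A := wave_mass p r c0 in mass0 ball_small.
pose z : R[i] := (Num.sqrt A^-1)%:C.
have zz : z * Num.conj z = (A^-1)%:C.
  by rewrite -cabs_sqr cabs_real ?sqrtr_ge0// sqr_sqrtr// invr_ge0 ltW.
have zA : z * Num.conj z * A%:C = 1.
  by rewrite zz -rmorphM/= mulVf ?lt0r_neq0.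
pose w1 i : 'rV[R[i]]_N := row_mx (row i W1) 0.
pose w2 i : 'rV[R[i]]_N := row_mx 0 (row i W2).
pose f i (x : grid p N) := z * wave r (w1 i) (grid_lift R x).
pose g' i (x : grid p N) := z * wave r (w2 i) (grid_lift R x).
pose g i (x : grid p N) := g' i (theta p x).
have [b1 [b1P b1E]] := fin_action_lshift n2 a1P.
have [b2 [b2P b2E]] := fin_action_rshift n1 a2P.
have B1P := fin_action_fun (gauss p) b1P.
have B2P := fin_action_fun (gauss p) b2P.
have [theta' thetaK theta'K] := theta_bij p.
have [b [bP bl br]] := fin_action_free_prod B1P (fin_action_transport theta'K thetaK B2P).
have row0 m (Y : 'M[R[i]]_(k, m)) i : (row i Y) 0 = Y i.
  by apply/funext => j; rewrite mxE.
have dot1 i j : rvdot (w1 i) (w1 j) = M i j.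
  rewrite -W1M /rvdot /w1 tr_row_mx map_col_mx mul_row_col trmx0 map_mx0 mulmx0 addr0.
  by rewrite !mxE; apply: eq_bigr => l _; rewrite !mxE.
have dot2 i j : rvdot (w2 i) (w2 j) = M i j.
  rewrite -W2M /rvdot /w2 tr_row_mx map_col_mx mul_row_col trmx0 map_mx0 mulmx0 add0r.
  by rewrite !mxE; apply: eq_bigr => l _; rewrite !mxE.
have gramf i j : \sum_x f i x * Num.conj (f j x) = M i j.
  rewrite -dot1 -[RHS]mul1r -zA -mulrA -wave_gram mulr_sumr.
  by apply: eq_bigr => x _; rewrite /f rmorphM mulrACA.
have gramg' i j : \sum_x g' i x * Num.conj (g' j x) = M i j.
  rewrite -dot2 -[RHS]mul1r -zA -mulrA -wave_gram mulr_sumr.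
  by apply: eq_bigr => x _; rewrite /g' rmorphM mulrACA.
exists (grid p N), b, f, g; split; first exact: bP.
- move=> i j; rewrite -gramf; apply: eq_bigr => x _.
  by rewrite invg1 (fin_act1 bP).
- move=> x i j; rewrite -(row0 _ W1 i) -(row0 _ W1 j) -b1E.
  rewrite {1}/coef fp_inlV bl -/(coef _ (f i) (f j) x).
  transitivity (z * Num.conj z * (A%:C * coef b1 (w1 i 0) (w1 j 0) x)).
    by rewrite -(wave_coef p r c0 b1P) -coefZ.
  by rewrite mulrA zA mul1r.
- move=> y i j; rewrite -(row0 _ W2 i) -(row0 _ W2 j) -b2E.
  transitivity (z * Num.conj z * (A%:C * coef b2 (w2 i 0) (w2 j 0) y)); last first.
    by rewrite mulrA zA mul1r.
  rewrite -(wave_coef p r c0 b2P) -coefZ -/(g' i) -/(g' j).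
  rewrite [RHS]/coef (reindex (theta p) (onW_bij _ (theta_bij p))).
  by rewrite /coef fp_inrV br; apply: eq_bigr => x _; rewrite {1}/g theta'K.
- move=> i; set m := rvform (row i W1) (row i W1).
  have mE : M i i = m%:C.
    by rewrite -rvdotvv -W1M !mxE; apply: eq_bigr => l _; rewrite !mxE.
  have [F FE] : exists F : {ffun grid p N -> R[i]^o}, forall x, F x = f i x.
    by exists [ffun x => f i x] => x; rewrite ffunE.
  have [Gf GE] : exists F : {ffun grid p N -> R[i]^o}, forall x, F x = g i x.
    by exists [ffun x => g i x] => x; rewrite ffunE.
  have rP := @l2formP R (grid p N).
  have FF : l2form F F = m.
    rewrite /l2form -cRe_sum; under eq_bigr => x _ do rewrite FE.
    by rewrite gramf mE.
  have GG : l2form Gf Gf = m.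
    rewrite /l2form -cRe_sum; under eq_bigr => x _ do rewrite GE.
    rewrite -[RHS]/(complex.Re m%:C) -mE -(gramg' i i).
    by rewrite [in RHS](reindex (theta p) (onW_bij _ (theta_bij p))).
  have -> : \sum_x cabs (g i x - f i x) ^+ 2 = l2form (Gf - F) (Gf - F).
    by rewrite l2formvv; apply: eq_bigr => x _; rewrite !ffunE GE FE.
  have -> : l2form (Gf - F) (Gf - F) = - 2 * l2form (Gf - F) F.
    rewrite !(rformE rP) FF GG (rformC rP F); lra.
  pose Bl := [set x : grid p N | (rnorm (@rvform R N) (grid_lift R x) <= r)%R]%SET.
  have nw : rnorm (@rvform R N) (w1 i) ^+ 2 = m.
    rewrite (sqr_rnorm (rvformP R N)); apply: complexI; rewrite -mE -dot1.
    by rewrite /rvdot rvdotvv.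
  have z2 : cabs z ^+ 2 = A^-1 by apply: complexI; rewrite cabs_sqr zz.
  (* 2 u v <= e v^2 + u^2 / e, for v = |f i x| and u the difference at x *)
  apply: (@le_trans _ _ (\sum_x (e * cabs (f i x) ^+ 2 +
      (x \in Bl)%:R * (A^-1 * 16 * c ^+ 2 * m / e)))).
    rewrite /l2form mulr_sumr; apply: ler_sum => x _; rewrite !ffunE GE FE.
    have [xB|xB] := boolP (x \in Bl); last first.
      have -> : f i x = 0.
        rewrite /f /wave cutoff_out ?mulr0// ltW// ltNge; move: xB; by rewrite inE.
      by rewrite conjC0 mulr0 cabs0 expr0n !mulr0 mul0r addr0.
    rewrite inE in xB.
    have wU : w1 i *m U = w2 i.
      by apply: rot_swap => //; rewrite -row_mul ?W1V ?W2V.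
    have lip := wave_lip r0 Uu wU xB (ctrack _ _ _ (ltW r0) cp xB) cr.
    have gf2 : cabs (g i x - f i x) ^+ 2 <= A^-1 * 16 * c ^+ 2 * m.
      have -> : A^-1 * 16 * c ^+ 2 * m = A^-1 * (4 * c * rnorm (@rvform R N) (w1 i)) ^+ 2.
        by rewrite !exprMn nw; ring.
      rewrite /g /g' /f -mulrBr cabsM exprMn z2 ler_wpM2l ?invr_ge0 ?(ltW mass0)//.
      by rewrite ler_pXn2r ?nnegrE ?cabs_ge0// !mulr_ge0 ?rnorm_ge0.
    have := Re_le_abs ((g i x - f i x) * Num.conj (f i x)).
    rewrite cabsM cabs_conj ler_norml => /andP[hre _].
    move: (complex.Re _) (cabs (g i x - f i x)) (cabs (f i x)) (A^-1 * 16 * c ^+ 2 * m) hre gf2.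
    move=> t u v B hre gf2; rewrite mul1r; apply: (@le_trans _ _ (2 * (u * v))); first lra.
    apply: (@le_trans _ _ (e * v ^+ 2 + u ^+ 2 / e)).
      have -> : e * v ^+ 2 + u ^+ 2 / e = 2 * (u * v) + (e * v - u) ^+ 2 / e.
        by field; rewrite lt0r_neq0.
      by rewrite lerDl divr_ge0 ?sqr_ge0// ltW.
    by rewrite lerD2l ler_pM2r ?invr_gt0.
  rewrite big_split -mulr_sumr /= -mulr_suml -natr_sum.
  have -> : (\sum_x (x \in Bl) = #|Bl|)%N.
    by rewrite -sum1_card [RHS]big_mkcond; apply: eq_bigr => x _; case: (x \in Bl).
  have -> : \sum_x cabs (f i x) ^+ 2 = m.
    by rewrite -FF l2formvv; apply: eq_bigr => x _; rewrite FE.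
  apply: (@le_trans _ _ (e * m + e * m)).
    rewrite lerD2l.
    apply: (@le_trans _ _ (e' * A * (A^-1 * 16 * c ^+ 2 * m / e))).
      rewrite ler_wpM2r// !mulr_ge0 ?invr_ge0 ?sqr_ge0 ?(ltW mass0) ?(ltW e0)//.
      exact: rv0.
    have -> : e' * A * (A^-1 * 16 * c ^+ 2 * m / e) = e * m * (16 * c ^+ 2 / (16 * c ^+ 2 + 1)).
      by rewrite /e'; field; rewrite !lt0r_neq0.
    apply: ler_piMr; first by rewrite mulr_ge0 ?(ltW e0) ?rv0.
    by rewrite ler_pdivrMr// mul1r lerDl.
  apply: (@le_trans _ _ (e * T + e * T)).
    by apply: lerD; rewrite ler_wpM2l ?(ltW e0)// Tge.
  by rewrite -mulr2n -mulr_natl mulrCA /e divfK// mulf_neq0 ?lt0r_neq0.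
Qed.
End Glue.

(** * Following words letter by letter *)

Section Restrict.
Variables (R : realType) (G K : groupType) (h : K -> G).
Hypothesis hM : {morph h : x y / (x * y)%g}.
Variables (H : hilbertSpace R) (pi : unirep G H).

Fact restrict1 v : pi (h 1%g) v = v.
Proof. by rewrite (morph_one hM) rep_map1. Qed.

Fact restrictM x y v : pi (h (x * y)%g) v = pi (h x) (pi (h y) v).
Proof. by rewrite hM rep_mapM. Qed.

Definition rep_restrict : unirep K H :=
  @UniRep R K H (fun x => pi (h x)) restrict1 restrictM
    (fun x => rep_unitary pi (h x)).

End Restrict.

(** A vector in the kernel has x M x^* >= d |x|^2. *)
Lemma gram_unitmx (R : realType) (H : hilbertSpace R) k (v : 'I_k -> H) (d : R) :
  0 < d -> gram_mx v + (d%:C)%:M \in unitmx.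
Proof.
move=> d0; rewrite -row_free_unit -kermx_eq0; apply/eqP/row_matrixP => i.
rewrite row0; move: (row _ _) (row_sub i (kermx (gram_mx v + (d%:C)%:M))) => x.
move=> /sub_kermxP xM; have g0 := gram_mx_ge0 v x.
have gx : (x *m gram_mx v *m x^t*) 0 0 + d%:C * (rvform x x)%:C = 0.
  have := congr1 (fun y => (y *m x^t*) 0 0) xM.
  rewrite mulmxDr mulmxDl mul_mx_scalar -scalemxAl mul0mx mxE [X in _ + X]mxE [RHS]mxE.
  by rewrite rvdotvv.
move: (_ 0 0) gx g0 => g gx g0.
have xx : rvform x x = 0.
  have := rform_ge0 (rvformP R k) x; rewrite le_eqVlt => /orP[/eqP //|x0].
  have : 0 < g + d%:C * (rvform x x)%:C.
    by rewrite ltr_wpDl// -rmorphM/= ltcR mulr_gt0.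
  by rewrite gx ltxx.
apply/rowP => c; rewrite mxE; apply/eqP; rewrite -normr_eq0 cabsE.
have := cabs_le_rnorm x c; rewrite /rnorm xx sqrtr0 => xc.
by apply/eqP; congr (_%:C); apply/eqP; rewrite eq_le xc cabs_ge0.
Qed.

Section FormSums.
Variables (R : realType) (T : Type) (s : seq T).

Lemma l2form_sum (X : finType) (c : T -> R[i]) (F : T -> {ffun X -> R[i]^o}) :
  l2form (\sum_(t <- s) c t *: F t) (\sum_(t <- s) c t *: F t) =
  complex.Re (\sum_(t <- s) \sum_(u <- s) c t * Num.conj (c u) *
    \sum_x F t x * Num.conj (F u x)).
Proof.
have rP := @l2formP R X; rewrite (rform_suml rP) cRe_sum; apply: eq_bigr => t _.
rewrite (rform_sumr rP) cRe_sum; apply: eq_bigr => u _.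
rewrite /l2form -cRe_sum mulr_sumr; congr complex.Re; apply: eq_bigr => x _.
by rewrite !ffunE rmorphM /= mulrACA.
Qed.

Lemma hs_form_sum (H : hilbertSpace R) (c : T -> R[i]) (F : T -> H) :
  complex.Re (hs_dot H (\sum_(t <- s) c t *: F t) (\sum_(t <- s) c t *: F t)) =
  complex.Re (\sum_(t <- s) \sum_(u <- s) c t * Num.conj (c u) * hs_dot H (F t) (F u)).
Proof.
have rP := hs_dot_real_form H.
have := rform_suml rP s (fun t => c t *: F t) (\sum_(t <- s) c t *: F t); rewrite /= => ->.
rewrite cRe_sum; apply: eq_bigr => t _.
have := rform_sumr rP s (fun t => c t *: F t) (c t *: F t); rewrite /= => ->.
rewrite cRe_sum; apply: eq_bigr => u _.
by rewrite hs_dotZl hs_dotZr mulrA.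
Qed.

Lemma delta_form_sum k (c : T -> R[i]) (i : T -> 'I_k) :
  0 <= complex.Re (\sum_(t <- s) \sum_(u <- s) c t * Num.conj (c u) * (i t == i u)%:R).
Proof.
have <- : l2form (\sum_(t <- s) c t *: ([ffun j => (j == i t)%:R] : {ffun 'I_k -> R[i]^o}))
    (\sum_(t <- s) c t *: ([ffun j => (j == i t)%:R] : {ffun 'I_k -> R[i]^o})) =
    complex.Re (\sum_(t <- s) \sum_(u <- s) c t * Num.conj (c u) * (i t == i u)%:R).
  rewrite l2form_sum; congr complex.Re; apply: eq_bigr => t _; apply: eq_bigr => u _.
  congr (_ * _); rewrite (bigD1 (i t))//= !ffunE eqxx mul1r big1 ?addr0.
    by rewrite conjC_nat.
  by move=> j /negPf ji; rewrite ffunE ji mul0r.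
exact: (rform_ge0 (@l2formP R _)).
Qed.

End FormSums.

Section Words.
Variables G1 G2 : groupType.
Local Notation word := (seq (G1 + G2)).

(** The letters of a word act from the last to the first, so the vectors met on the
    way to pi(u) v are the pi(u') v for u' a suffix of u. *)
Fixpoint suffixes (u : word) : seq word :=
  u :: (if u is _ :: u' then suffixes u' else [::]).

Lemma suffixes_refl u : u \in suffixes u.
Proof. by case: u => [|s u]; rewrite /= mem_head. Qed.

Lemma suffixes_cons s u w : s :: u \in suffixes w -> u \in suffixes w.
Proof.
elim: w => [|t w IHw] /=; rewrite !inE//.
by case/orP => [/eqP[_ ->]|/IHw ->]; rewrite ?suffixes_refl orbT.
Qed.

Definition letter (s : G1 + G2) : free_prod G1 G2 :=
  match s with inl x => fp_inl G2 x | inr y => fp_inr G1 y end.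

Lemma fp_pi_cons s u : fp_pi (s :: u) = (letter s * fp_pi u)%g.
Proof. by case: s => z; rewrite [RHS]fp_mul_pi. Qed.

End Words.

Section WordModel.
Variables (R : realType) (L G1 G2 : groupType).
Variables (alpha1 : group_action L G1) (alpha2 : group_action L G2).
Hypotheses (FD1 : property_FD_relative R alpha1) (FD2 : property_FD_relative R alpha2).
Variables (H : hilbertSpace R) (pi : unirep (free_prod G1 G2) H).

(** F u stands for pi(u) v, in a permutation representation sigma. Apply [glue] to
    the vectors pi(u) v for u in ws. A letter of G1 acts on the functions f of
    [glue] with nearly the coefficients of pi, and a letter of G2 does so on the
    functions g, which are within t of the f. As the Gram matrix is exact, expanding
    |sigma(s) F u - F (s :: u)|^2 only involves the diagonal of M and one such
    coefficient: the result is at most 8 d, namely 2 d from the diagonal and 6 d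
    from the coefficient. *)
Lemma word_model (ws : seq (seq (G1 + G2))) (v : H) (d t : R) :
  0 < d -> 0 < t -> 8 * d <= t ^+ 2 ->
  [::] \in ws -> (forall s u, s :: u \in ws -> u \in ws) ->
  exists (X : finType) (b : free_prod G1 G2 -> X -> X)
      (bP : fin_action (free_prod_action alpha1 alpha2) b)
      (F : seq (G1 + G2) -> l2hilbert R X),
    (forall u w, u \in ws -> w \in ws ->
      hs_dot (l2hilbert R X) (F u) (F w) =
      hs_dot H (pi (fp_pi u) v) (pi (fp_pi w) v) + d%:C *+ (u == w)) /\
    forall s u, s :: u \in ws ->
      rnorm (@l2form R X) (perm_rep R (fin_act1 bP) (fin_actM bP) (letter s) (F u) - F (s :: u))
        <= 3 * t.
Proof.
move=> d0 t0 dt ws0 wsC.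
pose k := size ws.
have idxP u : u \in ws -> (index u ws < k)%N by rewrite /k index_mem.
pose vv (i : 'I_k) := pi (fp_pi (nth [::] ws i)) v.
pose s1 : seq G1 := pmap (fun z => if z is inl x then Some x else None) (flatten ws).
pose s2 : seq G2 := pmap (fun z => if z is inr x then Some x else None) (flatten ws).
pose E1 (j : 'I_(size s1)) := nth 1%g s1 j.
pose E2 (j : 'I_(size s2)) := nth 1%g s2 j.
have E1P x u : inl x :: u \in ws -> exists j, E1 j = x.
  move=> xu; have xs1 : x \in s1.
    rewrite mem_pmap; apply/mapP; exists (inl x) => //.
    by apply/flattenP; exists (inl x :: u); rewrite ?mem_head.
  by exists (Ordinal (etrans (index_mem x s1) xs1)); rewrite /E1 /= nth_index.
have E2P x u : inr x :: u \in ws -> exists j, E2 j = x.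
  move=> xu; have xs1 : x \in s2.
    rewrite mem_pmap; apply/mapP; exists (inr x) => //.
    by apply/flattenP; exists (inr x :: u); rewrite ?mem_head.
  by exists (Ordinal (etrans (index_mem x s2) xs1)); rewrite /E2 /= nth_index.
pose pi1 := rep_restrict (@fp_inlM G1 G2) pi.
pose pi2 := rep_restrict (@fp_inrM G1 G2) pi.
have [n1 [a1 [W1 [a1P W1M W1E]]]] := FD_exact_gram FD1 pi1 vv E1 d0.
have [n2 [a2 [W2 [a2P W2M W2E]]]] := FD_exact_gram FD2 pi2 vv E2 d0.
set M := gram_mx vv + (d%:C)%:M in W1M W2M.
have Munit : M \in unitmx by exact: gram_unitmx.
have ME i j : M i j = hs_dot H (vv i) (vv j) + d%:C *+ (i == j).
  by rewrite /M !mxE.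
have n1_gt0 : (0 < n1)%N.
  rewrite lt0n; apply/eqP => n1E; pose i0 : 'I_k := Ordinal (idxP _ ws0).
  have : 0 < M i0 i0.
    by rewrite ME eqxx mulr1n ltr_wpDl ?ltcR// -hs_normE exprn_ge0.
  rewrite -W1M mxE big1 ?ltxx// => c _.
  by move: (ltn_ord c); rewrite [X in (_ < X)%N]n1E.
pose c0 : 'I_(n1 + n2) := lshift n2 (Ordinal n1_gt0).
have eta0 : 0 < t ^+ 2 by rewrite exprn_gt0.
have [X [b [f [g [bP gramf fE gE fg]]]]] := glue a1P a2P W1M W2M Munit c0 eta0.
pose sigma := perm_rep R (fin_act1 bP) (fin_actM bP).
(* for u outside ws the index takes the default value i0 *)
pose i0 : 'I_k := Ordinal (idxP _ ws0).
pose idx u : 'I_k := insubd i0 (index u ws).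
have idxE u : u \in ws -> nat_of_ord (idx u) = index u ws.
  by move=> uws; rewrite /idx val_insubd idxP.
have vvE u : u \in ws -> vv (idx u) = pi (fp_pi u) v.
  by move=> uws; rewrite /vv idxE// nth_index.
have idx_eq u w : u \in ws -> w \in ws -> (idx u == idx w) = (u == w).
  move=> uws wws; apply/eqP/eqP => [e|-> //].
  by rewrite -[u](nth_index [::] uws) -[w](nth_index [::] wws) -!idxE// e.
pose F u : l2hilbert R X := [ffun x => f (idx u) x].
pose Gv u : l2hilbert R X := [ffun x => g (idx u) x].
have dotF u w : hs_dot (l2hilbert R X) (F u) (F w) = M (idx u) (idx w).
  rewrite -gramf; apply: eq_bigr => x _; rewrite !ffunE invg1.
  by rewrite (fin_act1 bP).
exists X, b, bP, F; split.
  by move=> u w uws wws; rewrite dotF ME !vvE// idx_eq.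
move=> s u suws; have uws := wsC _ _ suws.
have rP := @l2formP R X.
have distE (p q : X -> R[i]) z (P Q : l2hilbert R X) :
    P = [ffun x => p x] -> Q = [ffun x => q x] ->
    l2form (sigma z P - Q) (sigma z P - Q) = complex.Re (\sum_x p x * Num.conj (p x)) +
      complex.Re (\sum_x q x * Num.conj (q x)) - 2 * complex.Re (coef b p q z).
  move=> PE QE; rewrite !(rformE rP) (rformC rP Q).
  have -> : l2form (sigma z P) (sigma z P) = complex.Re (\sum_x p x * Num.conj (p x)).
    have := congr1 (@complex.Re R) (rep_unitary sigma z P P).
    rewrite /l2form -cRe_sum => ->; congr complex.Re; apply: eq_bigr => x _.
    by rewrite PE !ffunE.
  have -> : l2form Q Q = complex.Re (\sum_x q x * Num.conj (q x)).
    rewrite /l2form -cRe_sum; congr complex.Re; apply: eq_bigr => x _.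
    by rewrite QE !ffunE.
  have -> : l2form (sigma z P) Q = complex.Re (coef b p q z).
    rewrite /l2form -cRe_sum; congr complex.Re; apply: eq_bigr => x _.
    by rewrite perm_repE PE QE !ffunE.
  lra.
set i := idx u; set i' := idx (s :: u).
have vvS : vv i' = pi (letter s) (vv i).
  by rewrite !vvE// fp_pi_cons rep_mapM.
have MRe j : complex.Re (M j j) = complex.Re (hs_dot H (vv j) (vv j)) + d.
  by rewrite ME eqxx mulr1n cReD.
have same : hs_dot H (vv i) (vv i) = hs_dot H (vv i') (vv i').
  by rewrite vvS rep_unitary.
have close (y : R[i]) : cabs (y - hs_dot H (pi (letter s) (vv i)) (vv i')) <= 3 * d ->
    complex.Re (M i i) + complex.Re (M i' i') - 2 * complex.Re y <= 8 * d.
  rewrite -vvS !MRe same => yd.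
  have := Re_le_cabs (- (y - hs_dot H (vv i') (vv i'))).
  rewrite cabsN opprB cReB; move: yd; lra.
have t3 : t <= 3 * t by lra.
case: s => [x|y] in suws @i' vvS same close *.
- apply: le_trans t3; rewrite (rnorm_le rP) ?(ltW t0)//; apply: le_trans dt.
  rewrite (distE (f i) (f i') _ (F u) (F (inl x :: u)))//.
  have gr j : \sum_x f j x * Num.conj (f j x) = M j j.
    by rewrite -gramf; apply: eq_bigr => z _; rewrite invg1 (fin_act1 bP).
  rewrite !gr fE; apply: close.
  have [j jx] := E1P _ _ suws; have := W1E j i i'; by rewrite jx.
- have fg_t w : rnorm (@l2form R X) (Gv w - F w) <= t.
    rewrite (rnorm_le rP) ?(ltW t0)//; apply: le_trans (fg (idx w)).
    by rewrite l2formvv; apply: ler_sum => z _; rewrite !ffunE.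
  have Gt : rnorm (@l2form R X) (sigma (letter (inr y)) (Gv u) - Gv (inr y :: u)) <= t.
    rewrite (rnorm_le rP) ?(ltW t0)//; apply: le_trans dt.
    rewrite (distE (g i) (g i') _ (Gv u) (Gv (inr y :: u)))//.
    have gr j : \sum_x g j x * Num.conj (g j x) = M j j.
      have one : fp_inr G1 (1%g : G2) = 1%g by apply/fp_piP; exact: Word1r.
      have := gE 1%g j j; rewrite one -W2M /coef invg1 mxE => e1.
      have -> : \sum_c W2 j c * (W2^t*) c j = \sum_c W2 j (a2 1^-1%g c) * Num.conj (W2 j c).
        by apply: eq_bigr => c _; rewrite invg1 (fin_act1 a2P) !mxE.
      by rewrite -e1; apply: eq_bigr => z _; rewrite (fin_act1 bP).
    rewrite !gr gE; apply: close.
    have [j jx] := E2P _ _ suws; have := W2E j i i'; by rewrite jx.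
  rewrite -/sigma.
  have -> : sigma (letter (inr y)) (F u) - F (inr y :: u) =
      (sigma (letter (inr y)) (Gv u) - Gv (inr y :: u)) -
      sigma (letter (inr y)) (Gv u - F u) + (Gv (inr y :: u) - F (inr y :: u)).
    by rewrite linearB opprB [RHS]addrAC [X in _ = X + _]addrA subrK [RHS]addrC addrA subrK.
  apply: le_trans (rnormD rP _ _) _; apply: le_trans (lerD (rnormB rP _ _) (fg_t _)) _.
  have : rnorm (@l2form R X) (sigma (letter (inr y)) (Gv u - F u)) <= t.
    apply: le_trans (fg_t u); rewrite le_eqVlt; apply/orP; left; apply/eqP.
    congr Num.sqrt.
    have := congr1 (@complex.Re R) (rep_unitary sigma (letter (inr y)) (Gv u - F u) (Gv u - F u)).
    by rewrite /l2form -!cRe_sum.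
  by move: Gt; lra.
Qed.

End WordModel.

Section ApproximatingRep.
Variables (R : realType) (L G1 G2 : groupType).
Variables (alpha1 : group_action L G1) (alpha2 : group_action L G2).
Hypotheses (FD1 : property_FD_relative R alpha1) (FD2 : property_FD_relative R alpha2).

(** Along a word each letter costs at most 3 t, so sigma(a) F [::] is close to the sum
    of the a_g F g. The Gram matrix of the F g is that of the pi(g) v plus d on
    the diagonal, which can only make the sum longer than pi(a) v. *)
Lemma approx_rep (H : hilbertSpace R) (pi : unirep (free_prod G1 G2) H)
    (a : group_algebra R (free_prod G1 G2)) (v : H) (e : R) :
  `|v| <= 1 -> 0 < e ->
  exists (K : hilbertSpace R) (sigma : unirep (free_prod G1 G2) K) (w : K),
    [/\ FD_class (free_prod_action alpha1 alpha2) sigma, `|w| <= 1 &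
      complex.Re `|rep_alg pi a v| - e <= complex.Re `|rep_alg sigma a w|].
Proof.
move=> v1 e0; set P := complex.Re _.
have P0 : 0 <= P by exact: Re_norm_ge0.
pose supp : seq (free_prod G1 G2) := monalg.msupp a.
pose rep (g : free_prod G1 G2) : seq (G1 + G2) := generic_quotient.repr g.
have repK g : fp_pi (rep g) = g by rewrite /fp_pi reprK.
(* B t bounds the error accumulated along all the words of the support *)
pose B : R := \sum_(g <- supp) cabs (monalg.mcoeff g a) * (3 * (size (rep g))%:R).
have B0 : 0 <= B by apply: sumr_ge0 => g _; rewrite !mulr_ge0 ?cabs_ge0.
pose t := e / (2 * (B + 1)).
have t0 : 0 < t by rewrite divr_gt0// mulr_gt0// ltr_wpDl.
(* 8 d <= t^2 is required by word_model; d <= e / (2 (P + 1)) pays for dividing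
   F [::], of norm at most 1 + d, to make it a unit vector *)
pose d := Num.min (t ^+ 2 / 8) (e / (2 * (P + 1))).
have d0 : 0 < d.
  by rewrite lt_min !divr_gt0 ?exprn_gt0// mulr_gt0// ltr_wpDl.
have dt : 8 * d <= t ^+ 2.
  have : d <= t ^+ 2 / 8 by rewrite ge_min lexx.
  lra.
have dP : P * d <= e / 2.
  have : d <= e / (2 * (P + 1)) by rewrite ge_min lexx orbT.
  rewrite ler_pdivlMr ?mulr_gt0 ?ltr_wpDl//; nra.
have Bt : B * t <= e / 2.
  by rewrite /t mulrA ler_pdivrMr ?mulr_gt0 ?ltr_wpDl//; nra.
pose ws := [::] :: flatten [seq suffixes (rep g) | g <- supp].
have wsS g : g \in supp -> rep g \in ws.
  move=> gs; rewrite inE; apply/orP; right; apply/flattenP.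
  by exists (suffixes (rep g)); [exact: map_f|exact: suffixes_refl].
have wsC s u : s :: u \in ws -> u \in ws.
  rewrite !inE /= => /flattenP[_ /mapP[g gs ->] su]; apply/orP; right.
  by apply/flattenP; exists (suffixes (rep g)); [exact: map_f|exact: suffixes_cons su].
have [X [b [bP [F [Fdot Fstep]]]]] :=
  word_model FD1 FD2 pi v d0 t0 dt (mem_head _ _) wsC.
set sigma := perm_rep R (fin_act1 bP) (fin_actM bP) in Fstep.
have rP := @l2formP R X.
have ReE (h : l2hilbert R X) : complex.Re `|h| = rnorm (@l2form R X) h by [].
have sigma_iso g (h : l2hilbert R X) : rnorm (@l2form R X) (sigma g h) = rnorm (@l2form R X) h.
  by rewrite -!ReE rep_isometry.
have word_step u : u \in ws ->
    rnorm (@l2form R X) (sigma (fp_pi u) (F [::]) - F u) <= 3 * t * (size u)%:R.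
  elim: u => [_|s u IHu suws].
    by rewrite [fp_pi [::]]/(1%g : free_prod G1 G2) rep_map1 subrr (rnorm0 rP) mulr0.
  rewrite fp_pi_cons rep_mapM.
  have -> : sigma (letter s) (sigma (fp_pi u) (F [::])) - F (s :: u) =
    sigma (letter s) (sigma (fp_pi u) (F [::]) - F u) + (sigma (letter s) (F u) - F (s :: u)).
    by rewrite linearB addrA subrK.
  apply: le_trans (rnormD rP _ _) _; rewrite sigma_iso /= -[(size u).+1%:R]natr1 mulrDr mulr1.
  by apply: lerD; [exact/IHu/wsC/suws|exact: Fstep].
pose S := \sum_(g <- supp) monalg.mcoeff g a *: F (rep g).
have S_close : rnorm (@l2form R X) (rep_alg sigma a (F [::]) - S) <= B * t.
  rewrite /rep_alg /S -sumrB; apply: le_trans (rnorm_sum rP _ _) _.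
  rewrite /B mulr_suml big_seq [leRHS]big_seq; apply: ler_sum => g gs; rewrite -scalerBr.
  have := word_step _ (wsS g gs); rewrite repK => h.
  have -> (z : R[i]) (y : l2hilbert R X) : rnorm (@l2form R X) (z *: y) = cabs z * rnorm (@l2form R X) y.
    by rewrite -!ReE normrZ !cabsE -rmorphM.
  by rewrite -mulrA ler_wpM2l ?cabs_ge0//; apply: le_trans h _; lra.
(* the additional d is a positive form in the coefficients of a *)
have S_ge : P <= rnorm (@l2form R X) S.
  rewrite /P Re_norm_rnorm /rnorm ler_sqrt; last exact: (rform_ge0 rP).
  rewrite /rep_alg hs_form_sum /S l2form_sum -subr_ge0.
  have -> : complex.Re (\sum_(g <- supp) \sum_(h <- supp) monalg.mcoeff g a *
        Num.conj (monalg.mcoeff h a) * \sum_x F (rep g) x * Num.conj (F (rep h) x)) =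
      complex.Re (\sum_(g <- supp) \sum_(h <- supp) monalg.mcoeff g a *
        Num.conj (monalg.mcoeff h a) * hs_dot H (pi g v) (pi h v)) +
      d * complex.Re (\sum_(g <- supp) \sum_(h <- supp) monalg.mcoeff g a *
        Num.conj (monalg.mcoeff h a) * (rep g == rep h)%:R).
    rewrite -cReZ -cReD; congr (complex.Re _).
    rewrite mulr_sumr -big_split !big_seq; apply: eq_bigr => g gs /=.
    rewrite mulr_sumr -big_split !big_seq; apply: eq_bigr => h hs /=.
    have dotE : \sum_x F (rep g) x * Num.conj (F (rep h) x) =
        hs_dot H (pi g v) (pi h v) + d%:C *+ (rep g == rep h).
      by have := Fdot _ _ (wsS g gs) (wsS h hs); rewrite !repK.
    rewrite dotE.
    by rewrite -[d%:C *+ _]mulr_natr; ring.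
  rewrite addrC addKr mulr_ge0 ?(ltW d0)//.
  have idxP g : (index (rep g) ws < (size ws).+1)%N by rewrite ltnS index_size.
  have := delta_form_sum supp (fun g => monalg.mcoeff g a)
    (fun g => inord (index (rep g) ws) : 'I_(size ws).+1).
  congr (0 <= complex.Re _); rewrite !big_seq; apply: eq_bigr => g gs.
  rewrite !big_seq; apply: eq_bigr => h hs; congr (_ * (nat_of_bool _)%:R).
  apply/eqP/eqP => [e1|->//].
  rewrite -(nth_index [::] (wsS g gs)) -(nth_index [::] (wsS h hs)); congr nth.
  by rewrite -(inordK (idxP g)) -(inordK (idxP h)) e1.
have F0_le : rnorm (@l2form R X) (F [::]) <= 1 + d.
  rewrite (rnorm_le rP); last by rewrite addr_ge0// ltW.
  have := Fdot _ _ (mem_head _ _) (mem_head _ _); rewrite eqxx mulr1n rep_unitary.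
  move=> /(congr1 (@complex.Re R)); rewrite cReD.
  have -> : complex.Re (hs_dot (l2hilbert R X) (F [::]) (F [::])) = l2form (F [::]) (F [::]).
    by rewrite /l2form -cRe_sum.
  move=> ->; rewrite [complex.Re d%:C]/=.
  have : complex.Re (hs_dot H v v) <= 1.
    have hP := hs_dot_real_form H; rewrite -(sqr_rnorm hP) -Re_norm_rnorm.
    rewrite expr_le1 ?Re_norm_ge0//; by rewrite -lecR Re_normK.
  have := d0; nra.
have d1 : 0 < 1 + d by rewrite addr_gt0.
exists (l2hilbert R X), sigma, ((1 + d)^-1%:C *: F [::]); split.
- exact: perm_rep_FD_class.
- rewrite -Re_normK -(rmorph1 (real_complex R)) lecR ReE (rnormZ rP) ?invr_ge0 ?(ltW d1)//.
  by rewrite ler_pdivrMl// mulr1.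
- rewrite rep_algZ ReE (rnormZ rP) ?invr_ge0 ?(ltW d1)// ler_pdivlMl//.
  have : rnorm (@l2form R X) S <= rnorm (@l2form R X) (rep_alg sigma a (F [::])) + B * t.
    have -> : S = rep_alg sigma a (F [::]) - (rep_alg sigma a (F [::]) - S) by rewrite opprB addrC subrK.
    by apply: le_trans (rnormB rP _ _) _; rewrite lerD2l.
  have : 0 <= e * d by rewrite mulr_ge0 ?ltW.
  move: S_ge; rewrite -/P; move: (rnorm _ _) (rnorm _ _) => x y; lra.
Qed.

End ApproximatingRep.

Theorem theorem5p20 (R : realType) (Lambda Gamma1 Gamma2 : groupType)
    (alpha1 : group_action Lambda Gamma1)
    (alpha2 : group_action Lambda Gamma2)
    (hFD1 : property_FD_relative R alpha1)
    (hFD2 : property_FD_relative R alpha2) :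
  property_FD_relative R (free_prod_action alpha1 alpha2).
Proof.
elim/quotW => s s0.
(* the Cauchy sequence s does not tend to 0 *)
have [e e0 big] : exists2 e : R, 0 < e & forall N, exists2 n, (N <= n)%N & e <= full_norm (val s n).
  apply: contrapT => h; apply: s0.
  apply/(@eqquotP _ (cauchy_equivR R (free_prod Gamma1 Gamma2)) (full_cstar R (free_prod Gamma1 Gamma2))).
  apply/asboolP/cvgr0Pnorm_lt => e e0; apply: contrapT => hn; apply: h.
  exists e => // N; apply: contrapT => hN; apply: hn; exists N => // n /= Nn.
  rewrite subr0 ger0_norm ?full_norm_ge0// ltNge; apply/negP => en.
  by apply: hN; exists n.
have e4 : 0 < e / 4 by rewrite divr_gt0.
have /asboolP/(_ _ e4)[N NP] := valP s.
have [n Nn en] := big N.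
have [H [pi [v [v1 piv]]]] : exists (H : hilbertSpace R) (pi : unirep (free_prod Gamma1 Gamma2) H) (v : H),
    `|v| <= 1 /\ 3 * (e / 4) < complex.Re `|rep_alg pi (val s n) v|.
  apply: contrapT => h; have : full_norm (val s n) <= 3 * (e / 4).
    apply: full_norm_le; first by rewrite mulr_ge0// ltW.
    move=> H pi; apply: opnorm_le => v v1; rewrite leNgt; apply/negP => hv.
    by apply: h; exists H, pi, v.
  lra.
have [K [sigma [w [Fs w1 sw]]]] := approx_rep hFD1 hFD2 pi (val s n) v1 e4.
exists K, sigma; split; first exact: Fs.
exists w => lim0.
have := @rep_cstarE R _ K sigma s w; rewrite lim0 => /cvgr0Pnorm_lt/(_ (e / 4)%:C).
rewrite ltcR => /(_ e4)[M _ MP].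
have := MP (maxn M N) (leq_maxl _ _); rewrite /= -Re_normK ltcR => small.
have := opnorm_ub sigma (val s n - val s (maxn M N)) w1.
move=> /le_trans/(_ (full_norm_ub _ _)).
have := NP n (maxn M N) Nn (leq_maxr _ _) => near /le_lt_trans/(_ near).
rewrite rep_algB.
have : complex.Re `|rep_alg sigma (val s n) w| <=
    complex.Re `|rep_alg sigma (val s n) w - rep_alg sigma (val s (maxn M N)) w| +
    complex.Re `|rep_alg sigma (val s (maxn M N)) w|.
  by rewrite -lecR rmorphD/= !Re_normK -[X in `|X| <= _](subrK (rep_alg sigma (val s (maxn M N)) w)) ler_normD.
lra.
Qed.
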